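(* (Racah.) Let $\overline x=x+\eta$ with $\eta\in\{0,+1,-1\}$ and $\overline{\boldsymbol\rho}=\overline\alpha,\overline\beta,\overline\gamma,\overline N$. Up to transformations of the parameters leaving the polynomials invariant, the whole list of non-trivial $A_2$-contiguity relations between $R_i(x;\boldsymbol\rho)=R^{(R)}_i(x;\boldsymbol\rho)$ and $R_i(\overline x;\overline{\boldsymbol\rho})$ is the following (in each case both the relation and its associated relation hold, with the given coefficients, determined up to rescaling, and $\lambda^+_{x,\boldsymbol\rho}=1$): (RI) $\eta=0$, $\overline\alpha=\alpha$, $\overline\beta=\beta+1$, $\overline\gamma=\gamma-1$, $\overline N=N-1$: $\Phi_i^{0,+}=\frac{(i+1+\alpha+\beta)(N-i)}{(2i+1+\alpha+\beta)N}$, $\Phi_i^{-1,+}=\frac{(i+1+\alpha+\beta+N)i}{(2i+1+\alpha+\beta)N}$, $\lambda^-_{x,\boldsymbol\rho}=\frac{(x+\gamma)(x-N)}{N}$, $\Phi_i^{0,-}=\frac{(i+1+\beta)(i+1+\alpha-\gamma)}{2i+2+\alpha+\beta}$, $\Phi_i^{1,-}=-\frac{(i+\beta+\gamma+1)(i+\alpha+1)}{2i+2+\alpha+\beta}$. (RII) $\eta=0$, $\overline\alpha=\alpha$, $\overline\beta=\beta+1$, $\overline\gamma=\gamma$, $\overline N=N$: $\Phi_i^{0,+}=\frac{(i+1+\alpha+\beta)(i+1+\beta+\gamma)}{(2i+1+\alpha+\beta)(1+\beta+\gamma)}$, $\Phi_i^{-1,+}=-\frac{i(i+\alpha-\gamma)}{(2i+1+\alpha+\beta)(1+\beta+\gamma)}$,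 $\lambda^-_{x,\boldsymbol\rho}=\frac{(x+\beta+\gamma+1)(N+\beta-x+1)}{1+\beta+\gamma}$, $\Phi_i^{0,-}=\frac{(i+2+\alpha+\beta+N)(i+1+\beta)}{2i+2+\alpha+\beta}$, $\Phi_i^{1,-}=\frac{(N-i)(i+1+\alpha)}{2i+2+\alpha+\beta}$. (RIII) $\eta=-1$, $\overline\alpha=\alpha+1$, $\overline\beta=\beta$, $\overline\gamma=\gamma+1$, $\overline N=N-1$: $\Phi_i^{0,+}=\frac{(i+1+\alpha+\beta)(i+1+\alpha)(N-i)(i+1+\beta+\gamma)}{(2i+1+\alpha+\beta)(1+\alpha)(1+\beta+\gamma)N}$, $\Phi_i^{-1,+}=\frac{i(i+\beta)(i+\alpha-\gamma)(i+1+\alpha+\beta+N)}{(2i+1+\alpha+\beta)(1+\alpha)(1+\beta+\gamma)N}$, $\lambda^-_{x,\boldsymbol\rho}=\frac{x(x+\gamma-N)}{(1+\alpha)(1+\beta+\gamma)N}$, $\Phi_i^{0,-}=\frac{1}{2i+2+\alpha+\beta}$, $\Phi_i^{1,-}=-\frac{1}{2i+2+\alpha+\beta}$. (RIV) $\eta=0$, $\overline\alpha=\alpha+1$, $\overline\beta=\beta$, $\overline\gamma=\gamma$, $\overline N=N$: $\Phi_i^{0,+}=\frac{(i+1+\alpha+\beta)(i+1+\alpha)}{(1+\alpha)(2i+1+\alpha+\beta)}$, $\Phi_i^{-1,+}=-\frac{i(i+\beta)}{(1+\alpha)(2i+1+\alpha+\beta)}$, $\lambda^-_{x,\boldsymbol\rho}=\frac{(x+1+\alpha)(N+\alpha-\gamma-x+1)}{1+\alpha}$,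 $\Phi_i^{0,-}=\frac{(i+2+\alpha+\beta+N)(i+1+\alpha-\gamma)}{2i+2+\alpha+\beta}$, $\Phi_i^{1,-}=\frac{(i+1+\beta+\gamma)(N-i)}{2i+2+\alpha+\beta}$. Moreover, for $\overline N\in\{N,N+1,N-1,N-2,N+2\}$, all contiguity relations of type $B_2$ and all those of type $B'_2$ for the Racah polynomials are obtained by applying $A_2$-contiguity relations twice.
   Context: Racah polynomials: for $\boldsymbol\rho=\alpha,\beta,\gamma,N$, $N$ a non-negative integer, $i=0,\dots,N$, $$R^{(R)}_i(x;\boldsymbol\rho)={}_4F_3\left({-i,\ i+\alpha+\beta+1,\ -x,\ x+\gamma-N\atop \alpha+1,\ \beta+\gamma+1,\ -N}\Big|\,1\right),$$ where ${}_{p+1}F_p\big({-i,a_1,\dots,a_p\atop b_1,\dots,b_p}|z\big)=\sum_{k=0}^i\frac{(-i,a_1,\dots,a_p)_k\,z^k}{(b_1,\dots,b_p)_k\,k!}$, $(b_1,\dots,b_p)_k=\prod_j(b_j)_k$, $(b)_k=\prod_{\ell=0}^{k-1}(b+\ell)$. $R_i$ has degree $i$ in $\lambda_{x,\boldsymbol\rho}=x(x+\gamma-N)$. Conventions. Parameters are generic. $\overline{\boldsymbol\rho}$ denotes modified parameters; one requires $\lambda_{x,\boldsymbol\rho}=\zeta\lambda_{\overline x,\overline{\boldsymbol\rho}}-\xi$ with constants $\zeta,\xi$, which here gives $\zeta=1$, $\xi=\eta(\gamma-N-\eta)$, $2\eta=\gamma-\overline\gamma+\overline N-N$. An $A_2$-contiguity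 relation is $$\lambda^+_{x,\boldsymbol\rho}R_i(x;\boldsymbol\rho)=\Phi^{0,+}_iR_i(\overline x;\overline{\boldsymbol\rho})+\Phi^{-1,+}_iR_{i-1}(\overline x;\overline{\boldsymbol\rho}),\quad i\ge0,\ \Phi^{-1,+}_0=0,\ \Phi^{0,+}_0\ne0,$$ and its associated relation is $$\lambda^-_{x,\boldsymbol\rho}R_i(\overline x;\overline{\boldsymbol\rho})=\Phi^{1,-}_iR_{i+1}(x;\boldsymbol\rho)+\Phi^{0,-}_iR_i(x;\boldsymbol\rho),\quad i\ge0,$$ with $\lambda^\pm$ independent of $i$ and $\Phi$'s independent of $x$ (terms with zero coefficient are omitted at the boundary of the index range). The trivial relation is $\eta=0$, $\overline{\boldsymbol\rho}=\boldsymbol\rho$. Contiguity relations of type $B_2$ (resp. $B'_2$) express $\lambda^+_{x,\boldsymbol\rho}R_i(x;\boldsymbol\rho)$ as a combination, with $x$-independent coefficients, of $R_{i+\epsilon}(\widetilde x;\widetilde{\boldsymbol\rho})$, $\epsilon\in\{1,0,-1\}$ (resp. $\epsilon\in\{0,-1,-2\}$); for these $\overline N$ denotes the integer parameter of the right-hand side polynomials. ''Applying $A_2$ relations twice'' means: for $B_2$, expand $R_i(x;\boldsymbol\rho)$ in $R_i,R_{i-1}$ at some $(\overline x,\overline{\boldsymbol\rho})$ by an $A_2$-contiguity relation and then expand these by the associated relation of an $A_2$-contiguity relation from $(\widetilde x,\widetilde{\boldsymbol\rho})$ to $(\overline x,\overline{\boldsymbol\rho})$; for $B'_2$, compose an $A_2$-contiguity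 relation from $(x,\boldsymbol\rho)$ to $(\overline x,\overline{\boldsymbol\rho})$ with one from $(\overline x,\overline{\boldsymbol\rho})$ to $(\widetilde x,\widetilde{\boldsymbol\rho})$.
   Formalization: Completeness, B2 and B2' are proved for all sufficiently large N (for N=1 the list is incomplete); B2 relations from a family to itself (recurrences, λ⁺ fixed only up to a constant) are sums of two composites; relations omitting a term of index above the target N hold on the grid. *)

(* Defs.v *)
From mathcomp Require Import all_boot all_order all_algebra.

Set Implicit Arguments.
Unset Strict Implicit.
Unset Printing Implicit Defensive.

Import Order.TTheory GRing.Theory Num.Theory.
Local Open Scope ring_scope.

Section Hypergeometric.
Variable K : numFieldType.

Definition poch (b : K) (k : nat) : K := \prod_(l < k) (b + l%:R).

(* Terminating (p+1)F(p)(-i, a ; b | z). *)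
Definition hypF (i : nat) (a b : seq K) (z : K) : K :=
  \sum_(k < i.+1)
    (\prod_(c <- - i%:R :: a) poch c k) * z ^+ k
      / ((\prod_(d <- b) poch d k) * (k`!)%:R).

End Hypergeometric.

Record racahParam (K : numFieldType) := RacahParam {
  rA : K;   (* alpha *)
  rB : K;   (* beta *)
  rC : K;   (* gamma *)
  rN : nat
}.

Section Racah.
Variable K : numFieldType.
Implicit Types (rho : racahParam K) (lam : K -> K) (Phi : int -> nat -> K).

(* Meaningful for i <= rN rho; beyond, the lower parameter -N makes a
   denominator vanish. *)
Definition racah rho (i : nat) (x : K) : K :=
  let: RacahParam a b c N := rho in
  hypF i [:: i%:R + a + b + 1; - x; x + c - N%:R]
         [:: a + 1; b + c + 1; - N%:R] 1.

Definition lattice rho (x : K) : K := x * (x + rC rho - (rN rho)%:R).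

(* Generic parameters: 1, alpha, beta, gamma are linearly independent over Z
   (equivalently over Q). *)
Definition generic rho : Prop :=
  forall m0 m1 m2 m3 : int,
    m0%:~R + m1%:~R * rA rho + m2%:~R * rB rho + m3%:~R * rC rho = 0 ->
    [/\ m0 = 0, m1 = 0, m2 = 0 & m3 = 0].

(* For all i <= N, R_i is defined (no vanishing denominator) and has degree
   exactly i in the lattice variable.  This is all that is asked of parameters
   that are unknowns of a classification. *)
Definition racah_wf rho : Prop :=
  [/\ poch (rA rho + 1) (rN rho) != 0,
      poch (rB rho + rC rho + 1) (rN rho) != 0 &
      forall i, (i <= rN rho)%N -> poch (i%:R + rA rho + rB rho + 1) i != 0].

(* rho and rho' differ by a transformation of the parameters that leaves the
   polynomials invariant. *)
Definition racah_same rho rho' : Prop :=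
  rN rho = rN rho' /\
  forall i, (i <= rN rho)%N -> forall x, racah rho i x = racah rho' i x.

Definition compatible_lattices rho (eta : int) rho' : Prop :=
  exists zeta xi : K,
    forall x, lattice rho x = zeta * lattice rho' (x + eta%:~R) - xi.

(* For 0 <= i <= N,
     lam(x) R_i(x; rho) = \sum_(e in E) Phi e i * R_(i+e)(x + eta; rho').
   Terms whose index i+e leaves the range 0..N' have zero coefficient and are
   omitted.  If no index exceeds N', this is an identity of functions of x.
   If some index exceeds N', it can only hold on the grid x + eta = 0, ..., N'
   of the polynomials on the right-hand side: a polynomial of degree N'+1
   vanishing on that grid has been dropped. *)
Definition contiguity (E : seq int) lam Phi rho (eta : int) rho' : Prop :=
  forall i : nat, (i <= rN rho)%N ->
    (forall e : int, e \in E -> ~~ (0 <= i%:Z + e <= (rN rho')%:Z) ->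
       Phi e i = 0) /\
    (forall x : K,
       (forall e : int, e \in E -> i%:Z + e <= (rN rho')%:Z) \/
       (exists2 m : nat, (m <= rN rho')%N & x + eta%:~R = m%:R) ->
       lam x * racah rho i x =
         \sum_(e <- E | 0 <= i%:Z + e <= (rN rho')%:Z)
            Phi e i * racah rho' (absz (i%:Z + e)) (x + eta%:~R)).

Definition A2_relation lamp Phip rho (eta : int) rhob : Prop :=
  [/\ racah_wf rho, racah_wf rhob, compatible_lattices rho eta rhob,
      contiguity [:: 0; -1] lamp Phip rho eta rhob & Phip 0 0%N != 0].

(* lam^-(x) R_i(x + eta; rhob) in terms of R_(i+1)(x; rho) and R_i(x; rho);
   the variable of [contiguity] is here y = x + eta. *)
Definition A2_associated lamm Phim rho (eta : int) rhob : Prop :=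
  contiguity [:: 1; 0] (fun y => lamm (y - eta%:~R)) Phim rhob (- eta) rho.

(* lam = 0 has to be excluded, otherwise the zero relation holds for all
   parameters. *)
Definition B2_relation lam Phi rho (eta : int) rhot : Prop :=
  [/\ racah_wf rho, racah_wf rhot, compatible_lattices rho eta rhot,
      contiguity [:: 1; 0; -1] lam Phi rho eta rhot &
      exists x, lam x != 0].

Definition B2'_relation lam Phi rho (eta : int) rhot : Prop :=
  [/\ racah_wf rho, racah_wf rhot, compatible_lattices rho eta rhot,
      contiguity [:: 0; -1; -2] lam Phi rho eta rhot &
      exists x, lam x != 0].

Definition A2_shifts : seq int := [:: 0; 1; -1].

(* The relation (lam, Phi) from rho to rhot is the result of expanding R_i(rho)
   at rhob by an A2-relation (lam1, P), then expanding at rhot by the associated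
   relation (lam2, Q) of an A2-relation from rhot to rhob. *)
Definition B2_from_A2 lam Phi rho (eta : int) rhot : Prop :=
  exists (rhob : racahParam K) (eta1 eta2 : int)
         (lam1 lam2p lam2 : K -> K) (P Qp Q : int -> nat -> K),
    [/\ [/\ eta1 \in A2_shifts, eta2 \in A2_shifts & eta1 = eta + eta2],
        A2_relation lam1 P rho eta1 rhob,
        A2_relation lam2p Qp rhot eta2 rhob /\
          A2_associated lam2 Q rhot eta2 rhob,
        forall x, lam x = lam1 x * lam2 (x + eta%:~R) &
        forall i : nat, (i <= rN rho)%N ->
          [/\ Phi 1 i = P 0 i * Q 1 i,
              Phi 0 i = P 0 i * Q 0 i + P (-1) i * Q 1 i.-1 &
              Phi (-1) i = P (-1) i * Q 0 i.-1]].

(* The relation (lam, Phi) is the composition of an A2-relation (lam1, P) from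
   rho to rhob with an A2-relation (lam2, Q) from rhob to rhot. *)
Definition B2'_from_A2 lam Phi rho (eta : int) rhot : Prop :=
  exists (rhob : racahParam K) (eta1 eta2 : int)
         (lam1 lam2 : K -> K) (P Q : int -> nat -> K),
    [/\ [/\ eta1 \in A2_shifts, eta2 \in A2_shifts & eta = eta1 + eta2],
        A2_relation lam1 P rho eta1 rhob,
        A2_relation lam2 Q rhob eta2 rhot,
        forall x, lam x = lam1 x * lam2 (x + eta1%:~R) &
        forall i : nat, (i <= rN rho)%N ->
          [/\ Phi 0 i = P 0 i * Q 0 i,
              Phi (-1) i = P 0 i * Q (-1) i + P (-1) i * Q 0 i.-1 &
              Phi (-2) i = P (-1) i * Q (-1) i.-1]].

End Racah.

Inductive racahCase := RI | RII | RIII | RIV.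

(* The cases in which the integer parameter becomes N - 1. *)
Definition lowersN (k : racahCase) : bool :=
  match k with RI | RIII => true | RII | RIV => false end.

Definition case_shift (k : racahCase) : int :=
  match k with RIII => -1 | _ => 0 end.

Section List.
Variable K : numFieldType.

Definition case_target (k : racahCase) (rho : racahParam K) : racahParam K :=
  let: RacahParam a b c N := rho in
  match k with
  | RI => RacahParam a (b + 1) (c - 1) N.-1
  | RII => RacahParam a (b + 1) c N
  | RIII => RacahParam (a + 1) b (c + 1) N.-1
  | RIV => RacahParam (a + 1) b c N
  end.

Definition case_lamm (k : racahCase) (rho : racahParam K) (x : K) : K :=
  let: RacahParam a b c n := rho in let N := n%:R : K in
  match k with
  | RI => (x + c) * (x - N) / N
  | RII => (x + b + c + 1) * (N + b - x + 1) / (1 + b + c)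
  | RIII => x * (x + c - N) / ((1 + a) * (1 + b + c) * N)
  | RIV => (x + 1 + a) * (N + a - c - x + 1) / (1 + a)
  end.

(* Phi^{0,+}, Phi^{-1,+} *)
Definition case_Phip (k : racahCase) (rho : racahParam K)
    (e : int) (j : nat) : K :=
  let: RacahParam a b c n := rho in
  let N := n%:R : K in let i := j%:R : K in
  if e == 0 then
    match k with
    | RI => (i + 1 + a + b) * (N - i) / ((2 * i + 1 + a + b) * N)
    | RII => (i + 1 + a + b) * (i + 1 + b + c)
               / ((2 * i + 1 + a + b) * (1 + b + c))
    | RIII => (i + 1 + a + b) * (i + 1 + a) * (N - i) * (i + 1 + b + c)
               / ((2 * i + 1 + a + b) * (1 + a) * (1 + b + c) * N)
    | RIV => (i + 1 + a + b) * (i + 1 + a) / ((1 + a) * (2 * i + 1 + a + b))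
    end
  else if e == -1 then
    match k with
    | RI => (i + 1 + a + b + N) * i / ((2 * i + 1 + a + b) * N)
    | RII => - (i * (i + a - c) / ((2 * i + 1 + a + b) * (1 + b + c)))
    | RIII => i * (i + b) * (i + a - c) * (i + 1 + a + b + N)
               / ((2 * i + 1 + a + b) * (1 + a) * (1 + b + c) * N)
    | RIV => - (i * (i + b) / ((1 + a) * (2 * i + 1 + a + b)))
    end
  else 0.

(* Phi^{0,-}, Phi^{1,-} *)
Definition case_Phim (k : racahCase) (rho : racahParam K)
    (e : int) (j : nat) : K :=
  let: RacahParam a b c n := rho in
  let N := n%:R : K in let i := j%:R : K in
  if e == 0 then
    match k with
    | RI => (i + 1 + b) * (i + 1 + a - c) / (2 * i + 2 + a + b)
    | RII => (i + 2 + a + b + N) * (i + 1 + b) / (2 * i + 2 + a + b)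
    | RIII => 1 / (2 * i + 2 + a + b)
    | RIV => (i + 2 + a + b + N) * (i + 1 + a - c) / (2 * i + 2 + a + b)
    end
  else if e == 1 then
    match k with
    | RI => - ((i + b + c + 1) * (i + a + 1) / (2 * i + 2 + a + b))
    | RII => (N - i) * (i + 1 + a) / (2 * i + 2 + a + b)
    | RIII => - (1 / (2 * i + 2 + a + b))
    | RIV => (i + 1 + b + c) * (N - i) / (2 * i + 2 + a + b)
    end
  else 0.

End List.

(* Main.v *)
Require Import Defs.
From mathcomp Require Import all_boot all_order all_algebra.
From mathcomp Require Import ring zify.
From Stdlib Require Import Classical.

Set Implicit Arguments.
Unset Strict Implicit.
Unset Printing Implicit Defensive.

Import Order.TTheory GRing.Theory Num.Theory.
Local Open Scope ring_scope.

(** Put A = alpha + 1, B = beta + gamma + 1, C = - N, u = gamma - N and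
    s = A + B + C - 1 - u = alpha + beta + 1.  As a polynomial in the lattice
    X = x (x + u), the Racah polynomial is
      R_i = sum_k w_(i,k) prod_(l < k) (l (l + u) - X),
      w_(i,k) = (-i)_k (i+s)_k / ((A)_k (B)_k (C)_k k!),
    which is symmetric in A, B, C.  In these coordinates the cases RIV, RII
    and RI raise A, B and C by one with u fixed, and RIII raises A, B, C by
    one and u by two while x becomes x - 1.  The four relations and their
    associated relations are identities between the coefficients w_(i,k)
    ([wt_up], [wt_dn], [wt_up'], [wt_dn']).  When i is the last index,
    C = - N kills a denominator; the identity then holds on the grid only,
    where the offending terms vanish.

    Conversely, let a relation from rho to rho' be given.  Its case i = 0 says
    that the multiplier is constant, or of degree one in the lattice.  So,
    after normalization to monic polynomials, it reads
      lam P_i = Q_(i+h) + c1(i) Q_(i+h-1) + c2(i) Q_(i+h-2)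
    with lam = 1, h = 0 or lam = X - kappa, h = 1 ([monic_rel]).  Both
    families satisfy a three-term recurrence
      X P_i = P_(i+1) + b(i) P_i + g(i) P_(i-1),
    where g is a rational function of i with eight explicit zeros and four
    explicit poles ([ttr], [ttr_coefE]).  Multiplication by X and comparison of
    the lowest terms gives, for the last nonzero coefficient c = c_m,
      g(i) c(i-1) = c(i) g'(i+h-m)
    ([relation_bottom]).  Now c(i) is a polynomial of bounded degree divided
    by known linear factors ([relation_coefs]), so for large N this is an
    identity of rational functions, and it forces the zeros of one side to be
    those of the other up to shifts by nonnegative integers ([match_roots]).
    Since the parameters are generic, a zero can only be matched with a zero of
    the same linear form, and there are integers t1, t2, t3, t4 such that, up
    to the exchange of A' and B',
      eta = - t1, A' = A + t1 + t2, B' = B + t1 + t3, C' = C + t1 + t4,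
    with ti + tj <= m - h and bounds on t1 + t2 + t3 + t4 ([classify_match]).
    The unit vectors are the four relations of the list, and the exchange of
    A' and B' is the transformation that leaves the polynomials invariant.
    The bounds leave the sums and the differences of two unit vectors, that is,
    the compositions of two relations, and three spurious families, which are
    excluded by expansion in the basis of the polynomials
    ([no_square_in_pencil], [no_linear_multiplier],
    [no_three_up_one_down]); see [classify_const] and [classify_linear].

    Finally the coefficients of a relation are determined by its multiplier,
    because the polynomials of index at most N' are independent on the grid
    ([contig_unique]).  A relation with a multiplier of degree one could still
    differ from the composition of two steps by a relation with a constant
    multiplier, but the latter does not exist, except between equal families
    of polynomials ([no_const_and_linear], [linear_unique]).  The
    recurrence relations of a single family have multipliers l1 X + l0; they
    are combinations of the relations obtained by going to the target of RIII,
    respectively of RIV, and back ([B2_trivial]). *)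

(** * Contiguity of the terms of a terminating hypergeometric sum *)

Section Pochhammer.
Variable K : numFieldType.
Implicit Types (b : K) (k n i : nat).

Lemma poch0 b : poch b 0 = 1.
Proof. by rewrite /poch big_ord0. Qed.

Lemma pochSr b k : poch b k.+1 = poch b k * (b + k%:R).
Proof. by rewrite /poch big_ord_recr. Qed.

Lemma pochSl b k : poch b k.+1 = b * poch (b + 1) k.
Proof.
rewrite /poch big_ord_recl /= addr0; congr (_ * _).
by apply: eq_bigr => l _; rewrite /bump /= add1n -addn1 natrD addrAC addrA.
Qed.

Lemma poch_neq0 b k : (poch b k != 0) = [forall l : 'I_k, b + l%:R != 0].
Proof.
rewrite /poch; apply/idP/forallP => [/prodf_neq0 H l | H]; first exact: H.
by apply/prodf_neq0.
Qed.

Lemma poch_neq0P b k :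
  reflect (forall l, (l < k)%N -> b + l%:R != 0) (poch b k != 0).
Proof.
rewrite poch_neq0; apply: (iffP forallP) => [H l lk | H l]; last exact: H.
exact: (H (Ordinal lk)).
Qed.

Lemma poch_neq0_le b k n : (k <= n)%N -> poch b n != 0 -> poch b k != 0.
Proof.
move=> kn /poch_neq0P H; apply/poch_neq0P => l lk; apply: H.
exact: leq_trans lk kn.
Qed.

(** The factor of index i vanishes. *)
Lemma poch_oppn_eq0 i k : (i < k)%N -> poch (- i%:R : K) k = 0.
Proof.
move=> ik; apply/eqP/negPn/negP => /poch_neq0P /(_ _ ik).
by rewrite addNr eqxx.
Qed.

Lemma poch_oppn_neq0 i k : (k <= i)%N -> poch (- i%:R : K) k != 0.
Proof.
move=> ki; apply/poch_neq0P => l lk.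
by rewrite addrC subr_eq0 eqr_nat neq_ltn (leq_trans lk ki).
Qed.

End Pochhammer.

Section Hyper.
Variable K : numFieldType.
Implicit Types (A B C u xi : K) (i k n : nat).

(** The parameter s that makes the sum with upper parameters -i, i + s, -x,
    x + u and lower parameters A, B, C balanced. *)
Definition ssum A B C u : K := A + B + C - 1 - u.

(** The points of the lattice; the base point xi allows two lattices that
    differ by a shift of x to share the same polynomial variable. *)
Definition node u xi (l : nat) : K := l%:R * (l%:R + u) - xi.

(** The Newton basis attached to the nodes, with sign (-1)^k. *)
Definition phi u xi k : {poly K} := \prod_(l < k) ((node u xi l)%:P - 'X).

(** The coefficients of the hypergeometric polynomial on the Newton basis. *)
Definition wt A B C u i k : K :=
  poch (- i%:R) k * poch (i%:R + ssum A B C u) k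
    / (poch A k * poch B k * poch C k * (k`!)%:R).

(** The hypergeometric polynomial, cut after n terms. *)
Definition RPn A B C u xi n i : {poly K} :=
  \sum_(k < n) wt A B C u i k *: phi u xi k.

(** The complete sum: the terms with k > i vanish. *)
Definition RP A B C u xi i := RPn A B C u xi i.+1 i.

Lemma wt_eq0 A B C u i k : (i < k)%N -> wt A B C u i k = 0.
Proof. by move=> ik; rewrite /wt poch_oppn_eq0 // !mul0r. Qed.

Lemma RPn_eq A B C u xi n i : (i < n)%N -> RPn A B C u xi n i = RP A B C u xi i.
Proof.
move=> lin; rewrite /RP /RPn -(subnKC lin) big_split_ord /= [X in _ + X]big1 ?addr0 //.
by move=> k _; rewrite wt_eq0 ?scale0r //= addSn ltnS leq_addr.
Qed.

Lemma wt_swap12 A B C u i k : wt A B C u i k = wt B A C u i k.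
Proof.
by rewrite /wt /ssum [A + B]addrC [poch A k * _]mulrC.
Qed.

Lemma wt_swap13 A B C u i k : wt A B C u i k = wt C B A u i k.
Proof.
rewrite /wt /ssum; congr (_ * poch (_ + (_ - 1 - u)) _ / (_ * _)); first by ring.
by ring.
Qed.

Lemma RPn_swap12 A B C u xi n i : RPn A B C u xi n i = RPn B A C u xi n i.
Proof. by apply: eq_bigr => k _; rewrite wt_swap12. Qed.

Lemma RPn_swap13 A B C u xi n i : RPn A B C u xi n i = RPn C B A u xi n i.
Proof. by apply: eq_bigr => k _; rewrite wt_swap13. Qed.

Lemma phiS u xi k : phi u xi k.+1 = phi u xi k * ((node u xi k)%:P - 'X).
Proof. by rewrite /phi big_ord_recr. Qed.

Lemma phi0 u xi : phi u xi 0 = 1.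
Proof. by rewrite /phi big_ord0. Qed.

(** Coefficients of the relation that raises A by one, and ([dn0], [dn1]) of
    the relation that lowers A + 1 back to A. *)
Definition up0 (A s : K) i : K := (i%:R + s) * (i%:R + A) / ((2 * i%:R + s) * A).
Definition up1 (A s : K) i : K := - (i%:R * (i%:R + s - A) / ((2 * i%:R + s) * A)).
Definition dn0 (B C s : K) i : K :=
  (i%:R + s + 1 - B) * (i%:R + s + 1 - C) / (2 * i%:R + s + 1).
Definition dn1 (B C s : K) i : K :=
  - ((i%:R + B) * (i%:R + C) / (2 * i%:R + s + 1)).

Lemma poch_predn i k :
  i%:R * poch (- i.-1%:R : K) k = (i%:R - k%:R) * poch (- i%:R) k.
Proof.
case: i => [|i]; first by case: k => [|k]; rewrite ?poch0 ?mul0r ?subrr ?mul0r // pochSl oppr0 mul0r mulr0.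
have := pochSl (- i.+1%:R : K) k; rewrite pochSr.
have -> : - i.+1%:R + 1 = - i%:R :> K by rewrite -natr1; ring.
move=> /= H; apply: oppr_inj; rewrite -!mulNr -H; ring.
Qed.

Lemma wt_up A B C u i k : A != 0 -> poch (A + 1) k != 0 ->
  2 * i%:R + ssum A B C u != 0 ->
  wt A B C u i k = up0 A (ssum A B C u) i * wt (A + 1) B C u i k
     + up1 A (ssum A B C u) i * wt (A + 1) B C u i.-1 k.
Proof.
move=> A0 A1 hs.
have E1 : ssum (A + 1) B C u = ssum A B C u + 1 by rewrite /ssum; ring.
rewrite /wt E1; move: hs; set s := ssum A B C u => hs.
have H1 : (i%:R + s) * poch (i%:R + (s + 1)) k = poch (i%:R + s) k * (i%:R + s + k%:R).
  by rewrite [i%:R + (s + 1)]addrA -pochSl pochSr.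
have H2 : A * poch (A + 1) k = poch A k * (A + k%:R) by rewrite -pochSl pochSr.
have H3 := poch_predn i k.
have Ak0 : A + k%:R != 0.
  apply/negP => /eqP Ak0; move/eqP: H2; rewrite Ak0 mulr0 mulf_eq0.
  by rewrite (negPf A0) (negPf A1).
have [i0|ip] := posnP i.
  rewrite i0 mulr0 add0r in hs *.
  case: k A1 {H1} H2 {H3} Ak0 => [|k] A1 H2 Ak0; last first.
    by rewrite oppr0 [poch 0 _]pochSl !mul0r !mulr0 addr0.
  rewrite !poch0 fact0 /up0 /up1 !mul0r oppr0 mul0r addr0 mulr0 !add0r !mul1r; rewrite invr1.
  by rewrite divff ?(mulf_neq0 hs A0) ?mulr1.
have Hi : poch (- i.-1%:R : K) k = (i%:R - k%:R) * poch (- i%:R) k / i%:R.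
  by rewrite -H3 mulrC mulKf // pnatr_eq0 -lt0n.
have ni : i%:R != 0 :> K by rewrite pnatr_eq0 -lt0n.
have Hs : poch (i.-1%:R + (s + 1)) k = poch (i%:R + s) k.
  by congr poch; rewrite -[in RHS](prednK ip) -natr1; ring.
rewrite Hs Hi -!(mulrA _ (poch B k)) -!(mulrA _ (poch B k * _)) !invfM.
have -> : poch A k = A * poch (A + 1) k / (A + k%:R) by rewrite H2 mulfK.
rewrite /up0 /up1.
move: (poch (A + 1) k) A1 (poch (- i%:R) k) (poch (i%:R + s) k) ((poch B k)^-1 * _)
  (poch (i%:R + (s + 1)) k) H1 => q q0 p r D' p1 H1.
move: (D' / _) => D {D'}.
apply/eqP; rewrite -subr_eq0; apply/eqP.
transitivity (- ((i%:R + A) * p * D / ((2 * i%:R + s) * A * q)) *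
  ((i%:R + s) * p1 - r * (i%:R + s + k%:R))); last by rewrite H1 subrr mulr0.
by field; rewrite hs A0 q0 ni Ak0.
Qed.

(** The factor A (A - u) - (k+1)(k+1+u) is the value of the multiplier at a
    node.  The last hypothesis avoids the zero of the denominator
    (A + 1)_(k+1), which is harmless when the numerator vanishes as well. *)
Lemma wt_dn A B C u i k : poch A k.+1 != 0 -> poch B k.+1 != 0 ->
  poch C k.+1 != 0 -> 2 * i%:R + ssum A B C u + 1 != 0 ->
  (A + k.+1%:R != 0) || (i < k.+1)%N ->
  (A * (A - u) - k.+1%:R * (k.+1%:R + u)) * wt (A + 1) B C u i k.+1
    + wt (A + 1) B C u i k
  = A * (dn1 B C (ssum A B C u) i * wt A B C u i.+1 k.+1
       + dn0 B C (ssum A B C u) i * wt A B C u i k.+1).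
Proof.
have E1 : ssum (A + 1) B C u = ssum A B C u + 1 by rewrite /ssum; ring.
have Eu : u = A + B + C - 1 - ssum A B C u by rewrite /ssum; ring.
rewrite /wt E1 {2 3}Eu; move: (ssum A B C u) => s {E1 Eu}.
move=> A0 B0 C0 hs hk.
have a0 : A != 0 by move/poch_neq0P: A0 => /(_ 0%N isT); rewrite addr0.
have EA : poch (A + 1) k = poch A k.+1 / A by rewrite pochSl mulrC mulKf.
have EA1 : poch (A + 1) k.+1 = poch A k.+1 * (A + k.+1%:R) / A.
  by rewrite pochSr EA -addrA nat1r mulrAC.
have Ei : poch (- i.+1%:R : K) k.+1 = - i.+1%:R * poch (- i%:R) k.
  by rewrite pochSl -natr1; congr (_ * poch _ _); ring.
have Es : poch (i%:R + s) k.+1 = (i%:R + s) * poch (i%:R + (s + 1)) k.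
  by rewrite pochSl addrA.
have Es1 : poch (i.+1%:R + s) k.+1 = poch (i%:R + (s + 1)) k.+1.
  by congr poch; rewrite -natr1; ring.
rewrite EA EA1 Ei Es Es1 factS natrM !(pochSr (- _)) !(pochSr (i%:R + _)).
move: B0 C0; rewrite !(pochSr B) !(pochSr C) !mulf_eq0 !negb_or => /andP[b0 b1] /andP[c0 c1].
have f0 : (k`!)%:R != 0 :> K by rewrite pnatr_eq0 -lt0n fact_gt0.
have k0 : 1 + k%:R != 0 :> K by rewrite nat1r pnatr_eq0.
rewrite /dn0 /dn1; have [ik|ki] := leqP i k; last first.
  have {}hk : A + k.+1%:R != 0 by case/orP: hk; rewrite // ltnNge ki.
  move: (poch A k.+1) A0 (poch B k) b0 (poch C k) c0 => a a1 b b0 c c0.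
  move: (poch (- i%:R) k) (poch (i%:R + _) k) (k`!)%:R f0 => p r f f0.
  rewrite -!(nat1r k) -!(nat1r i) in hk *; field.
  by rewrite k0 c1 b1 hk hs f0 c0 b0 a1 a0.
have pk : poch (- i%:R : K) k * (- i%:R + k%:R) = 0.
  by rewrite -pochSr poch_oppn_eq0.
rewrite pk !(mul0r, mulr0) addr0 add0r.
have [ik'|{}ki] := ltnP i k.
  by rewrite !(poch_oppn_eq0 _ ik') !(mul0r, mulr0).
have {}ki : k = i by apply/eqP; rewrite eqn_leq ki ik.
rewrite ki in A0 b0 b1 c0 c1 f0 k0 *.
move: (poch A i.+1) A0 (poch B i) b0 (poch C i) c0 => a a1 b b0 c c0.
move: (poch (- i%:R) i) (poch (i%:R + _) i) (i`!)%:R f0 => p r f f0.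
rewrite -!(nat1r i); field.
by rewrite k0 c1 b1 hs f0 c0 b0 a1 a0.
Qed.

(** The same for the relation that raises A, B, C by one and u by two. *)
Definition up0' A B C s i : K :=
  (i%:R + s) * (i%:R + A) * (i%:R + B) * (i%:R + C)
    / ((2 * i%:R + s) * (A * B * C)).
Definition up1' A B C s i : K :=
  - (i%:R * (i%:R + s - A) * (i%:R + s - B) * (i%:R + s - C)
    / ((2 * i%:R + s) * (A * B * C))).
Definition dn' s i : K := (2 * i%:R + s + 1)^-1.

Lemma wt_up' A B C u i k : A != 0 -> B != 0 -> C != 0 ->
  poch (A + 1) k != 0 -> poch (B + 1) k != 0 -> poch (C + 1) k != 0 ->
  2 * i%:R + ssum A B C u != 0 ->
  wt A B C u i k - (k.+1%:R * (k.+1%:R + u)) * wt A B C u i k.+1 =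
  up0' A B C (ssum A B C u) i * wt (A + 1) (B + 1) (C + 1) (u + 2) i k
    + up1' A B C (ssum A B C u) i * wt (A + 1) (B + 1) (C + 1) (u + 2) i.-1 k.
Proof.
have E1 : ssum (A + 1) (B + 1) (C + 1) (u + 2) = ssum A B C u + 1.
  by rewrite /ssum; ring.
have Eu : u = A + B + C - 1 - ssum A B C u by rewrite /ssum; ring.
rewrite /wt E1 {3}Eu; move: (ssum A B C u) => s {E1 Eu}.
move=> A0 B0 C0 A1 B1 C1 hs.
have H1 : (i%:R + s) * poch (i%:R + (s + 1)) k = poch (i%:R + s) k * (i%:R + s + k%:R).
  by rewrite [i%:R + (s + 1)]addrA -pochSl pochSr.
have H3 := poch_predn i k.
have E (X : K) : X != 0 -> poch (X + 1) k != 0 ->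
   X + k%:R != 0 /\ poch X k = X * poch (X + 1) k / (X + k%:R).
  move=> X0 X1; have H : X * poch (X + 1) k = poch X k * (X + k%:R).
    by rewrite -pochSl pochSr.
  have Xk : X + k%:R != 0.
    apply/negP => /eqP Xk; move/eqP: H; rewrite Xk mulr0 mulf_eq0.
    by rewrite (negPf X0) (negPf X1).
  by split => //; rewrite H mulfK.
have [Ak EA] := E _ A0 A1; have [Bk EB] := E _ B0 B1; have [Ck EC] := E _ C0 C1.
have f0 : (k`!)%:R != 0 :> K by rewrite pnatr_eq0 -lt0n fact_gt0.
have k0 : 1 + k%:R != 0 :> K by rewrite nat1r pnatr_eq0.
rewrite factS natrM (pochSl A) (pochSl B) (pochSl C) (pochSr (- _)) (pochSr (i%:R + s)).
rewrite EA EB EC /up0' /up1' {E EA EB EC}.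
have [i0|ip] := posnP i.
  rewrite i0 mulr0 add0r in hs *.
  case: k A1 B1 C1 {H1 H3} Ak Bk Ck f0 k0 => [|k] A1 B1 C1 Ak Bk Ck f0 k0; last first.
    by rewrite oppr0 [poch 0 _]pochSl !(mul0r, mulr0) subr0 addr0.
  rewrite !poch0 /= !addr0 in Ak Bk Ck *; field.
  by rewrite hs A0 B0 C0 /= oner_eq0.
have ni : i%:R != 0 :> K by rewrite pnatr_eq0 -lt0n.
have Hi : poch (- i.-1%:R : K) k = (i%:R - k%:R) * poch (- i%:R) k / i%:R.
  by rewrite -H3 mulrC mulKf.
have Hs : poch (i.-1%:R + (s + 1)) k = poch (i%:R + s) k.
  by congr poch; rewrite -[in RHS](prednK ip) -natr1; ring.
rewrite Hs Hi.
move: (poch (A + 1) k) A1 (poch (B + 1) k) B1 (poch (C + 1) k) C1 => a a1 b b1 c c1.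
move: (poch (- i%:R) k) (poch (i%:R + s) k) (poch (i%:R + (s + 1)) k) H1 => p r p1 H1.
rewrite -!(nat1r k); move: (k`!)%:R f0 => f f0.
apply/eqP; rewrite -subr_eq0; apply/eqP.
transitivity (- ((i%:R + A) * (i%:R + B) * (i%:R + C) * p
    / ((2 * i%:R + s) * (A * B * C) * (a * b * c * f))) *
  ((i%:R + s) * p1 - r * (i%:R + s + k%:R))); last by rewrite H1 subrr mulr0.
by field; rewrite ?A0 ?B0 ?C0 ?a1 ?b1 ?c1 ?f0 ?ni ?Ak ?Bk ?Ck ?k0 ?hs.
Qed.

Lemma wt_dn' A B C u i k : poch A k.+1 != 0 -> poch B k.+1 != 0 ->
  poch C k.+1 != 0 -> 2 * i%:R + ssum A B C u + 1 != 0 ->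
  wt (A + 1) (B + 1) (C + 1) (u + 2) i k =
  A * B * C * dn' (ssum A B C u) i * (wt A B C u i k.+1 - wt A B C u i.+1 k.+1).
Proof.
have E1 : ssum (A + 1) (B + 1) (C + 1) (u + 2) = ssum A B C u + 1.
  by rewrite /ssum; ring.
rewrite /wt E1; move: (ssum A B C u) => s {E1} A0 B0 C0 hs.
have Ei : poch (- i.+1%:R : K) k.+1 = - i.+1%:R * poch (- i%:R) k.
  by rewrite pochSl -natr1; congr (_ * poch _ _); ring.
have Es : poch (i%:R + s) k.+1 = (i%:R + s) * poch (i%:R + (s + 1)) k.
  by rewrite pochSl addrA.
have Es1 : poch (i.+1%:R + s) k.+1 = poch (i%:R + (s + 1)) k.+1.
  by congr poch; rewrite -natr1; ring.
have f0 : (k`!)%:R != 0 :> K by rewrite pnatr_eq0 -lt0n fact_gt0.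
have k0 : 1 + k%:R != 0 :> K by rewrite nat1r pnatr_eq0.
rewrite Ei Es Es1 factS natrM !(pochSr (- _)) !(pochSr (i%:R + _)) /dn'.
move: A0 B0 C0; rewrite !pochSl !mulf_eq0 !negb_or.
move=> /andP[a0 a1] /andP[b0 b1] /andP[c0 c1].
move: (poch (A + 1) k) a1 (poch (B + 1) k) b1 (poch (C + 1) k) c1 => a a1 b b1 c c1.
move: (poch (- i%:R) k) (poch (i%:R + _) k) (k`!)%:R f0 => p r f f0.
rewrite -!(nat1r k) -!(nat1r i); field.
by rewrite ?a0 ?b0 ?c0 ?a1 ?b1 ?c1 ?k0 ?hs ?f0.
Qed.

End Hyper.

(** * Contiguity of the polynomials *)

Section HyperPoly.
Variable K : numFieldType.
Implicit Types (A B C u xi : K) (i k n : nat).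

Lemma RPnS A B C u xi n i :
  RPn A B C u xi n.+1 i = RPn A B C u xi n i + wt A B C u i n *: phi u xi n.
Proof. by rewrite /RPn big_ord_recr. Qed.

Lemma wt0 A B C u i : wt A B C u i 0 = 1.
Proof. by rewrite /wt !poch0 fact0 !mulr1 divff ?oner_eq0. Qed.

Lemma RPn1 A B C u xi i : RPn A B C u xi 1 i = 1.
Proof. by rewrite /RPn big_ord1 wt0 phi0 scale1r. Qed.

Lemma RPn_up A B C u xi n i : A != 0 -> poch (A + 1) n.-1 != 0 ->
  2 * i%:R + ssum A B C u != 0 ->
  RPn A B C u xi n i = up0 A (ssum A B C u) i *: RPn (A + 1) B C u xi n i
    + up1 A (ssum A B C u) i *: RPn (A + 1) B C u xi n i.-1.
Proof.
move=> A0 A1 hs; rewrite /RPn !scaler_sumr -big_split /=; apply: eq_bigr => k _.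
rewrite !scalerA -scalerDl; congr (_ *: _); apply: wt_up => //.
apply: poch_neq0_le A1; have := ltn_ord k; lia.
Qed.

Lemma lin_phi u xi (a : K) k :
  ((a - xi)%:P - 'X) * phi u xi k
  = phi u xi k.+1 + (a - k%:R * (k%:R + u)) *: phi u xi k.
Proof.
rewrite phiS [_ * phi _ _ _]mulrC -[_ *: phi _ _ _]mulr_algr -mulrDr; congr (_ * _).
by rewrite alg_polyC /node !polyCB; ring.
Qed.

(** The remainder, a multiple of the basis element of degree n+1, vanishes
    on the grid of n+1 nodes. *)
Lemma RPn_dn A B C u xi n i : poch A n != 0 -> poch B n != 0 ->
  poch C n != 0 -> 2 * i%:R + ssum A B C u + 1 != 0 ->
  (A + n%:R != 0) || (i < n)%N ->
  ((A * (A - u) - xi)%:P - 'X) * RPn (A + 1) B C u xi n.+1 i =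
  (A * dn1 B C (ssum A B C u) i) *: RPn A B C u xi n.+1 i.+1
  + (A * dn0 B C (ssum A B C u) i) *: RPn A B C u xi n.+1 i
  + wt (A + 1) B C u i n *: phi u xi n.+1.
Proof.
move=> A0 B0 C0 hs; elim: n A0 B0 C0 => [|n IH] A0 B0 C0 hn.
  rewrite !RPn1 mulr1 wt0 scale1r -[LHS](mulr1 _) -(phi0 u xi) lin_phi phi0.
  rewrite addrC mul0r subr0 -scalerDl; congr (_ *: 1 + _).
  rewrite /dn0 /dn1 -mulrDr; congr (_ * _).
  have -> : u = A + B + C - 1 - ssum A B C u by rewrite /ssum; ring.
  have -> : ssum A B C (A + B + C - 1 - ssum A B C u) = ssum A B C u.
    by rewrite /ssum; ring.
  by move: (ssum _ _ _ _) hs => s hs; field.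
rewrite RPnS mulrDr IH; last first.
- by apply/orP; left; move/poch_neq0P: A0; apply.
- exact: poch_neq0_le C0.
- exact: poch_neq0_le B0.
- exact: poch_neq0_le A0.
rewrite -scalerAr lin_phi scalerDr scalerA !(RPnS _ _ _ _ _ n.+1).
have := wt_dn A0 B0 C0 hs hn.
move: (wt (A + 1) B C u i n.+1) (wt (A + 1) B C u i n) (wt A B C u i.+1 n.+1).
move: (wt A B C u i n.+1) (dn1 B C _ i) (dn0 B C _ i) => w1 d1 d0 w2 w3 w4.
move=> /(canRL (addKr _)) ->.
rewrite [A * (_ * _ + _)]mulrDr !mulrA !scalerDr !scalerA !scalerDl scaleNr.
rewrite [X in - (X *: _)]mulrC.
move: (_ *: RPn _ _ _ _ _ _ i.+1) (_ *: RPn _ _ _ _ _ _ i) => X Y.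
move: (_ *: phi u xi n.+1) (_ *: phi u xi n.+1) (_ *: phi u xi n.+1) => a b c.
by move: (_ *: phi u xi n.+2) => d; ring.
Qed.

Lemma node_shift u xi l : node u xi l.+1 = node (u + 2) (xi - u - 1) l.
Proof. by rewrite /node -natr1; ring. Qed.

(** Removal of the first node is a change of the base point. *)
Lemma phi_shift u xi k :
  phi u xi k.+1 = ((- xi)%:P - 'X) * phi (u + 2) (xi - u - 1) k.
Proof.
rewrite /phi big_ord_recl /= [node u xi 0]/node mul0r sub0r; congr (_ * _).
by apply: eq_bigr => l _; rewrite -node_shift /bump.
Qed.

Lemma phi_shift2 u xi k :
  phi u xi k.+1 = phi (u + 2) (xi - u - 1) k.+1
     - (k.+1%:R * (k.+1%:R + u)) *: phi (u + 2) (xi - u - 1) k.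
Proof.
rewrite phi_shift (phiS (u + 2)) -mul_polyC [LHS]mulrC [_%:P * _]mulrC -mulrBr.
by congr (_ * _); rewrite -node_shift /node !polyCB; ring.
Qed.

Lemma RPn_up' A B C u xi n i : A != 0 -> B != 0 -> C != 0 ->
  poch (A + 1) n.-1 != 0 -> poch (B + 1) n.-1 != 0 -> poch (C + 1) n.-1 != 0 ->
  2 * i%:R + ssum A B C u != 0 ->
  RPn A B C u xi n.+1 i =
  up0' A B C (ssum A B C u) i *:
    RPn (A + 1) (B + 1) (C + 1) (u + 2) (xi - u - 1) n i
  + up1' A B C (ssum A B C u) i *:
    RPn (A + 1) (B + 1) (C + 1) (u + 2) (xi - u - 1) n i.-1
  + wt A B C u i n *: phi (u + 2) (xi - u - 1) n.
Proof.
move=> A0 B0 C0; elim: n => [|n IH] A1 B1 C1 hs.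
  by rewrite RPn1 wt0 phi0 /RPn !big_ord0 !scaler0 !add0r scale1r.
rewrite RPnS IH //; last 3 first.
- by apply: poch_neq0_le A1; exact: leq_pred.
- by apply: poch_neq0_le B1; exact: leq_pred.
- by apply: poch_neq0_le C1; exact: leq_pred.
rewrite phi_shift2 !(RPnS _ _ _ _ _ n) !scalerDr !scalerA scalerN scalerA.
have := wt_up' A0 B0 C0 A1 B1 C1 hs => /(canRL (subrK _)).
move: (wt A B C u i n) (wt A B C u i n.+1) (up0' _ _ _ _ i) (up1' _ _ _ _ i).
move: (wt _ _ _ _ i n) (wt _ _ _ _ i.-1 n) => w1 w2 w3 w4 x y ->.
rewrite !scalerDl [X in - (X *: _)]mulrC.
move: (_ *: RPn _ _ _ _ _ n i) (_ *: RPn _ _ _ _ _ n i.-1) => X Y.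
move: (w4 *: _) (_ *: phi _ _ n) (_ *: phi _ _ n) (_ *: phi _ _ n).
by move=> a b c d; ring.
Qed.

Lemma RPn_dn' A B C u xi n i : poch A n != 0 -> poch B n != 0 ->
  poch C n != 0 -> 2 * i%:R + ssum A B C u + 1 != 0 ->
  ((- xi)%:P - 'X) * RPn (A + 1) (B + 1) (C + 1) (u + 2) (xi - u - 1) n i =
  (A * B * C * dn' (ssum A B C u) i) *:
     (RPn A B C u xi n.+1 i - RPn A B C u xi n.+1 i.+1).
Proof.
move=> A0 B0 C0 hs; elim: n A0 B0 C0 => [|n IH] A0 B0 C0.
  by rewrite !RPn1 subrr scaler0 /RPn !big_ord0 mulr0.
rewrite RPnS mulrDr IH ?(poch_neq0_le _ A0) ?(poch_neq0_le _ B0) ?(poch_neq0_le _ C0) //.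
rewrite (RPnS _ _ _ _ _ n.+1 i) (RPnS _ _ _ _ _ n.+1 i.+1) -scalerAr -phi_shift wt_dn' //.
move: (_ * dn' _ _) => c; rewrite -scalerA -scalerDr; congr (_ *: _).
by rewrite scalerBl; ring.
Qed.

End HyperPoly.

(** * Racah polynomials in hypergeometric coordinates *)

Section Bridge.
Variable K : numFieldType.
Implicit Types (rho : racahParam K) (i k n : nat).

(** The coordinates A, B, C, u and s of Racah parameters. *)
Definition pA rho : K := rA rho + 1.
Definition pB rho : K := rB rho + rC rho + 1.
Definition pC rho : K := - (rN rho)%:R.
Definition pu rho : K := rC rho - (rN rho)%:R.
Definition ps rho : K := rA rho + rB rho + 1.

Lemma ssumE rho : ssum (pA rho) (pB rho) (pC rho) (pu rho) = ps rho.
Proof. by rewrite /ssum /pA /pB /pC /pu /ps; ring. Qed.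

(** The Racah polynomial of index i, as a polynomial in the lattice minus xi. *)
Definition RQ rho xi i : {poly K} := RP (pA rho) (pB rho) (pC rho) (pu rho) xi i.

Lemma latticeE rho x : lattice rho x = x * (x + pu rho).
Proof. by rewrite /lattice /pu addrA. Qed.

Lemma horner_phi (u xi x : K) k :
  (phi u xi k).[x * (x + u) - xi] = poch (- x) k * poch (x + u) k.
Proof.
rewrite /phi horner_prod -big_split /=; apply: eq_bigr => l _.
by rewrite hornerD hornerN hornerC hornerX /node; ring.
Qed.

Lemma racahE rho xi i x : racah rho i x = (RQ rho xi i).[lattice rho x - xi].
Proof.
rewrite /RQ /RP /RPn latticeE horner_sum /racah; case: rho => a b c N /=.
apply: eq_bigr => k _; rewrite hornerZ horner_phi !big_cons !big_nil expr1n.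
rewrite /wt /ssum /pA /pB /pC /pu /= !mulr1 [x + (c - _)]addrA.
have -> : i%:R + (a + 1 + (b + c + 1) - N%:R - 1 - (c - N%:R)) = i%:R + a + b + 1.
  by ring.
by rewrite -!mulrA; congr (_ * (_ * _)); rewrite !mulrA [LHS]mulrC !mulrA.
Qed.

Lemma big2E (E F : int) (P : int -> bool) (f : int -> K) :
  \sum_(e <- [:: E; F] | P e) f e = (if P E then f E else 0) + (if P F then f F else 0).
Proof. by rewrite !big_cons big_nil; do 2!case: ifP; rewrite ?addr0 ?add0r. Qed.

Lemma big3E (E F G : int) (P : int -> bool) (f : int -> K) :
  \sum_(e <- [:: E; F; G] | P e) f e = (if P E then f E else 0)
    + (if P F then f F else 0) + (if P G then f G else 0).
Proof.
by rewrite !big_cons big_nil; do 3!case: ifP; rewrite ?addr0 ?add0r ?addrA.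
Qed.

(** Reduction of a relation with index shifts 0 and -1 to the identity of
    functions for i <= N', and to the grid when i = N = N' + 1. *)
Lemma contiguity_up lam Phi rho (eta : int) rho' :
  (rN rho <= (rN rho').+1)%N ->
  Phi (-1) 0%N = 0 ->
  (forall i x, (i <= rN rho)%N -> (i <= rN rho')%N -> lam x * racah rho i x =
     Phi 0 i * racah rho' i (x + eta%:~R)
     + Phi (-1) i * racah rho' i.-1 (x + eta%:~R)) ->
  ((rN rho' < rN rho)%N -> Phi 0 (rN rho) = 0 /\
     forall m x, (m <= rN rho')%N -> x + eta%:~R = m%:R ->
       lam x * racah rho (rN rho) x
       = Phi (-1) (rN rho) * racah rho' (rN rho).-1 m%:R) ->
  contiguity [:: 0; -1] lam Phi rho eta rho'.
Proof.
move=> hN P0 H1 H2 i iN; split.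
  move=> e; rewrite !inE => /orP[] /eqP -> h.
    have iN' : (rN rho' < i)%N by lia.
    have -> : i = rN rho by lia.
    by have [|//] := H2; lia.
  by have -> : i = 0%N by lia.
move=> x hx; rewrite big2E.
have [iN'|iN'] := leqP i (rN rho').
  rewrite H1 //; have -> : (0 <= i%:Z + 0 <= (rN rho')%:Z) = true by lia.
  rewrite addr0 absz_nat; congr (_ + _).
  case: i iN hx iN' => [|i] iN hx iN'.
    by rewrite P0 mul0r (_ : (0 <= 0%:Z - 1 <= (rN rho')%:Z) = false).

  have -> : (0 <= i.+1%:Z - 1 <= (rN rho')%:Z) = true by lia.
  by congr (_ * racah _ _ _); lia.
have e : i = rN rho by lia.
have [H3 H4] := H2 (leq_trans iN' iN).
case: hx => [/(_ 0)|[m mN hm]]; first by rewrite inE eqxx => /(_ isT); lia.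
have -> : (0 <= i%:Z - 1 <= (rN rho')%:Z) = true by lia.
have -> : (0 <= i%:Z + 0 <= (rN rho')%:Z) = false by lia.
rewrite e (H4 m) // hm add0r.
by congr (_ * racah _ _ _); lia.
Qed.

(** Reduction of a relation with index shifts 1 and 0 to the identity of
    functions for i < N', and to the grid when i = N = N'. *)
Lemma contiguity_dn lam Phi rho (eta : int) rho' :
  (rN rho <= rN rho')%N ->
  (forall i x, (i <= rN rho)%N -> (i < rN rho')%N -> lam x * racah rho i x =
     Phi 1 i * racah rho' i.+1 (x + eta%:~R)
     + Phi 0 i * racah rho' i (x + eta%:~R)) ->
  (rN rho' = rN rho -> Phi 1 (rN rho) = 0 /\
     forall m x, (m <= rN rho')%N -> x + eta%:~R = m%:R ->
       lam x * racah rho (rN rho) x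
       = Phi 0 (rN rho) * racah rho' (rN rho) m%:R) ->
  contiguity [:: 1; 0] lam Phi rho eta rho'.
Proof.
move=> hN H1 H2 i iN; split.
  move=> e; rewrite !inE => /orP[] /eqP -> h; last by lia.
  have -> : i = rN rho by lia.
  by have [|//] := H2; lia.
move=> x hx; rewrite big2E.
have [iN'|iN'] := ltnP i (rN rho').
  rewrite H1 //; have -> : (0 <= i%:Z + 0 <= (rN rho')%:Z) = true by lia.
  have -> : (0 <= i%:Z + 1 <= (rN rho')%:Z) = true by lia.
  by rewrite addr0 absz_nat; congr (_ * racah _ _ _ + _); lia.
have e : rN rho' = rN rho by lia.
have ei : i = rN rho by lia.
have [H3 H4] := H2 e.
case: hx => [/(_ 1)|[m mN hm]]; first by rewrite inE eqxx => /(_ isT); lia.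
have -> : (0 <= i%:Z + 0 <= (rN rho')%:Z) = true by lia.
have -> : (0 <= i%:Z + 1 <= (rN rho')%:Z) = false by lia.
by rewrite ei (H4 m) // hm add0r addr0 absz_nat.
Qed.

(** The choice of base point under which the two lattices coincide. *)
Lemma lattice_shift rho (eta : int) rho' xi :
  pu rho' = pu rho - 2 * eta%:~R -> xi = eta%:~R * (pu rho - eta%:~R) ->
  forall x, lattice rho' (x + eta%:~R) - xi = lattice rho x.
Proof. by move=> E -> x; rewrite !latticeE E; ring. Qed.

Lemma racah_shiftE rho (eta : int) rho' xi i x :
  pu rho' = pu rho - 2 * eta%:~R -> xi = eta%:~R * (pu rho - eta%:~R) ->
  racah rho' i (x + eta%:~R) = (RQ rho' xi i).[lattice rho x].
Proof. by move=> E1 E2; rewrite (racahE _ xi) (lattice_shift E1 E2). Qed.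

(** On the first n nodes the terms with k >= n vanish. *)
Lemma RQ_trunc rho xi n i x m : (n <= i)%N -> (m < n)%N ->
  x = m%:R * (m%:R + pu rho) - xi ->
  (RQ rho xi i).[x] =
  (RPn (pA rho) (pB rho) (pC rho) (pu rho) xi n i).[x].
Proof.
move=> ni mn ->; rewrite /RQ /RP -addn1 /RPn -(subnKC ni) -addnA big_split_ord /= hornerD.
rewrite [X in _ + X]horner_sum [X in _ + X]big1 ?addr0 // => k _.
by rewrite hornerZ horner_phi poch_oppn_eq0 ?mul0r ?mulr0 //=; lia.
Qed.

End Bridge.

Section Generic.
Variable K : numFieldType.
Implicit Types (rho : racahParam K) (i k n : nat).

(** A nontrivial integral combination of 1, alpha, beta, gamma is nonzero. *)
Lemma gen_ne rho (z : K) (m0 m1 m2 m3 : int) : generic rho ->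
  z = m0%:~R + m1%:~R * rA rho + m2%:~R * rB rho + m3%:~R * rC rho ->
  [|| m1 != 0, m2 != 0, m3 != 0 | m0 != 0] -> z != 0.
Proof.
move=> G -> H; apply/eqP => /G [e0 e1 e2 e3]; move: H.
by rewrite e0 e1 e2 e3 eqxx.
Qed.

Lemma generic_shift rho rho' (k1 k2 k3 : int) : generic rho ->
  rA rho' = rA rho + k1%:~R -> rB rho' = rB rho + k2%:~R ->
  rC rho' = rC rho + k3%:~R -> generic rho'.
Proof.
move=> G eA eB eC m0 m1 m2 m3; rewrite eA eB eC => H.
have [|e0 e1 e2 e3] := G (m0 + m1 * k1 + m2 * k2 + m3 * k3) m1 m2 m3.
  by rewrite -[RHS]H !intrD !intrM; ring.
by move: e0; rewrite e1 e2 e3 !mul0r !addr0.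
Qed.

Lemma generic_wf rho : generic rho -> racah_wf rho.
Proof.
move=> G; split.
- apply/poch_neq0P => l _; apply: (@gen_ne rho _ (l%:Z + 1) 1 0 0) => //.
  by rewrite intrD; ring.
- apply/poch_neq0P => l _; apply: (@gen_ne rho _ (l%:Z + 1) 0 1 1) => //.
  by rewrite intrD; ring.
- move=> i _; apply/poch_neq0P => l _; apply: (@gen_ne rho _ (i%:Z + l%:Z + 1) 1 1 0) => //.
  by rewrite !intrD; ring.
Qed.

End Generic.

(** * The four relations *)

Definition notRIII (k : racahCase) : bool :=
  if k is RIII then false else true.

Section FourRelations.
Variable K : numFieldType.
Implicit Types (rho : racahParam K) (k : racahCase) (i n : nat).

(** The parameters A, B, C with the one that is raised put first.  The value
    at RIII, where all three are raised, is irrelevant. *)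
Definition raised (k : racahCase) rho : K * K * K :=
  match k with
  | RI => (pC rho, pB rho, pA rho)
  | RII => (pB rho, pA rho, pC rho)
  | RIII | RIV => (pA rho, pB rho, pC rho)
  end.

Lemma raised_RPn k rho xi n i :
  RPn (pA rho) (pB rho) (pC rho) (pu rho) xi n i =
  RPn (raised k rho).1.1 (raised k rho).1.2 (raised k rho).2 (pu rho) xi n i.
Proof. by case: k => //=; [exact: RPn_swap13 | exact: RPn_swap12]. Qed.

Lemma raised_ssum k rho :
  ssum (raised k rho).1.1 (raised k rho).1.2 (raised k rho).2 (pu rho) = ps rho.
Proof.
by case: k; rewrite -ssumE /= /ssum; ring.
Qed.

Lemma target_pu k rho : (lowersN k -> (0 < rN rho)%N) ->
  pu (case_target k rho) = pu rho - 2 * (case_shift k)%:~R.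
Proof.
case: rho => a b c N; case: k => /= h; rewrite /pu /=; try ring.
  by rewrite -[in RHS](prednK (h isT)) -natr1; ring.
by rewrite -[in RHS](prednK (h isT)) -natr1; ring.
Qed.

Lemma target_pC k rho : (lowersN k -> (0 < rN rho)%N) ->
  pC (case_target k rho) = pC rho + (lowersN k)%:R.
Proof.
case: rho => a b c N; case: k => /= h; rewrite /pC /= ?addr0 //.
  by rewrite -[in RHS](prednK (h isT)) -natr1; ring.
by rewrite -[in RHS](prednK (h isT)) -natr1; ring.
Qed.

Lemma target_RPn k rho xi n i : (lowersN k -> (0 < rN rho)%N) ->
  notRIII k ->
  RPn (pA (case_target k rho)) (pB (case_target k rho)) (pC (case_target k rho))
    (pu (case_target k rho)) xi n i =
  RPn ((raised k rho).1.1 + 1) (raised k rho).1.2 (raised k rho).2 (pu rho) xi n i.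
Proof.
move=> h; have := target_pu h; have := target_pC h.
case: k h => //= h -> -> _; rewrite mulr0 subr0 ?addr0; case: rho h => a b c N /= _.
- rewrite RPn_swap13; congr RPn; rewrite /pB /=; ring.
- rewrite RPn_swap12; congr RPn; rewrite /pB /=; ring.
- by congr RPn.
Qed.

Lemma target_RPn' rho xi n i : (0 < rN rho)%N ->
  RPn (pA (case_target RIII rho)) (pB (case_target RIII rho))
    (pC (case_target RIII rho)) (pu (case_target RIII rho)) xi n i =
  RPn (pA rho + 1) (pB rho + 1) (pC rho + 1) (pu rho + 2) xi n i.
Proof.
move=> h; have := @target_pu RIII rho (fun _ => h).
have := @target_pC RIII rho (fun _ => h).
case: rho h => a b c N /= h -> ->; congr RPn; rewrite /pB /=; ring.
Qed.

Lemma case_Phip_up k rho i : (lowersN k -> (0 < rN rho)%N) ->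
  notRIII k ->
  case_Phip k rho 0 i = up0 (raised k rho).1.1 (ps rho) i /\
  case_Phip k rho (-1) i = up1 (raised k rho).1.1 (ps rho) i.
Proof.
case: rho => a b c N; case: k => //= h _; rewrite /up0 /up1 /pA /pB /pC /ps /=.
- have E : (2 * i%:R + (a + b + 1)) * - N%:R = - ((2 * i%:R + 1 + a + b) * N%:R).
    by ring.
  rewrite E invrN; split; [rewrite mulrN -mulNr | rewrite mulrN opprK]; congr (_ / _); ring.
- by split; congr (_ / _) || congr (- (_ / _)); ring.
- by split; congr (_ / _) || congr (- (_ / _)); ring.
Qed.

Lemma case_Phim_dn k rho i : (lowersN k -> (0 < rN rho)%N) ->
  notRIII k ->
  case_Phim k rho 0 i = dn0 (raised k rho).1.2 (raised k rho).2 (ps rho) i /\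
  case_Phim k rho 1 i = dn1 (raised k rho).1.2 (raised k rho).2 (ps rho) i.
Proof.
case: rho => a b c N; case: k => //= h _; rewrite /dn0 /dn1 /pA /pB /pC /ps /=;
  rewrite -?mulNr; split; congr (_ / _); ring.
Qed.

Lemma case_Phip_up' rho i :
  case_Phip RIII rho 0 i = up0' (pA rho) (pB rho) (pC rho) (ps rho) i /\
  case_Phip RIII rho (-1) i = up1' (pA rho) (pB rho) (pC rho) (ps rho) i.
Proof.
case: rho => a b c N; rewrite /up0' /up1' /pA /pB /pC /ps /=.
have E : (2 * i%:R + (a + b + 1)) * ((a + 1) * (b + c + 1) * - N%:R)
   = - ((2 * i%:R + 1 + a + b) * (1 + a) * (1 + b + c) * N%:R) by ring.
rewrite E invrN; split; [rewrite mulrN -mulNr | rewrite mulrN opprK]; congr (_ / _); ring.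
Qed.

Lemma case_Phim_dn' rho i :
  case_Phim RIII rho 0 i = dn' (ps rho) i /\
  case_Phim RIII rho 1 i = - dn' (ps rho) i.
Proof.
by case: rho => a b c N; rewrite /dn' /ps /= !mul1r; split; [|congr (- _)]; congr (_^-1); ring.
Qed.

Lemma case_lammE k rho (x : K) : (lowersN k -> (0 < rN rho)%N) ->
  notRIII k ->
  case_lamm k rho x = (((raised k rho).1.1 * ((raised k rho).1.1 - pu rho))%:P - 'X).[lattice rho x]
     / (raised k rho).1.1.
Proof.
rewrite latticeE hornerD hornerN hornerX hornerC.
case: rho => a b c N; case: k => //= h _; rewrite /pA /pB /pC /pu /=.
- rewrite invrN mulrN -mulNr; congr (_ / _); ring.
- congr (_ / _); ring.
- congr (_ / _); ring.
Qed.

Lemma case_lammE' rho (x : K) :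
  case_lamm RIII rho x = - lattice rho x / (pA rho * pB rho * pC rho).
Proof.
rewrite latticeE; case: rho => a b c N /=; rewrite /pA /pB /pC /pu /=.
rewrite [_ * - _]mulrN invrN mulrNN; congr (_ / _); ring.
Qed.

Section Generic1.
Variables (rho : racahParam K) (G : generic rho).

Lemma gen_pA_neq0 (k : int) : pA rho + k%:~R != 0.
Proof. by apply: (@gen_ne K rho _ (k + 1) 1 0 0 G) => //; rewrite /pA intrD; ring. Qed.

Lemma gen_pB_neq0 (k : int) : pB rho + k%:~R != 0.
Proof. by apply: (@gen_ne K rho _ (k + 1) 0 1 1 G) => //; rewrite /pB intrD; ring. Qed.

Lemma gen_poch_pA n : poch (pA rho) n != 0.
Proof. by apply/poch_neq0P => l _; apply: (gen_pA_neq0 l). Qed.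

Lemma gen_poch_pB n : poch (pB rho) n != 0.
Proof. by apply/poch_neq0P => l _; apply: (gen_pB_neq0 l). Qed.

Lemma gen_poch_pA1 n : poch (pA rho + 1) n != 0.
Proof.
by apply/poch_neq0P => l _; have := gen_pA_neq0 (1 + l%:Z); rewrite intrD addrA.
Qed.

Lemma gen_poch_pB1 n : poch (pB rho + 1) n != 0.
Proof.
by apply/poch_neq0P => l _; have := gen_pB_neq0 (1 + l%:Z); rewrite intrD addrA.
Qed.

Lemma poch_pC n : (n <= rN rho)%N -> poch (pC rho) n != 0.
Proof. exact: poch_oppn_neq0. Qed.

Lemma poch_pC1 n : (n < rN rho)%N -> poch (pC rho + 1) n != 0.
Proof.
move=> h; have := @poch_pC n.+1 h.
by rewrite pochSl mulf_eq0 negb_or => /andP[].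
Qed.

Lemma raised_neq0 k : (lowersN k -> (0 < rN rho)%N) ->
  notRIII k -> (raised k rho).1.1 != 0.
Proof.
case: k => //= h _.
- by rewrite oppr_eq0 pnatr_eq0 -lt0n h.
- by have := gen_pB_neq0 0; rewrite addr0.
- by have := gen_pA_neq0 0; rewrite addr0.
Qed.

Lemma raised_poch1 k n : (lowersN k -> (n < rN rho)%N) ->
  notRIII k -> poch ((raised k rho).1.1 + 1) n != 0.
Proof.
case: k => //= h _; [exact: poch_pC1 (h isT) | exact: gen_poch_pB1 | exact: gen_poch_pA1].
Qed.

Lemma raised_poch k n : (n <= rN rho)%N ->
  [/\ poch (raised k rho).1.1 n != 0, poch (raised k rho).1.2 n != 0
    & poch (raised k rho).2 n != 0].
Proof.
by move=> h; case: k => /=; rewrite gen_poch_pA gen_poch_pB poch_pC.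
Qed.

End Generic1.
End FourRelations.

Section FourRelations.
Variable K : numFieldType.
Implicit Types (rho : racahParam K) (k : racahCase) (i n : nat).

Lemma target_generic k rho : generic rho -> generic (case_target k rho).
Proof.
case: rho => a b c N G; case: k.
- apply: (generic_shift (k1 := 0) (k2 := 1) (k3 := -1) G) => /=; rewrite ?addr0 //.
- apply: (generic_shift (k1 := 0) (k2 := 1) (k3 := 0) G) => /=; rewrite ?addr0 //.
- apply: (generic_shift (k1 := 1) (k2 := 0) (k3 := 1) G) => /=; rewrite ?addr0 //.
- apply: (generic_shift (k1 := 1) (k2 := 0) (k3 := 0) G) => /=; rewrite ?addr0 //.
Qed.

Lemma target_rN k rho : rN (case_target k rho) = (rN rho - lowersN k)%N.
Proof. by case: rho => a b c N; case: k; rewrite /= ?subn0 ?subn1. Qed.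

Lemma target_compat k rho : (lowersN k -> (0 < rN rho)%N) ->
  compatible_lattices rho (case_shift k) (case_target k rho).
Proof.
move=> h; exists 1; exists ((case_shift k)%:~R * (pu rho - (case_shift k)%:~R)) => x.
by rewrite mul1r (lattice_shift (target_pu h) erefl).
Qed.

Section OneCase.
Variables (rho : racahParam K) (G : generic rho) (k : racahCase).
Hypothesis h : lowersN k -> (0 < rN rho)%N.

Lemma gen_ps_neq0 (i n : nat) : 2 * i%:R + ps rho + n%:R != 0.
Proof.
by apply: (@gen_ne K rho _ (2 * i%:Z + n%:Z + 1) 1 1 0 G) => //;
  rewrite /ps !intrD intrM; ring.
Qed.

(** For RI and i = N, the parameter raised is C = - N and the target has
    N' = N - 1: the identity is proved for the sum cut at k = N - 1. *)
Lemma case_contiguity_up : notRIII k ->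
  contiguity [:: 0; -1] (fun _ => 1) (case_Phip k rho) rho (case_shift k)
    (case_target k rho).
Proof.
move=> hk; have e0 : case_shift k = 0 by case: (k) hk.
have Hp i := case_Phip_up i h hk.
have hu : pu (case_target k rho) = pu rho by rewrite target_pu // e0 mulr0 subr0.
apply: contiguity_up.
- by rewrite target_rN; case: (lowersN k); lia.
- by have [_ ->] := Hp 0%N; rewrite /up1 !mul0r oppr0.
- move=> i x iN iN'; have [-> ->] := Hp i.
  rewrite mul1r e0 addr0 !(racahE _ 0) !subr0.
  have -> : lattice (case_target k rho) x = lattice rho x by rewrite !latticeE hu.
  rewrite /RQ -(@RPn_eq _ _ _ _ _ _ i.+1 i.-1); last by lia.
  rewrite -!hornerZ -hornerD /RP !target_RPn // (raised_RPn k) -(raised_ssum k).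
  rewrite -RPn_up //; first exact: raised_neq0.
    apply: raised_poch1 => // hl; rewrite /= -(prednK (h hl)) ltnS.
    by move: iN'; rewrite target_rN hl subn1.
  by rewrite raised_ssum; have := gen_ps_neq0 i 0; rewrite addr0.
- rewrite target_rN; case El : (lowersN k); last by lia.
  have N0 := h El; move=> _; have [E0 E1] := Hp (rN rho).
  have kRI : k = RI by case: (k) El hk.
  have Z0 : case_Phip k rho 0 (rN rho) = 0.
    by rewrite E0 kRI /up0 /= /pC subrr mulr0 mul0r.
  split=> // m x mN; rewrite e0 addr0 => ->; rewrite mul1r !(racahE _ 0) !subr0.
  have -> : lattice (case_target k rho) m%:R = lattice rho m%:R by rewrite !latticeE hu.
  rewrite (@RQ_trunc _ _ _ (rN rho) _ _ m) //; [|by lia|by rewrite latticeE subr0].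
  rewrite (raised_RPn k) RPn_up; first last.
  + by rewrite raised_ssum; have := gen_ps_neq0 (rN rho) 0; rewrite addr0.
  + by apply: raised_poch1 => // _; lia.
  + exact: raised_neq0.
  rewrite raised_ssum -E0 -E1 Z0 scale0r add0r hornerZ /RQ /RP -target_RPn //.
  by rewrite (RPn_eq _ _ _ _ _ (n := rN rho)) //; lia.
Qed.

Lemma case_contiguity_dn : notRIII k ->
  contiguity [:: 1; 0] (fun y => case_lamm k rho (y - (case_shift k)%:~R))
    (case_Phim k rho) (case_target k rho) (- case_shift k) rho.
Proof.
move=> hk; have e0 : case_shift k = 0 by case: (k) hk.
have Hp i := case_Phim_dn i h hk.
have hu : pu (case_target k rho) = pu rho by rewrite target_pu // e0 mulr0 subr0.
have X0 := raised_neq0 G h hk.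
have main i n x : (i <= n)%N -> (n <= rN rho)%N ->
   ((raised k rho).1.1 + n%:R != 0) || (i < n)%N ->
   case_lamm k rho x * (RPn (pA (case_target k rho)) (pB (case_target k rho)) (pC (case_target k rho))
    (pu (case_target k rho)) 0 n.+1 i).[lattice rho x] =
   case_Phim k rho 1 i * (RPn (pA rho) (pB rho) (pC rho) (pu rho) 0 n.+1 i.+1).[lattice rho x]
   + case_Phim k rho 0 i * (RPn (pA rho) (pB rho) (pC rho) (pu rho) 0 n.+1 i).[lattice rho x]
   + wt ((raised k rho).1.1 + 1) (raised k rho).1.2 (raised k rho).2 (pu rho) i n
      / (raised k rho).1.1 * (phi (pu rho) 0 n.+1).[lattice rho x].
  move=> lin nN hn; have [-> ->] := Hp i.
  rewrite case_lammE // target_RPn // !(raised_RPn k).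
  have [A0 B0 C0] := raised_poch G k nN.
  have hs : 2 * i%:R + ssum (raised k rho).1.1 (raised k rho).1.2 (raised k rho).2 (pu rho) + 1 != 0.
    by rewrite raised_ssum; exact: (gen_ps_neq0 i 1).
  have := RPn_dn 0 A0 B0 C0 hs hn => /(congr1 (fun p => p.[lattice rho x])).
  rewrite raised_ssum subr0 hornerM 3!(hornerD, hornerZ) => H.
  rewrite mulrAC H; move: (dn1 _ _ _ _) (dn0 _ _ _ _) (wt _ _ _ _ _ _) => d1 d0 w.
  by rewrite !hornerZ; field.
apply: contiguity_dn.
- by rewrite target_rN leq_subr.
- move=> i x iN' iN; rewrite e0 subr0 oppr0 addr0 !(racahE _ 0) !subr0.
  have -> : lattice (case_target k rho) x = lattice rho x by rewrite !latticeE hu.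
  have := main i i.+1 x (leqnSn i) iN; rewrite ltnSn orbT => /(_ isT).
  by rewrite wt_eq0 // !mul0r addr0 !RPn_eq // => H; exact: H.
- rewrite target_rN => hN; have nl : lowersN k = false.
    by case El: (lowersN k) hN => //; have := h El; lia.
  rewrite nl subn0; split.
    have [_ ->] := Hp (rN rho); rewrite /dn1.
    suff : (rN rho)%:R + (raised k rho).2 = 0 \/ (rN rho)%:R + (raised k rho).1.2 = 0.
      by case => ->; rewrite ?mulr0 !mul0r oppr0.
    by case: (k) hk nl => //= _ _; rewrite /pC subrr; left.
  move=> m x mN; rewrite e0 oppr0 addr0 subr0 => ->.
  rewrite !(racahE _ 0) !subr0.
  have -> : lattice (case_target k rho) m%:R = lattice rho m%:R by rewrite !latticeE hu.
  rewrite /RQ /RP main //; last first.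
    apply/orP; left; case: (k) hk nl => //= _ _; [exact: (gen_pB_neq0 G (rN rho))|exact: (gen_pA_neq0 G (rN rho))].
  have -> : case_Phim k rho 1 (rN rho) = 0.
    have [_ ->] := Hp (rN rho); rewrite /dn1.
    suff -> : (rN rho)%:R + (raised k rho).2 = 0 by rewrite mulr0 !mul0r oppr0.
    by case: (k) hk nl => //= _ _; rewrite /pC subrr.
  rewrite mul0r add0r latticeE -[_ * (_ + _)]subr0 horner_phi.
  by rewrite (poch_oppn_eq0 _ (k := (rN rho).+1)) ?mul0r ?mulr0 ?addr0 //.
Qed.

End OneCase.

Section CaseRIII.
Variables (rho : racahParam K) (G : generic rho) (N0 : (0 < rN rho)%N).

Let xi : K := - pu rho - 1.

Lemma lattice_RIII x : lattice (case_target RIII rho) (x + (-1)%:~R) - xi = lattice rho x.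
Proof.
apply: lattice_shift; first by rewrite (@target_pu _ RIII).
by rewrite /xi /=; ring.
Qed.

Lemma gen_ABC_neq0 : [/\ pA rho != 0, pB rho != 0 & pC rho != 0].
Proof.
have := gen_pA_neq0 G 0; have := gen_pB_neq0 G 0; rewrite !addr0 => -> ->; split=> //.
by rewrite oppr_eq0 pnatr_eq0 -lt0n.
Qed.

Lemma RIII_contiguity_up :
  contiguity [:: 0; -1] (fun _ => 1) (case_Phip RIII rho) rho (case_shift RIII)
    (case_target RIII rho).
Proof.
have Hp i := case_Phip_up' rho i; have [A0 B0 C0] := gen_ABC_neq0.
have xiE' : 0 - pu rho - 1 = xi by rewrite /xi; ring.
have main n i : (n <= rN rho)%N -> (0 < n)%N ->
   RPn (pA rho) (pB rho) (pC rho) (pu rho) 0 n.+1 i =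
   case_Phip RIII rho 0 i *: RPn (pA (case_target RIII rho)) (pB (case_target RIII rho))
      (pC (case_target RIII rho)) (pu (case_target RIII rho)) xi n i
   + case_Phip RIII rho (-1) i *: RPn (pA (case_target RIII rho)) (pB (case_target RIII rho))
      (pC (case_target RIII rho)) (pu (case_target RIII rho)) xi n i.-1
   + wt (pA rho) (pB rho) (pC rho) (pu rho) i n *: phi (pu rho + 2) xi n.
  move=> nN n0; have [-> ->] := Hp i; rewrite !target_RPn' // -ssumE -xiE'.
  apply: RPn_up' => //; rewrite ?ssumE; [exact: gen_poch_pA1|exact: gen_poch_pB1| |].
    by apply: poch_pC1; lia.
  by have := gen_ps_neq0 G i 0; rewrite addr0.
apply: contiguity_up.
- by rewrite target_rN /=; lia.
- by have [_ ->] := Hp 0%N; rewrite /up1' !mul0r oppr0.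
- move=> i x iN; rewrite target_rN /= => iN'; rewrite mul1r.
  rewrite (racahE rho 0) !(racahE _ xi) lattice_RIII subr0.
  have := @main i.+1 i; rewrite wt_eq0 // scale0r addr0 => /(_ _ _)/(congr1 (fun p => p.[lattice rho x])).
  rewrite hornerD !hornerZ (RPn_eq _ _ _ _ _ (n := i.+2)) // (RPn_eq _ _ _ _ _ (n := i.+1) (i := i.-1)); last by lia.
  by apply => //; lia.
- rewrite target_rN /= => _; have Z0 : case_Phip RIII rho 0 (rN rho) = 0.
    have [-> _] := Hp (rN rho); rewrite /up0' [_ + pC rho](_ : _ = 0) ?mulr0 ?mul0r //.
    by rewrite /pC subrr.
  split=> // m x mN xm; rewrite mul1r.
  rewrite (racahE rho 0) subr0 -xm !(racahE _ xi) lattice_RIII.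
  rewrite /RQ /RP main // Z0 scale0r add0r hornerD !hornerZ.
  rewrite (RPn_eq _ _ _ _ _ (n := rN rho)) /RP; last by lia.
  rewrite -[RHS]addr0; congr (_ + _); rewrite -lattice_RIII latticeE xm.
  have -> : pu (case_target RIII rho) = pu rho + 2 by rewrite (@target_pu _ RIII) //=; ring.
  by rewrite horner_phi poch_oppn_eq0 ?mul0r ?mulr0 //; lia.
Qed.

Lemma RIII_contiguity_dn :
  contiguity [:: 1; 0] (fun y => case_lamm RIII rho (y - (case_shift RIII)%:~R))
    (case_Phim RIII rho) (case_target RIII rho) (- case_shift RIII) rho.
Proof.
have Hp i := case_Phim_dn' rho i; have [A0 B0 C0] := gen_ABC_neq0.
have xiE' : 0 - pu rho - 1 = xi by rewrite /xi; ring.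
apply: contiguity_dn; first by rewrite target_rN leq_subr.
- move=> i y iN' iN; set x := y + (- case_shift RIII)%:~R.
  have -> : y = x + (-1)%:~R by rewrite /x /=; ring.
  have -> : x + (-1)%:~R - (case_shift RIII)%:~R = x by rewrite /=; ring.
  rewrite !(racahE rho 0) !(racahE _ xi) lattice_RIII !subr0 case_lammE'.
  have [-> ->] := Hp i.
  have hs : 2 * i%:R + ssum (pA rho) (pB rho) (pC rho) (pu rho) + 1 != 0.
    by rewrite ssumE; exact: (gen_ps_neq0 G i 1).
  have := RPn_dn' 0 (gen_poch_pA G i.+1) (gen_poch_pB G i.+1) (poch_pC iN) hs.
  move/(congr1 (fun p => p.[lattice rho x])).
  rewrite xiE' hornerM hornerD hornerN hornerX hornerC oppr0 add0r -target_RPn' //.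
  rewrite hornerZ ssumE hornerD hornerN !RPn_eq // -!/(RQ _ _ _) => H.
  rewrite mulrAC H; move: (dn' _ _) (pA rho) (pB rho) (pC rho) A0 B0 C0 => d A B C A0 B0 C0.
  by field; rewrite A0 B0 C0.
- rewrite target_rN /=; lia.
Qed.

End CaseRIII.

Lemma four_relations rho k : generic rho -> (lowersN k -> (0 < rN rho)%N) ->
  A2_relation (fun _ => 1) (case_Phip k rho)
       rho (case_shift k) (case_target k rho) /\
  A2_associated (case_lamm k rho) (case_Phim k rho)
       rho (case_shift k) (case_target k rho).
Proof.
move=> G h; split; last first.
  rewrite /A2_associated; case: k h => h; try exact: case_contiguity_dn.
  by apply: RIII_contiguity_dn => //; exact: h.
split.
- exact: generic_wf.
- by apply: generic_wf; exact: target_generic.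
- exact: target_compat.
- case: k h => h; try exact: case_contiguity_up.
  by apply: RIII_contiguity_up => //; exact: h.
- have s0 := gen_ps_neq0 G 0 0; rewrite mulr0 add0r addr0 in s0.
  have [hk|hk] : notRIII k \/ k = RIII.
    by case: (k); [left|left|right|left].
    have [-> _] := case_Phip_up 0 h hk; rewrite /up0 mulr0 !add0r.
    by rewrite divff ?oner_eq0 // mulf_neq0 // raised_neq0.
  rewrite hk; have [-> _] := case_Phip_up' rho 0; rewrite /up0' mulr0 !add0r.
  have [A0 B0 C0] := gen_ABC_neq0 G (h (etrans (congr1 lowersN hk) erefl)).
  by rewrite -!mulrA !mulf_neq0 ?invr_eq0 ?mulf_neq0.
Qed.

End FourRelations.

(** * Functions of the index that are polynomial, and matching of their zeros *)

Section PolyFun.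
Variable K : numFieldType.
Implicit Types (f g : K -> K) (p q : {poly K}) (d e : nat).

(** f is a polynomial function of degree at most d. *)
Definition polyfun d f := exists2 p : {poly K}, (size p <= d.+1)%N & forall z, f z = p.[z].

Lemma polyfun_le d e f : (d <= e)%N -> polyfun d f -> polyfun e f.
Proof. by move=> de [p sp fp]; exists p => //; apply: leq_trans sp _. Qed.

Lemma polyfun_ext d f g : f =1 g -> polyfun d f -> polyfun d g.
Proof. by move=> fg [p sp fp]; exists p => // z; rewrite -fg. Qed.

Lemma polyfun_const (c : K) : polyfun 0 (fun=> c).
Proof. by exists c%:P; rewrite ?size_polyC ?leq_b1 // => z; rewrite hornerC. Qed.

Lemma polyfun_id : polyfun 1 id.
Proof. by exists 'X; rewrite ?size_polyX // => z; rewrite hornerX. Qed.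

Lemma polyfun_add d f g : polyfun d f -> polyfun d g -> polyfun d (fun z => f z + g z).
Proof.
move=> [p sp fp] [q sq gq]; exists (p + q).
  by apply: leq_trans (size_polyD _ _) _; rewrite geq_max sp sq.
by move=> z; rewrite hornerD fp gq.
Qed.

Lemma polyfun_opp d f : polyfun d f -> polyfun d (fun z => - f z).
Proof. by move=> [p sp fp]; exists (- p) => [|z]; rewrite ?size_polyN ?hornerN ?fp. Qed.

Lemma polyfun_mul d e f g : polyfun d f -> polyfun e g -> polyfun (d + e) (fun z => f z * g z).
Proof.
move=> [p sp fp] [q sq gq]; exists (p * q).
  apply: leq_trans (size_polyMleq _ _) _.
  by rewrite -subn1 leq_subLR add1n -addnS -addSn leq_add.
by move=> z; rewrite hornerM fp gq.
Qed.

Lemma polyfun_shift d (a : K) f : polyfun d f -> polyfun d (fun z => f (z + a)).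
Proof.
move=> [p sp fp]; exists (p \Po ('X + a%:P)).
  by rewrite size_comp_poly2 // size_XaddC.
by move=> z; rewrite horner_comp hornerD hornerX hornerC fp.
Qed.

Lemma polyfun_prod (r : seq K) : polyfun (size r) (fun z => \prod_(x <- r) (z - x)).
Proof.
exists (\prod_(x <- r) ('X - x%:P)); first by rewrite size_prod_XsubC.
by move=> z; rewrite horner_prod; apply: eq_bigr => x _; rewrite !hornerE.
Qed.

Lemma poly_many_zeros p (m : nat) :
  (forall i, (i < size p)%N -> p.[(m + i)%:R] = 0) -> p = 0.
Proof.
move=> H; apply/eqP; rewrite -size_poly_eq0 -leqn0 leqNgt; apply/negP => sp.
have p0 : p != 0 by rewrite -size_poly_gt0.
have := max_poly_roots (rs := [seq (m + i)%:R | i <- iota 0 (size p)]) p0.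
rewrite size_map size_iota ltnn => H2; suff: false by []; apply: H2.
  apply/allP => x /mapP[i]; rewrite mem_iota add0n => /andP[_ ip] ->.
  by rewrite /root H.
rewrite map_inj_uniq ?iota_uniq // => i j /eqP.
by rewrite eqr_nat eqn_add2l => /eqP.
Qed.

Lemma polyfun_zero d f (m : nat) : polyfun d f ->
  (forall i : nat, (m <= i <= m + d)%N -> f i%:R = 0) -> forall z, f z = 0.
Proof.
move=> [p sp fp] H z; rewrite fp (@poly_many_zeros p m) ?horner0 // => i ip.
by rewrite -fp H // leq_addr leq_add2l -ltnS (leq_trans ip sp).
Qed.

Lemma coef_XaddC1_exp (n i : nat) : (('X + 1 : {poly K}) ^+ n)`_i = 'C(n, i)%:R.
Proof.
rewrite exprD1n coef_sum.
have [ni|ni] := ltnP i n.+1.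
  rewrite (bigD1 (Ordinal ni)) //= coefMn coefXn eqxx big1 ?addr0 // => j ji.
  rewrite coefMn coefXn; case: eqP => [e|]; last by rewrite mul0rn.
  by case/eqP: ji; apply: val_inj.
rewrite bin_small // big1 // => j _; rewrite coefMn coefXn.
by case: eqP => [e|]; rewrite ?mul0rn //; have := ltn_ord j; lia.
Qed.

(** Summation of a polynomial. *)
Lemma antidiff_poly d p : (size p <= d)%N ->
  exists P : {poly K}, [/\ (size P <= d.+1)%N, P.[0] = 0 &
    forall z, P.[z + 1] = P.[z] + p.[z]].
Proof.
elim: d p => [|d IH] p sp.
  exists 0; split; rewrite ?size_poly0 ?horner0 // => z.
  by move: sp; rewrite leqn0 size_poly_eq0 => /eqP ->; rewrite !horner0 addr0.
pose c := p`_d / d.+1%:R; pose D : {poly K} := ('X + 1) ^+ d.+1 - 'X^(d.+1).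
have d0 : d.+1%:R != 0 :> K by rewrite pnatr_eq0.
have [|P [sP P0 HP]] := IH (p - c *: D).
  apply/leq_sizeP => j dj; rewrite coefB coefZ /D coefB coef_XaddC1_exp coefXn.
  case: (ltngtP j d.+1) => hj.
  - have -> : j = d by lia.
    by rewrite subr0 binSn /c divfK // subrr.
  - by rewrite bin_small // !subr0 mulr0 subr0 (leq_sizeP _ _ sp) // ltnW.
  - by rewrite hj binn subrr mulr0 subr0 (leq_sizeP _ _ sp).
exists (P + c *: 'X^(d.+1)); split.
- apply: leq_trans (size_polyD _ _) _; rewrite geq_max leqW //=.
  by apply: leq_trans (size_scale_leq _ _) _; rewrite size_polyXn.
- by rewrite hornerD hornerZ hornerXn P0 expr0n /= mulr0 addr0.
- move=> z; rewrite !(hornerD, hornerZ, hornerXn) HP hornerD hornerN hornerZ /D.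
  by rewrite hornerD hornerN hornerXn horner_exp hornerD hornerX hornerC; ring.
Qed.

Lemma polyfun_antidiff d f : polyfun d f -> exists F, [/\ polyfun d.+1 F, F 0 = 0 &
  forall z, F (z + 1) = F z + f z].
Proof.
move=> [p sp fp]; have [P [sP P0 HP]] := antidiff_poly sp.
by exists (horner P); split=> //; [exists P | move=> z; rewrite HP fp].
Qed.

(** If p(z) T(z) = p(z - 1) R(z) with R and T split, then the roots of T are
    those of R moved to the right by nonnegative integers, of sum at most the
    degree of p.  A root of R that is not a root of T must be a root of p; the
    induction removes that root from p and moves the root of R by one. *)
Lemma match_roots (p : {poly K}) (r t : seq K) : p != 0 ->
  p * \prod_(x <- t) ('X - x%:P) = (p \Po ('X - 1)) * \prod_(x <- r) ('X - x%:P) ->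
  exists ks : seq nat, [/\ size ks = size r, (sumn ks <= (size p).-1)%N &
    perm_eq [seq x.1 + x.2%:R | x <- zip r ks] t].
Proof.
have [n] := ubnP (size p + size r); elim: n p r t => // n IH p r t hn p0 H.
case: r hn H => [|x r] hn H.
  exists [::]; split=> //=.
  have sp : size (p \Po ('X - 1)) = size p.
    by rewrite size_comp_poly2 // -['X - 1]/('X - 1%:P) size_XsubC.
  move: H; rewrite big_nil mulr1 => /(congr1 (size \o polyseq)) /=.
  rewrite sp size_Mmonic // ?monic_prod_XsubC // size_prod_XsubC.
  case: t => //= y t; rewrite addnS /= => /eqP.
  by rewrite -[X in _ == X]addn0 eqn_add2l.
have [xt|xt] := boolP (x \in t).
  have ht := perm_to_rem xt.
  move: H; rewrite (perm_big _ ht) /= !big_cons !mulrA ![_ * ('X - _)]mulrC -!mulrA.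
  have X0 : 'X - x%:P != 0 by rewrite polyXsubC_eq0.
  move=> /(mulfI X0) H.
  have [|ks [sk hk pk]] := IH p r (rem x t) _ p0 H.
    by move: hn => /=; lia.
  exists (0%N :: ks); split=> /=; rewrite ?sk ?add0n // addr0.
  by rewrite perm_sym (permPl ht) perm_cons perm_sym.
have px : root p x.
  have := congr1 (fun q => q.[x]) H; rewrite /= hornerM [in RHS]big_cons !hornerM.
  rewrite hornerXsubC subrr mul0r mulr0 => /eqP; rewrite mulf_eq0 => /orP[//|].
  by rewrite -/(root _ x) root_prod_XsubC (negPf xt).
have [q Hq] := factor_theorem _ _ px.
have q0 : q != 0 by apply: contraNneq p0 => q0; rewrite Hq q0 mul0r.
have X0 : 'X - x%:P != 0 by rewrite polyXsubC_eq0.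
have H' : q * \prod_(x <- t) ('X - x%:P)
        = (q \Po ('X - 1)) * \prod_(x <- (x + 1) :: r) ('X - x%:P).
  apply: (mulfI X0); rewrite mulrA [('X - _) * q]mulrC -Hq H Hq comp_polyM !big_cons.
  rewrite comp_polyB comp_polyX comp_polyC polyCD; ring.
have sq : size p = (size q).+1 by rewrite Hq size_Mmonic ?monicXsubC // size_XsubC addn2.
have [|ks [sk hk pk]] := IH q _ t _ q0 H'; first by rewrite sq addSn ltnS in hn.
case: ks sk hk pk => // k ks /= [sk] hk pk.
exists (k.+1 :: ks); split=> /=; first by rewrite sk.
  have : (0 < size q)%N by rewrite size_poly_gt0.
  by rewrite sq => h; rewrite /= addSn -(prednK h) ltnS.
by rewrite -nat1r addrA.
Qed.

End PolyFun.

(** * Monic polynomials and their highest coefficients *)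

Section Nodes.
Variables (K : numFieldType) (u xi : K).

(** The monic Newton basis. *)
Definition phi_monic (k : nat) : {poly K} := \prod_(l < k) ('X - (node u xi l)%:P).

Lemma phi_monicS k : phi_monic k.+1 = phi_monic k * ('X - (node u xi k)%:P).
Proof. by rewrite /phi_monic big_ord_recr. Qed.

Lemma phi_phi_monic k : phi u xi k = (-1) ^+ k *: phi_monic k.
Proof.
elim: k => [|k IH]; first by rewrite /phi /phi_monic !big_ord0 expr0 scale1r.
rewrite phiS phi_monicS IH exprS -scalerAl mulN1r scaleNr -scalerN -mulrN.
by congr (_ *: (_ * _)); rewrite opprB.
Qed.

Lemma phi_monic_monic k : phi_monic k \is monic.
Proof. exact: monic_prod_XsubC. Qed.

Lemma size_phi_monic k : size (phi_monic k) = k.+1.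
Proof.
elim: k => [|k IH]; first by rewrite /phi_monic big_ord0 size_poly1.
by rewrite phi_monicS size_Mmonic ?monic_neq0 ?phi_monic_monic ?monicXsubC // IH size_XsubC addn2.
Qed.

Lemma phi_monic_lead k : (phi_monic k)`_k = 1.
Proof. by have /monicP := phi_monic_monic k; rewrite lead_coefE size_phi_monic. Qed.

(** The two coefficients below the leading one depend polynomially on k. *)
Lemma phi_monic_coefs : exists E1 E2 : K -> K, [/\ polyfun 3 E1, polyfun 6 E2,
  forall k : nat, (phi_monic k.+1)`_k = - E1 k.+1%:R &
  forall k : nat, (phi_monic k.+2)`_k = E2 k.+2%:R].
Proof.
have pn : polyfun 2 (fun z : K => z * (z + u) - xi).
  apply: polyfun_add; first apply: (@polyfun_mul _ 1 1); try exact: polyfun_id.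
    by apply: polyfun_add; [exact: polyfun_id | apply: (@polyfun_le _ 0) => //; exact: polyfun_const].
  by apply: (@polyfun_le _ 0) => //; exact: polyfun_const.
have [E1 [p1 E10 E1S]] := polyfun_antidiff pn.
have [E2 [p2 E20 E2S]] := polyfun_antidiff (polyfun_mul pn p1).
have H1 : forall k : nat, (phi_monic k.+1)`_k = - E1 k.+1%:R.
  elim=> [|k IH].
    rewrite phi_monicS /phi_monic big_ord0 mul1r coefB coefX coefC eqxx sub0r.
    by rewrite -[1%:R]add0r E1S E10 add0r /node.
  rewrite phi_monicS mulrBr coefB coefMX coefMC IH phi_monic_lead mul1r /=.
  have -> : k.+2%:R = k.+1%:R + 1 :> K by rewrite natr1.
  by rewrite E1S /node; ring.
exists E1, E2; split=> //; elim=> [|k IH].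
  rewrite phi_monicS mulrBr coefB coefMX coefMC H1 /=.
  have E21 : E2 1 = 0 by rewrite -[1]add0r E2S E20 E10 mulr0 addr0.
  by rewrite (_ : 2%:R = 1 + 1) ?natr1 // E2S E21 /node; ring.
rewrite phi_monicS mulrBr coefB coefMX coefMC IH H1 /=.
have -> : k.+3%:R = k.+2%:R + 1 :> K by rewrite natr1.
by rewrite E2S /node; ring.
Qed.

End Nodes.

Section Monic.
Variables (K : numFieldType) (A B C u xi : K) (M : nat).
Let s := ssum A B C u.
Hypothesis A0 : poch A M != 0.
Hypothesis B0 : poch B M != 0.
Hypothesis C0 : poch C M != 0.
Hypothesis s0 : forall m, (0 < m < M.*2)%N -> m%:R + s != 0.

(** The leading coefficient of the polynomial of index i. *)
Definition leadP (i : nat) : K :=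
  poch (i%:R + ssum A B C u) i / (poch A i * poch B i * poch C i).

(** The monic polynomial of index i. *)
Definition mpol i : {poly K} := (leadP i)^-1 *: RP A B C u xi i.

(** Numerator and denominator of the coefficient [ttr_coef] of the lowest term
    in the three-term recurrence of the monic polynomials. *)
Definition ttr_num (z : K) : K := z * (z + ssum A B C u - 1) * (A + z - 1) * (B + z - 1) * (C + z - 1)
  * (z + ssum A B C u - A) * (z + ssum A B C u - B) * (z + ssum A B C u - C).
Definition ttr_den (z : K) : K := let w := 2 * z + ssum A B C u in (w - 2) * (w - 1) ^+ 2 * w.
Definition ttr_coef (z : K) : K := ttr_num z / ttr_den z.

Lemma leadP_neq0 i : (i <= M)%N -> leadP i != 0.
Proof.
move=> iM; rewrite /leadP mulf_neq0 //.
  apply/poch_neq0P => l li; rewrite addrAC -natrD; apply: s0; lia.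
by rewrite invr_eq0 !mulf_neq0 // (poch_neq0_le iM).
Qed.

Lemma wt_lead i : (i <= M)%N -> wt A B C u i i * (-1) ^+ i = leadP i.
Proof.
move=> iM; rewrite /wt /leadP.
have -> : poch (- i%:R : K) i = (-1) ^+ i * (i`!)%:R.
  elim: (i) => [|k IH]; first by rewrite poch0 fact0 expr0 mul1r.
  rewrite pochSl -natr1 opprD addrNK IH factS natrM exprS -natr1; ring.
have f0 : (i`!)%:R != 0 :> K by rewrite pnatr_eq0 -lt0n fact_gt0.
have e1 : (-1) ^+ i * (-1) ^+ i = 1 :> K by rewrite -exprMn mulrNN mulr1 expr1n.
rewrite mulrC; move: ((-1) ^+ i) (i`!%:R) f0 e1 => e f f0 e1.
rewrite !mulrA e1 mul1r invfM; move: (poch _ _) (_^-1) => p q.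
by rewrite mulrC; field.
Qed.

(** The coefficients of the monic polynomial on the monic Newton basis. *)
Definition monic_wt i k := wt A B C u i k * (-1) ^+ k / leadP i.

Lemma mpolE i : mpol i = \sum_(k < i.+1) monic_wt i k *: phi_monic u xi k.
Proof.
rewrite /mpol /RP /RPn scaler_sumr; apply: eq_bigr => k _.
by rewrite phi_phi_monic !scalerA /monic_wt; congr (_ *: _); rewrite -mulrA mulrC.
Qed.

Lemma monic_wt_lead i : (i <= M)%N -> monic_wt i i = 1.
Proof. by move=> iM; rewrite /monic_wt wt_lead // divff // leadP_neq0. Qed.

Lemma size_mpol_tail n i : (size (\sum_(k < n) monic_wt i k *: phi_monic u xi k)%R <= n)%N.
Proof.
elim: n => [|n IH]; first by rewrite big_ord0 size_poly0.
rewrite big_ord_recr /=; apply: leq_trans (size_polyD _ _) _.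
rewrite geq_max leqW //=; apply: leq_trans (size_scale_leq _ _) _.
by rewrite size_phi_monic.
Qed.

Lemma mpol_lead i : (i <= M)%N -> (mpol i)`_i = 1.
Proof.
move=> iM; rewrite mpolE big_ord_recr /= coefD coefZ phi_monic_lead monic_wt_lead // mul1r.
by rewrite nth_default ?add0r // size_mpol_tail.
Qed.

Lemma size_mpol_le i : (size (mpol i) <= i.+1)%N.
Proof. by rewrite mpolE size_mpol_tail. Qed.

Lemma size_mpol i : (i <= M)%N -> size (mpol i) = i.+1.
Proof.
move=> iM; apply/eqP; rewrite eqn_leq size_mpol_le /= ltnNge; apply/negP => h.
by have := mpol_lead iM; rewrite nth_default // => /eqP; rewrite eq_sym oner_eq0.
Qed.

Lemma monic_wt_pred i k : (k < i <= M)%N ->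
  monic_wt i k * ((i%:R - k%:R) * (i%:R + s + k%:R)) =
  monic_wt i k.+1 * ((A + k%:R) * (B + k%:R) * (C + k%:R) * k.+1%:R).
Proof.
move=> ki; rewrite /monic_wt /wt -/s factS natrM !pochSr exprS.
have kM : (k < M)%N by lia.
have [a0 b0 c0] : [/\ A + k%:R != 0, B + k%:R != 0 & C + k%:R != 0].
  by split; [move/poch_neq0P: A0|move/poch_neq0P: B0|move/poch_neq0P: C0]; apply.
have [a1 b1 c1] : [/\ poch A k != 0, poch B k != 0 & poch C k != 0].
  by rewrite !(poch_neq0_le (ltnW kM)).
have f0 : (k`!)%:R != 0 :> K by rewrite pnatr_eq0 -lt0n fact_gt0.
have k0 : 1 + k%:R != 0 :> K by rewrite nat1r pnatr_eq0.
have l0 : leadP i != 0 by apply: leadP_neq0; lia.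
rewrite -!(nat1r k); move: (poch A k) (poch B k) (poch C k) a1 b1 c1 => a b c a1 b1 c1.
move: (k`!%:R) f0 (leadP i) l0 ((-1) ^+ k) (poch _ _) (poch _ _) => f f0 l l0 e p q.
by field; rewrite a0 b0 c0 a1 b1 c1 f0 k0 l0.
Qed.

(** The coefficient next to the leading one, up to the factor 2 i + s - 1. *)
Definition edge (z : K) : K := z * (A + z - 1) * (B + z - 1) * (C + z - 1).

Lemma index_neq0 (m i : nat) : (0 < i)%N -> (i <= M)%N -> (m < i.*2)%N -> (0 < m)%N -> 2 * i%:R + s - m%:R != 0.
Proof.
move=> i0 iM mi m0; have -> : 2 * i%:R + s - m%:R = (i.*2 - m)%:R + s.
  rewrite natrB ?(ltnW mi) // -muln2 natrM; ring.
apply: s0; lia.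
Qed.

Lemma monic_wt_next i : (i < M)%N -> monic_wt i.+1 i = edge i.+1%:R / (2 * i.+1%:R + s - 1).
Proof.
move=> iM; have := @monic_wt_pred i.+1 i; rewrite leqnn iM => /(_ isT).
have h := @index_neq0 1 i.+1 isT iM; rewrite monic_wt_lead // mul1r => H.
apply: (mulIf (h isT isT)); rewrite divfK ?h //.
by transitivity (monic_wt i.+1 i * ((i.+1%:R - i%:R) * (i.+1%:R + s + i%:R)));
  [rewrite -!natr1|rewrite H /edge -!natr1]; ring.
Qed.

Lemma monic_wt_next2 i : (i.+1 < M)%N -> monic_wt i.+2 i =
  edge i.+2%:R * edge (i.+2%:R - 1) / (2 * (2 * i.+2%:R + s - 1) * (2 * i.+2%:R + s - 2)).
Proof.
move=> iM; have := @monic_wt_pred i.+2 i; rewrite leqnSn iM => /(_ isT).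
have h1 := @index_neq0 1 i.+2 isT iM; have h2 := @index_neq0 2 i.+2 isT iM.
rewrite (monic_wt_next iM) => H.
have t0 : 2 != 0 :> K by rewrite pnatr_eq0.
have h : 2 * (2 * i.+2%:R + s - 2) != 0 by rewrite mulf_neq0 // h2 //; lia.
apply: (mulIf h); transitivity (monic_wt i.+2 i * ((i.+2%:R - i%:R) * (i.+2%:R + s + i%:R))).
  by rewrite -!natr1; ring.
rewrite H /edge -!(nat1r i.+1) -!(nat1r i).
move: h1 h2 => /(_ isT isT) h1 /(_ isT isT) h2.
by rewrite -!(nat1r i.+1) -!(nat1r i) in h1 h2; field; rewrite h1 h2.
Qed.

Lemma polyfun_edge : polyfun 4 edge.
Proof.
have h (X : K) : polyfun 1 (fun z => X + z - 1).
  apply: (@polyfun_ext _ _ (fun z => z + (X - 1))) => [z|]; first by ring.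
  exact: polyfun_shift (polyfun_id K).
by apply: (@polyfun_mul _ 3 1) (h C); apply: (@polyfun_mul _ 2 1) (h B);
  apply: (@polyfun_mul _ 1 1) (h A); exact: polyfun_id.
Qed.

Lemma polyfun_lin (c : K) : polyfun 1 (fun z => 2 * z + c).
Proof.
apply: polyfun_add; last by apply: (@polyfun_le _ 0) => //; exact: polyfun_const.
by apply: (@polyfun_mul _ 0 1); [exact: polyfun_const | exact: polyfun_id].
Qed.

Lemma polyfun_lin2 (c d : K) : polyfun 1 (fun z => 2 * z + c + d).
Proof. by apply: polyfun_ext (polyfun_lin (c + d)) => z; rewrite addrA. Qed.

(** The two coefficients below the leading one, as rational functions of i. *)
Lemma top_coefs : exists P1 P2 : K -> K, [/\ polyfun 4 P1, polyfun 8 P2,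
  forall i : nat, (0 < i <= M)%N ->
     (mpol i)`_i.-1 = P1 i%:R / (2 * i%:R + s - 1) &
  forall i : nat, (1 < i <= M)%N ->
     (mpol i)`_i.-2 = P2 i%:R / ((2 * i%:R + s - 1) * (2 * i%:R + s - 2))].
Proof.
have [E1 [E2 [p1 p2 HE1 HE2]]] := phi_monic_coefs u xi.
exists (fun z => - (E1 z * (2 * z + s - 1)) + edge z).
exists (fun z => E2 z * (2 * z + s - 1) * (2 * z + s - 2)
   - edge z * E1 (z - 1) * (2 * z + s - 2) + edge z * edge (z - 1) * 2^-1).
split.
- apply: polyfun_add; last exact: polyfun_edge.
  by apply: polyfun_opp; apply: (@polyfun_mul _ 3 1) => //; exact: polyfun_lin2.
- apply: polyfun_add.
    apply: polyfun_add.
      by apply: (@polyfun_mul _ 7 1); [apply: (@polyfun_mul _ 6 1) => //|]; exact: polyfun_lin2.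
    apply: polyfun_opp; apply: (@polyfun_mul _ 7 1); last exact: polyfun_lin2.
    by apply: (@polyfun_mul _ 4 3); [exact: polyfun_edge|exact: polyfun_shift].
  apply: (@polyfun_mul _ 8 0); last exact: polyfun_const.
  by apply: (@polyfun_mul _ 4 4); [exact: polyfun_edge|apply: polyfun_shift; exact: polyfun_edge].
- case=> // i iM; rewrite mpolE !big_ord_recr /= !coefD !coefZ HE1 phi_monic_lead monic_wt_lead //.
  rewrite nth_default ?size_mpol_tail // add0r monic_wt_next //.
  have h := @index_neq0 1 i.+1 isT iM isT isT; move: (E1 _) (edge _) => e f.
  by field; rewrite nat1r h.
- case=> // [[|i]] // iM; rewrite mpolE !big_ord_recr /= !coefD !coefZ HE1 HE2 phi_monic_lead monic_wt_lead //.
  rewrite nth_default ?size_mpol_tail // add0r monic_wt_next // monic_wt_next2 //.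
  have -> : i.+2%:R - 1 = i.+1%:R :> K by rewrite -[i.+2%:R]natr1 addrK.
  have h1 := @index_neq0 1 i.+2 isT iM isT isT; have h2 := @index_neq0 2 i.+2 isT iM isT isT.
  move: (E1 _) (E2 _) (edge i.+2%:R) (edge i.+1%:R) => e e2 f f2.
  move: (i.+2%:R) h1 h2 => z h1 h2.
  have t0 : 2 != 0 :> K by rewrite pnatr_eq0.
  by field; rewrite h1 h2.
Qed.

End Monic.

(** * The three-term recurrence *)

Section TTR.
Variables (K : numFieldType) (A B C u xi : K) (M : nat).
Let s := ssum A B C u.
Hypothesis A0 : poch A M != 0.
Hypothesis B0 : poch B M != 0.
Hypothesis C0 : poch C M != 0.
Hypothesis s0 : forall m, (0 < m < M.*2)%N -> m%:R + s != 0.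

Local Notation mpol := (mpol A B C u xi).
Local Notation leadP := (leadP A B C u).

Lemma natr_double1 n : (n.*2.+1)%:R = 2 * n%:R + 1 :> K.
Proof. by rewrite -natr1 -mul2n natrM. Qed.

Lemma natr_double n : (n.*2)%:R = 2 * n%:R :> K.
Proof. by rewrite -mul2n natrM. Qed.

(** Composition of the relation that raises A with the one that lowers it.
    The hypothesis on 2 i + s - 2 matters for i = 1 only. *)
Lemma ttr i : (0 < i < M)%N -> 2 * i%:R + s - 2 != 0 ->
  exists b, 'X * mpol i = mpol i.+1 + b *: mpol i + ttr_coef A B C u i%:R *: mpol i.-1.
Proof.
move=> /andP[i0 iM] h1.
have a0 : A != 0.
  by move/poch_neq0P: A0 => /(_ 0%N); rewrite addr0; apply; lia.
have a1 : poch (A + 1) i != 0.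
  by have := poch_neq0_le iM A0; rewrite pochSl mulf_eq0 negb_or => /andP[].
have [j ej] : exists j, i = j.+1 by exists i.-1; rewrite prednK.
have h4 : 2 * i.-1%:R + s + 1 != 0.
  by rewrite addrAC -natr_double1; apply: s0; lia.
have h0 : 2 * i%:R + s - 1 != 0.
  by apply: contra_neq h4 => <-; rewrite ej /= -[j.+1%:R]natr1; ring.
have h2 : 2 * i%:R + s != 0 by rewrite -natr_double; apply: s0; lia.
have h3 : 2 * i%:R + s + 1 != 0.
  by rewrite addrAC -natr_double1; apply: s0; lia.
have hup := RPn_up (B := B) (C := C) (u := u) xi (n := i.+1) (i := i) a0 a1 h2.
have hd1 := RPn_dn xi (poch_neq0_le iM A0) (poch_neq0_le iM B0) (poch_neq0_le iM C0) h3.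
have iM' := ltnW iM.
have hd2 := RPn_dn xi (poch_neq0_le iM' A0) (poch_neq0_le iM' B0) (poch_neq0_le iM' C0) h4.
have hj : (i.-1 < i)%N by rewrite ltn_predL.
have hj' : (i.-1 < i.+1)%N by apply: ltnW.
move: hd1 hd2; rewrite ltnSn hj !orbT => /(_ isT) hd1 /(_ isT) hd2.
rewrite wt_eq0 // scale0r addr0 in hd1; rewrite wt_eq0 // scale0r addr0 prednK // in hd2.
move: hup hd1 hd2; rewrite !RPn_eq //.
move=> hup hd1 hd2.
have [l0 l1 l2] : [/\ leadP i != 0, leadP i.+1 != 0 & leadP i.-1 != 0].
  by split; apply: (leadP_neq0 (M := M)) => //; lia.
set k0 := A * (A - u) - xi in hd1 hd2.
exists (k0 - A * (up0 A s i * dn0 B C s i + up1 A s i * dn1 B C s i.-1)).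
rewrite /mpol -!scalerAr.
have H : (k0%:P - 'X) * RP A B C u xi i =
    (up0 A s i * (A * dn1 B C s i)) *: RP A B C u xi i.+1
  + (A * (up0 A s i * dn0 B C s i + up1 A s i * dn1 B C s i.-1)) *: RP A B C u xi i
  + (up1 A s i * (A * dn0 B C s i.-1)) *: RP A B C u xi i.-1.
  rewrite [in LHS]hup mulrDr -!scalerAr hd1 hd2 !scalerDr !scalerA -!addrA; congr (_ + _).
  rewrite !addrA -scalerDl; congr (_ *: _ + _).
  by rewrite -/s; ring.
have HX : 'X * RP A B C u xi i = k0 *: RP A B C u xi i - (k0%:P - 'X) * RP A B C u xi i.
  by rewrite -mul_polyC; ring.
rewrite HX H.
have E1 : - (up0 A s i * (A * dn1 B C s i)) / leadP i = (leadP i.+1)^-1.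
  have e1 : poch (i.+1%:R + s) i.+1 * (i%:R + s) =
     poch (i%:R + s) i * ((2 * i%:R + s) * (2 * i%:R + s + 1)).
    have -> : i.+1%:R + s = i%:R + s + 1 by rewrite -natr1; ring.
    by rewrite mulrC -pochSl !pochSr -(nat1r i); ring.
  have p1 : poch (i.+1%:R + s) i.+1 != 0.
    by move: l1; rewrite /leadP -/s mulf_eq0 negb_or => /andP[].
  have p0 : poch (i%:R + s) i != 0.
    by move: l0; rewrite /leadP -/s mulf_eq0 negb_or => /andP[].
  rewrite /leadP -/s !invf_div !(pochSr A) !(pochSr B) !(pochSr C).
  have -> : (poch (i.+1%:R + s) i.+1)^-1 =
    (i%:R + s) / (poch (i%:R + s) i * ((2 * i%:R + s) * (2 * i%:R + s + 1))).
    apply: (mulfI p1); rewrite divff // [X in _ = X]mulrA e1 divff //.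
    by rewrite !mulf_neq0.
  rewrite /up0 /dn1; move: (poch A i) (poch B i) (poch C i) (poch _ _) p0 => a b c p p0.
  by field; rewrite h3 h2 p0 a0.
have E2 : - (up1 A s i * (A * dn0 B C s i.-1)) / leadP i = ttr_coef A B C u i%:R / leadP i.-1.
  rewrite ej /= in i0 iM iM' h0 h1 h2 h3 h4 l0 l2 *.
  have e1 : poch (j.+1%:R + s) j.+1 * (j%:R + s) =
     poch (j%:R + s) j * ((2 * j.+1%:R + s - 2) * (2 * j.+1%:R + s - 1)).
    have -> : j.+1%:R + s = j%:R + s + 1 by rewrite -natr1; ring.
    by rewrite mulrC -pochSl !pochSr -(nat1r j); ring.
  have p1 : poch (j.+1%:R + s) j.+1 != 0.
    by move: l0; rewrite /leadP -/s mulf_eq0 negb_or => /andP[].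
  have p0 : poch (j%:R + s) j != 0.
    by move: l2; rewrite /leadP -/s mulf_eq0 negb_or => /andP[].
  rewrite /leadP -/s !invf_div !(pochSr A) !(pochSr B) !(pochSr C).
  have -> : (poch (j.+1%:R + s) j.+1)^-1 = (j%:R + s) / (poch (j%:R + s) j
      * ((2 * j.+1%:R + s - 2) * (2 * j.+1%:R + s - 1))).
    apply: (mulfI p1); rewrite divff // [X in _ = X]mulrA e1 divff //.
    by rewrite !mulf_neq0.
  rewrite /up1 /dn0 /ttr_coef /ttr_num /ttr_den -/s.
  move: h0 h1 h2 h4; rewrite -!(nat1r j) => h0 h1 h2 h4.
  move: (poch A j) (poch B j) (poch C j) (poch _ _) p0 => a b c p p0.
  have h4' : 2 * j%:R + s + 1 = 2 * (1 + j%:R) + s - 1 by ring.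
  rewrite h4' in h4 *.
  move: (2 * (1 + j%:R) + s) h0 h1 h2 h4 {h4'} => w h0 h1 h2 h4.
  by field; rewrite h0 h1 h2 p0 a0.
rewrite !scalerA -E1 -E2 {HX H hd1 hd2}.
move: (A * (up0 _ _ _ * _ + _)) (up0 A s i * (A * _)) (up1 A s i * (A * _)) k0 (leadP i)^-1.
move: (RP _ _ _ _ _ i.+1) (RP _ _ _ _ _ i) (RP _ _ _ _ _ i.-1) => P Q R m x y k l.
rewrite -!mul_polyC !polyCM !polyCB !polyCN.
by ring.
Qed.

End TTR.

(** * From a relation to a matching of zeros *)

Section Indep.
Variable K : numFieldType.

Lemma lin_indep (Q : nat -> {poly K}) (a : nat -> K) n :
  (forall i j, (i < j < n)%N -> (size (Q i) < size (Q j))%N) ->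
  (forall i, (i < n)%N -> Q i != 0) ->
  \sum_(i < n) a i *: Q i = 0 -> forall i, (i < n)%N -> a i = 0.
Proof.
elim: n => // n IH hs Q0; rewrite big_ord_recr /= => H.
have an : a n = 0.
  apply/eqP/negPn/negP => an; have := congr1 (fun p : {poly K} => p`_(size (Q n)).-1) H.
  rewrite coefD coef0 coefZ -lead_coefE.
  rewrite nth_default ?add0r => [/eqP|].
    by rewrite mulf_eq0 (negPf an) lead_coef_eq0 (negPf (Q0 _ (ltnSn n))).
  have h0 : (0 < size (Q n))%N by rewrite size_poly_gt0 Q0.
  rewrite -ltnS prednK //.
  apply: (big_ind (fun p : {poly K} => (size p < size (Q n))%N)).
  - by rewrite size_poly0.
  - by move=> p q hp hq; apply: leq_ltn_trans (size_polyD _ _) _; rewrite gtn_max hp hq.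
  - by move=> i _; apply: leq_ltn_trans (size_scale_leq _ _) _; apply: hs; rewrite ltn_ord ltnSn.
move: H; rewrite an scale0r addr0 => /IH H i; rewrite ltnS leq_eqVlt => /orP[/eqP -> //|].
apply: H => [j k /andP[jk kn]|j jn]; [apply: hs; lia | apply: Q0; lia].
Qed.

(** Two families Q and P linked by lam P = Q + (lower terms): if lam P_1 is
    multiplied by X in the two possible ways, the coefficients of Q_0, Q_1 and
    Q_2 must agree. *)
Lemma bottom_coefs (P0 P1 P2 Q0 Q1 Q2 Q3 Q4 lam : {poly K})
  (c12 c22 c13 c23 c14 c24 b g b1 g1 b2 g2 b3 g3 : K) :
  (0 < size Q0)%N -> size Q1 = (size Q0).+1 -> size Q2 = (size Q1).+1 ->
  size Q3 = (size Q2).+1 ->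
  lam * P0 = Q2 + c12 *: Q1 + c22 *: Q0 ->
  lam * P1 = Q3 + c13 *: Q2 + c23 *: Q1 ->
  lam * P2 = Q4 + c14 *: Q3 + c24 *: Q2 ->
  'X * P1 = P2 + b *: P1 + g *: P0 ->
  'X * Q1 = Q2 + b1 *: Q1 + g1 *: Q0 ->
  'X * Q2 = Q3 + b2 *: Q2 + g2 *: Q1 ->
  'X * Q3 = Q4 + b3 *: Q3 + g3 *: Q2 ->
  [/\ g * c22 = c23 * g1,
      b * c23 + g * c12 = c13 * g2 + c23 * b1 &
      c24 + b * c13 + g = g3 + c13 * b2 + c23].
Proof.
move=> sz0 sz1 sz2 sz3 R2 R3 R4 T S1 S2 S3.
have E1 : 'X * (lam * P1) = lam * P2 + b *: (lam * P1) + g *: (lam * P0).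
  by rewrite mulrCA T !mulrDr !scalerAr.
move: E1; rewrite R2 R3 R4 !mulrDr -!scalerAr S1 S2 S3 => E1.
pose Q := nth Q0 [:: Q0; Q1; Q2; Q3].
pose a := nth 0 [:: g * c22 - c23 * g1; b * c23 + g * c12 - c13 * g2 - c23 * b1;
   c24 + b * c13 + g - g3 - c13 * b2 - c23; c14 + b - b3 - c13].
have H : \sum_(i < 4) a i *: Q i = 0.
  rewrite !big_ord_recr big_ord0 /= /a /Q /= add0r.
  move/eqP: E1; rewrite eq_sym -subr_eq0 => /eqP <-.
  rewrite -!mul_polyC !(polyCD, polyCM, polyCN, polyCB).
  by ring.
have hq i : (i < 4)%N -> size (Q i) = (size Q0 + i)%N.
  by case: i => [|[|[|[|i]]]] //= _; rewrite /Q /= ?sz3 ?sz2 ?sz1 ?addn0 ?addnS ?addn0.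
have hs : forall i j, (i < j < 4)%N -> (size (Q i) < size (Q j))%N.
  by move=> i j /andP[ij j4]; rewrite !hq ?ltn_add2l // (ltn_trans ij).
have hQ : forall i, (i < 4)%N -> Q i != 0.
  by move=> i i4; rewrite -size_poly_gt0 hq // addn_gt0 sz0.
have h := lin_indep hs hQ H.
have h0 := h 0%N isT; have h1 := h 1%N isT; have h2 := h 2%N isT.
rewrite /a /= in h0 h1 h2; split.
- by apply/eqP; rewrite -subr_eq0 h0.
- by apply/eqP; rewrite -subr_eq0 -[X in _ == X]h1; apply/eqP; ring.
- by apply/eqP; rewrite -subr_eq0 -[X in _ == X]h2; apply/eqP; ring.
Qed.

End Indep.

Section GRoots.
Variable K : numFieldType.

(** Zeros and poles in i of the coefficient of the recurrence. *)
Definition ttr_zeros (A B C u : K) : seq K :=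
  let s := ssum A B C u in
  [:: 0; 1 - s; 1 - A; 1 - B; 1 - C; A - s; B - s; C - s].
Definition ttr_poles (s : K) : seq K :=
  [:: (2 - s) / 2; (1 - s) / 2; (1 - s) / 2; - s / 2].

Lemma ttr_coefE A B C u z : ttr_coef A B C u z =
  \prod_(x <- ttr_zeros A B C u) (z - x) / (16 * \prod_(x <- ttr_poles (ssum A B C u)) (z - x)).
Proof.
rewrite /ttr_coef /ttr_num /ttr_den /ttr_zeros /ttr_poles; set s := ssum A B C u.
rewrite !big_cons !big_nil; congr (_ / _); first by ring.
have t0 : 2 != 0 :> K by rewrite pnatr_eq0.
by field.
Qed.

Lemma prod_shift (l : seq K) (z a : K) :
  \prod_(x <- l) (z - a - x) = \prod_(x <- [seq x + a | x <- l]) (z - x).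
Proof. by rewrite big_map; apply: eq_bigr => x _; ring. Qed.

Lemma prod_neq0 (l : seq K) (z : K) : z \notin l -> \prod_(x <- l) (z - x) != 0.
Proof.
move=> h; rewrite prodf_seq_neq0; apply/allP => x xl /=; rewrite subr_eq0.
by apply: contraNneq h => ->.
Qed.

(** From the relation g(i) c(i-1) = c(i) g'(i-r) for many consecutive i, where
    c is a polynomial of degree at most d divided by the linear factors with
    zeros D, to a matching of zeros. *)
Lemma ttr_match (A B C u A' B' C' u' : K) (D : seq K) (r : K) (n : K -> K)
    (c : nat -> K) (d i0 : nat) :
  let bound := (d + size D + 12)%N in
  polyfun d n -> (exists z, n z != 0) -> (0 < i0)%N ->
  (forall i, (i0 <= i <= i0 + bound)%N -> i%:R \notin ttr_poles (ssum A B C u)) ->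
  (forall i, (i0 <= i <= i0 + bound)%N -> i%:R - r \notin ttr_poles (ssum A' B' C' u')) ->
  (forall i, (i0.-1 <= i <= i0 + bound)%N -> c i * \prod_(x <- D) (i%:R - x) = n i%:R) ->
  (forall i, (i0 <= i <= i0 + bound)%N ->
     ttr_coef A B C u i%:R * c i.-1 = c i * ttr_coef A' B' C' u' (i%:R - r)) ->
  exists ks : seq nat, [/\ size ks = (12 + size D)%N, (sumn ks <= d)%N &
    perm_eq [seq x.1 + x.2%:R | x <- zip (ttr_zeros A B C u
        ++ (D ++ [seq x + r | x <- ttr_poles (ssum A' B' C' u')])) ks]
      ([seq x + r | x <- ttr_zeros A' B' C' u'] ++ ([seq x + 1 | x <- D] ++ ttr_poles (ssum A B C u)))].
Proof.
move=> bound pn n0 ip hG hG' hc H.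
set src := ttr_zeros _ _ _ _ ++ _; set tgt := _ ++ _.
have Z : forall z, n z * \prod_(x <- tgt) (z - x) - n (z - 1) * \prod_(x <- src) (z - x) = 0.
  have sz1 : size src = (12 + size D)%N by rewrite /src !size_cat size_map /=; lia.
  have sz2 : size tgt = (12 + size D)%N by rewrite /tgt !size_cat !size_map /=; lia.
  apply: (@polyfun_zero K (d + (12 + size D)) _ i0).
    apply: polyfun_add; first by rewrite -sz2; apply: polyfun_mul pn (polyfun_prod _).
    by apply: polyfun_opp; rewrite -sz1; apply: polyfun_mul (polyfun_prod _); apply: polyfun_shift.
  move=> i hi; have hi1 : (i0 <= i <= i0 + bound)%N by rewrite /bound; lia.
  have hi2 : (i0.-1 <= i <= i0 + bound)%N by lia.
  have hi3 : (i0.-1 <= i.-1 <= i0 + bound)%N by lia.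
  have ii : i.-1%:R = i%:R - 1 :> K.
    by rewrite -[in RHS](prednK (_ : (0 < i)%N)) ?natr1 -?natr1 ?addrK //; lia.
  move: (H i hi1) (hc i hi2) (hc i.-1 hi3); rewrite !ttr_coefE ii.
  rewrite /src /tgt !big_cat -!prod_shift.
  have := prod_neq0 (hG i hi1); have := prod_neq0 (hG' i hi1).
  move: (\prod_(x <- ttr_zeros _ _ _ _) _) (\prod_(x <- ttr_zeros _ _ _ _) _) => a a'.
  move: (\prod_(x <- ttr_poles _) _) (\prod_(x <- ttr_poles _) _) => e e' h1 h2 E <- <-.
  have t0 : 16 != 0 :> K by rewrite pnatr_eq0.
  have : a' / (16 * e) * c i.-1 * (16 * e' * e) = c i * (a / (16 * e')) * (16 * e' * e).
    by rewrite E.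
  have -> : a' / (16 * e) * c i.-1 * (16 * e' * e) = a' * c i.-1 * e'.
    by field; rewrite ?t0 ?h1 ?h2.
  have -> : c i * (a / (16 * e')) * (16 * e' * e) = c i * a * e.
    by field; rewrite ?t0 ?h1 ?h2.
  move: (\prod_(x <- D) _) (\prod_(x <- D) _) (c _) (c _) => f f' w w' {}E.
  by transitivity (f * f' * (w * a * e - a' * w' * e')); [rewrite /=; ring | rewrite E subrr mulr0].
have [p sp np] := pn; have [z0 nz0] := n0.
have p0 : p != 0 by apply: contraNneq nz0 => p0; rewrite np p0 horner0.
have EP : p * \prod_(x <- tgt) ('X - x%:P) = (p \Po ('X - 1)) * \prod_(x <- src) ('X - x%:P).
  apply/eqP; rewrite -subr_eq0; apply/eqP/(@poly_many_zeros _ _ 0) => i _.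
  have := Z (0 + i)%:R; rewrite !np => <-.
  rewrite hornerD hornerN !hornerM horner_comp !horner_prod hornerD hornerN hornerX hornerC.
  by congr (_ * _ - _ * _); apply: eq_bigr => x _; rewrite !hornerE.
have [ks [k1 k2 k3]] := match_roots p0 EP.
exists ks; split=> //; first by rewrite k1 /src !size_cat size_map /=; lia.
by apply: leq_trans k2 _; rewrite -subn1 leq_subLR add1n.
Qed.

End GRoots.

(** * Solution of the matching for generic parameters *)

(** Two matched multisets can be matched blockwise when the blocks d and a
    have nothing in common. *)
Lemma perm_split (T : eqType) (a b c d : seq T) : perm_eq (a ++ b) (c ++ d) ->
  size b = size d -> {in d, forall x, x \notin a} -> perm_eq b d /\ perm_eq a c.
Proof.
move=> H sbd da.
have fa : filter (mem d) a = [::].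
  by apply/eqP; rewrite -[_ == _]negbK -has_filter; apply/negP => /hasP[x xa /da]; rewrite xa.
have fd : filter (mem d) d = d by apply/all_filterP/allP.
have Hf := perm_filter (mem d) H; rewrite !filter_cat fa fd /= in Hf.
have sz := perm_size Hf; rewrite size_cat in sz.
have sb : (size (filter (mem d) b) <= size b)%N by rewrite size_filter count_size.
have c0 : filter (mem d) c = [::] by apply/eqP; rewrite -size_eq0; lia.
have fb : filter (mem d) b = b.
  apply/all_filterP; rewrite all_count -size_filter; apply/eqP.
  by rewrite c0 /= add0n in sz; rewrite sz sbd.
rewrite c0 fb /= in Hf; split=> //.
by move: H; rewrite -(perm_cat2r d a) => H; apply: perm_trans H; rewrite perm_cat2l perm_sym.
Qed.

Section Forms.
Variables (K : numFieldType) (rho : racahParam K) (G : generic rho).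

(** Integral linear forms in 1, alpha, beta, gamma; they are pairwise distinct
    for generic parameters. *)
Definition linform (m0 m1 m2 m3 : int) : K :=
  m0%:~R + m1%:~R * rA rho + m2%:~R * rB rho + m3%:~R * rC rho.

Lemma linform_inj m0 m1 m2 m3 n0 n1 n2 n3 : linform m0 m1 m2 m3 = linform n0 n1 n2 n3 ->
  [/\ m0 = n0, m1 = n1, m2 = n2 & m3 = n3].
Proof.
move=> H; have [|e0 e1 e2 e3] := G (m0 := m0 - n0) (m1 := m1 - n1) (m2 := m2 - n2) (m3 := m3 - n3).
  by rewrite !intrB -(subrr (linform n0 n1 n2 n3)) -{1}H /linform; ring.
by split; lia.
Qed.

Lemma linform_eqE m0 m1 m2 m3 n0 n1 n2 n3 : (linform m0 m1 m2 m3 == linform n0 n1 n2 n3) =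
  [&& m0 == n0, m1 == n1, m2 == n2 & m3 == n3].
Proof.
apply/eqP/and4P => [/linform_inj[-> -> -> ->]|[/eqP -> /eqP -> /eqP -> /eqP ->]] //.
Qed.

End Forms.

Section Classify.
Variables (K : numFieldType) (rho : racahParam K) (G : generic rho).
Variables (A' B' : K) (N' : nat) (eta r : int) (D : seq K) (d : nat).
Let C' : K := - N'%:R.
Let u' : K := pu rho - 2 * eta%:~R.
Let s' := ssum A' B' C' u'.
Let s := ps rho.
Let N : int := rN rho.
Hypothesis dN : (d < rN rho)%N.
Hypothesis rN2 : r <= N.
Hypothesis HD : forall x, x \in D ->
  (exists2 c : int, 0 < c & x = (c%:~R - s) / 2) \/ (exists c : int, x = (c%:~R - s') / 2).

(** The poles have the form (c - s) / 2 or (c - s') / 2 with c an integer, and,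
    for generic parameters, (c - s) / 2 is never a shifted zero of g.  Hence s' - s
    is an integer, the poles are matched among themselves, which gives the sum
    of their shifts, and the eight zeros of g' are matched with those of g.  The
    zeros 0, 1 - C, 1 - s and C - s, together with N > d, fix C' and s'; the
    position of 1 - A' among the zeros of g then leaves only the two cases
    exchanged by the symmetry in A and B. *)
Lemma classify_match (ks : seq nat) :
  size ks = (12 + size D)%N -> (sumn ks <= d)%N ->
  perm_eq [seq x.1 + x.2%:R | x <- zip (ttr_zeros (pA rho) (pB rho) (pC rho) (pu rho)
        ++ (D ++ [seq x + r%:~R | x <- ttr_poles s'])) ks]
      ([seq x + r%:~R | x <- ttr_zeros A' B' C' u'] ++ ([seq x + 1 | x <- D] ++ ttr_poles s)) ->
  exists t1 t2 t3 t4 : int,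
   [/\ eta = - t1, N'%:Z = N - t1 - t4,
      (A' = pA rho + (t1 + t2)%:~R /\ B' = pB rho + (t1 + t3)%:~R)
      \/ (A' = pB rho + (t1 + t3)%:~R /\ B' = pA rho + (t1 + t2)%:~R),
      [/\ t1 + t2 <= r, t1 + t3 <= r & t1 + t4 <= r] /\
      [/\ t2 + t3 <= r, t2 + t4 <= r & t3 + t4 <= r] &
      t1 + t2 + t3 + t4 <= r /\ 4 * r - 2 * (t1 + t2 + t3 + t4) <= (size D)%:Z].
Proof.
have t20 : 2 != 0 :> K by rewrite pnatr_eq0.
case: ks => [|k0 [|k1 [|k2 [|k3 [|k4 [|k5 [|k6 [|k7 ks]]]]]]]] // [] sks kd.
set S := D ++ _; set TS := [seq x + 1 | x <- D] ++ ttr_poles s.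
pose LG := [:: linform rho k0 0 0 0; linform rho k1 (-1) (-1) 0; linform rho k2 (-1) 0 0;
  linform rho k3 0 (-1) (-1); linform rho (1 + N + k4) 0 0 0; linform rho k5 0 (-1) 0;
  linform rho k6 (-1) 0 1; linform rho (k7%:Z - 1 - N) (-1) (-1) 0].
set TG := [seq x + r%:~R | x <- ttr_zeros A' B' C' u'].
pose LS := [seq x.1 + x.2%:R | x <- zip S ks].
move=> H; have {}H : perm_eq (LG ++ LS) (TG ++ TS).
  set s1 := ssum (pA rho) (pB rho) (pC rho) (pu rho).
  have <- : [:: 0 + k0%:R; 1 - s1 + k1%:R; 1 - pA rho + k2%:R; 1 - pB rho + k3%:R;
     1 - pC rho + k4%:R; pA rho - s1 + k5%:R; pB rho - s1 + k6%:R; pC rho - s1 + k7%:R] = LG.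
    rewrite /LG /s1 ssumE /linform /ps /pA /pB /pC !intrD !intrN /N.
    repeat (congr cons; first by ring).
    by [].
have sS : size S = (size D + 4)%N by rewrite /S size_cat size_map.
have sks' : size ks = size S by move: sks => /=; lia.
have sLS : size LS = size S by rewrite size_map size_zip sks' minnn.
have sTS : size TS = size S by rewrite /TS size_cat size_map sS.
(* The pole - s / 2 must come from a pole on the other side, so s' - s is an
   integer. *)
have notG (c : int) : (c%:~R - s) / 2 \notin LG.
  apply/negP; rewrite /LG !inE.
  have E m0 m1 m2 m3 : ((c%:~R - s) / 2 == linform rho m0 m1 m2 m3) =
      (linform rho (c - 1) (-1) (-1) 0 == linform rho (2 * m0) (2 * m1) (2 * m2) (2 * m3)).
    rewrite -(inj_eq (mulIf t20)) divfK //; congr (_ == _); rewrite /linform /s /ps ?(intrD,intrM); ring.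
  by rewrite !E !(linform_eqE G); lia.
have [sg Esg] : exists sg : int, s' = s + sg%:~R.
  have : - s / 2 \in LG ++ LS.
    by rewrite (perm_mem H) !mem_cat /ttr_poles !inE eqxx !orbT.
  have -> : - s / 2 = (0%:~R - s) / 2 by rewrite sub0r.
  rewrite mem_cat (negPf (notG 0)) /= => /mapP[[x k] /= xk E].
  have xS : x \in S.
    by rewrite -(unzip1_zip (eq_leq (esym sks'))); apply/mapP; exists (x, k).
  have Ex : x = - s / 2 - k%:R by rewrite -[- s]sub0r E addrK.
  have Ec (c : int) : x = (c%:~R - s') / 2 -> exists sg : int, s' = s + sg%:~R.
    move=> Ex2; exists (c + 2 * k%:Z).
    have : x * 2 = c%:~R - s' by rewrite Ex2 divfK.
    rewrite Ex mulrBl divfK // => E2.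
    by rewrite intrD intrM -[s' in LHS](subKr c%:~R) -E2; ring.
  move: xS; rewrite /S mem_cat => /orP[/HD [[c c0 Ex2]|[c /Ec //]]|].
    have : x * 2 = c%:~R - s by rewrite Ex2 divfK.
    rewrite Ex mulrBl divfK // => /eqP; rewrite addrC (inj_eq (addIr _)).
    rewrite -mulNr -[_ * 2]/(_ * 2%:~R) -[- _]/(- (k%:~R)) -intrN -intrM eqr_int; lia.
  case/mapP => y yd Exy.
  have [c Ey] : exists c : int, y = (c%:~R - s') / 2.
    move: yd; rewrite /ttr_poles !inE => /or4P[] /eqP ->; [exists 2|exists 1|exists 1|exists 0] => //.
    by rewrite sub0r.
  by apply: (Ec (c + 2 * r)); rewrite Exy Ey intrD intrM; field.
have TSform x : x \in TS -> exists c : int, x = (c%:~R - s) / 2.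
  rewrite /TS mem_cat => /orP[/mapP[y yD ->]|].
    have [[c _ ->]|[c ->]] := HD yD.
      by exists (c + 2); rewrite intrD; field.
    by exists (c + 2 - sg); rewrite Esg !(intrD, intrN); field.
  rewrite /ttr_poles !inE => /or4P[] /eqP ->; [exists 2|exists 1|exists 1|exists 0] => //.
  by rewrite sub0r.
have [HS HG] : perm_eq LS TS /\ perm_eq LG TG.
  apply: perm_split H _ _; first by rewrite sLS sTS.
  by move=> x /TSform[c ->].
(* The sums over the matched poles give the total shift of the poles. *)
have Hsum : (sumn ks)%:Z = (size D)%:Z + 2 * sg - 4 * r.
  have E : \sum_(x <- LS) x = \sum_(x <- TS) x by exact: perm_big.
  have E1 : \sum_(x <- LS) x = \sum_(x <- S) x + (sumn ks)%:R.
    rewrite /LS big_map; elim: (S) (ks) (sks') => [|x l IH] [|k l'] //=.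
      by rewrite !big_nil addr0.
    by move=> [hl]; rewrite !big_cons /= IH // natrD addrACA.
  have E2 : \sum_(x <- S) x = \sum_(x <- D) x + (4 - 4 * s') / 2 + 4 * r%:~R.
    by rewrite /S big_cat big_map /ttr_poles !big_cons big_nil /=; field.
  have E3 : \sum_(x <- TS) x = \sum_(x <- D) x + (size D)%:R + (4 - 4 * s) / 2.
    rewrite /TS big_cat big_map big_split /= big_const_seq count_predT iter_addr_0.
    by rewrite /ttr_poles !big_cons big_nil /=; field.
  rewrite E1 E2 E3 in E.
  apply/eqP; rewrite -(eqr_int K) !(intrD, intrN, intrM) /=.
  apply/eqP; apply: (addrI (\sum_(x <- D) x + (4 - 4 * s') / 2 + 4 * r%:~R)).
  by rewrite E Esg; field.
have mem x m0 m1 m2 m3 : x \in TG -> x = linform rho m0 m1 m2 m3 -> linform rho m0 m1 m2 m3 \in LG.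
  by move=> xT <-; rewrite (perm_mem HG).
have memE m0 m1 m2 m3 : linform rho m0 m1 m2 m3 \in LG =
  [|| [&& m0 == k0, m1 == 0, m2 == 0 & m3 == 0],
      [&& m0 == k1, m1 == -1, m2 == -1 & m3 == 0],
      [&& m0 == k2, m1 == -1, m2 == 0 & m3 == 0],
      [&& m0 == k3, m1 == 0, m2 == -1 & m3 == -1],
      [&& m0 == 1 + N + k4, m1 == 0, m2 == 0 & m3 == 0],
      [&& m0 == k5, m1 == 0, m2 == -1 & m3 == 0],
      [&& m0 == k6, m1 == -1, m2 == 0 & m3 == 1] |
      [&& m0 == k7%:Z - 1 - N, m1 == -1, m2 == -1 & m3 == 0]].
  by rewrite /LG !inE !(linform_eqE G).
have inTG x : x \in ttr_zeros A' B' C' u' -> x + r%:~R \in TG by move=> h; exact: (map_f (fun y => y + r%:~R) h).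
have {}mem x m0 m1 m2 m3 : x \in ttr_zeros A' B' C' u' -> x + r%:~R = linform rho m0 m1 m2 m3 ->
    linform rho m0 m1 m2 m3 \in LG by move=> h; apply: mem; exact: inTG.
have kd' : [/\ (k0 <= d)%N, (k1 <= d)%N, (k4 <= d)%N & (k7 <= d)%N].
  by move: kd => /=; split; lia.
have F1 : linform rho r 0 0 0 \in LG.
  by apply: (mem 0); [rewrite !inE eqxx | rewrite /linform; ring].
have F2 : linform rho (1 + N'%:Z + r) 0 0 0 \in LG.
  by apply: (mem (1 - C')); [rewrite !inE eqxx !orbT | rewrite /linform /C' !intrD; ring].
have F3 : linform rho (r - sg) (-1) (-1) 0 \in LG.
  apply: (mem (1 - s')); first by rewrite !inE eqxx !orbT.
  by rewrite Esg /linform /s /ps !(intrD, intrN); ring.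
have F4 : linform rho (r - N'%:Z - 1 - sg) (-1) (-1) 0 \in LG.
  apply: (mem (C' - s')); first by rewrite !inE eqxx !orbT.
  by rewrite Esg /linform /s /ps /C' !(intrD, intrN); ring.
rewrite !memE in F1 F2 F3 F4.
have [e0 e4 e1 e7] : [/\ r = k0, N'%:Z + r = N + k4, r - sg = k1 & r - N'%:Z - sg = k7%:Z - N].
  have NE : N = (rN rho)%:Z by [].
  case: kd' => kd0 kd1 kd4 kd7; clear - F1 F2 F3 F4 NE kd0 kd1 kd4 kd7 dN rN2.
  split. lia. lia. lia. lia.
have EB : B' = linform rho (sg + 2 + N'%:Z - N - 2 * eta) 1 1 1 - A'.
  have := erefl s'; rewrite {1}Esg {1}/s' /ssum /C' /u' /s /ps /pu => E.
  have -> : B' = A' + B' - N'%:R - 1 - (rC rho - (rN rho)%:R - 2 * eta%:~R) - A' + N'%:R + 1 +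
     (rC rho - (rN rho)%:R - 2 * eta%:~R) by ring.
  by rewrite -E /linform /N !(intrD, intrN, intrM); ring.
have key m0 m1 m2 m3 : 1 - A' + r%:~R = linform rho m0 m1 m2 m3 ->
  [/\ A' = linform rho (1 + r - m0) (- m1) (- m2) (- m3),
      B' = linform rho (sg + 1 + N'%:Z - N - 2 * eta - r + m0) (1 + m1) (1 + m2) (1 + m3),
      linform rho (2 * r - (sg + N'%:Z - N - 2 * eta) - m0) (-1 - m1) (-1 - m2) (-1 - m3) \in LG,
      linform rho (2 * r - m0 - sg) (- m1 - 1) (- m2 - 1) (- m3) \in LG &
      linform rho (N'%:Z - N - 2 * eta + m0) m1 m2 (1 + m3) \in LG].
  move=> E; have EA : A' = linform rho (1 + r - m0) (- m1) (- m2) (- m3).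
    have -> : A' = 1 + r%:~R - (1 - A' + r%:~R) by ring.
    by rewrite E /linform !(intrD, intrN); ring.
  have EB' : B' = linform rho (sg + 1 + N'%:Z - N - 2 * eta - r + m0) (1 + m1) (1 + m2) (1 + m3).
    by rewrite EB EA /linform !(intrD, intrN, intrM); ring.
  split=> //.
  - apply: (mem (1 - B')); first by rewrite !inE eqxx !orbT.
    by rewrite EB' /linform !(intrD, intrN, intrM); ring.
  - apply: (mem (A' - s')); first by rewrite !inE eqxx !orbT.
    by rewrite EA Esg /linform /s /ps !(intrD, intrN, intrM); ring.
  - apply: (mem (B' - s')); first by rewrite !inE eqxx !orbT.
    by rewrite EB' Esg /linform /s /ps !(intrD, intrN, intrM); ring.
have hA : 1 - A' + r%:~R \in LG by rewrite (perm_mem HG); apply: inTG; rewrite !inE eqxx !orbT.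
have good : (A' = linform rho (1 + r - k2%:Z) 1 0 0 /\ B' = linform rho (1 + r - k3%:Z) 0 1 1
             \/ A' = linform rho (1 + r - k3%:Z) 0 1 1 /\ B' = linform rho (1 + r - k2%:Z) 1 0 0)
   /\ [/\ sg = 3 * r - k2%:Z - k3%:Z - k4%:Z + 2 * eta, 2 * r - k2%:Z - sg = k5 & 2 * r - k3%:Z - sg = k6].
  move: hA; rewrite /LG !inE => /orP[|/orP[|/orP[|/orP[|/orP[|/orP[|/orP[|]]]]]]] /eqP /key[EA EB'];
    rewrite !memE; try (by lia) => h1 h2 h3.
  - split; [left|split; lia]; split; rewrite ?EA ?EB' //; congr linform; lia.
  - split; [right|split; lia]; split; rewrite ?EA ?EB' //; congr linform; lia.
case: good => good [g1 g2 g3].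
exists (- eta), (r - k2%:Z + eta), (r - k3%:Z + eta), (r - k4%:Z + eta); split.
- by rewrite opprK.
- lia.
- case: good => [[-> ->]|[-> ->]]; [left|right]; split; rewrite /linform /pA /pB !(intrD, intrN); ring.
- by split; split; lia.
- by split; lia.
Qed.

End Classify.

(** * Relations between monic Racah polynomials *)

Section MonicRacah.
Variable K : numFieldType.
Implicit Types (rho : racahParam K) (i n m : nat).

(** The monic Racah polynomial, its leading coefficient and the coefficient of
    its recurrence. *)
Definition mracah rho (xi : K) i : {poly K} := mpol (pA rho) (pB rho) (pC rho) (pu rho) xi i.
Definition leadR rho i : K := leadP (pA rho) (pB rho) (pC rho) (pu rho) i.
Definition ttrR rho (z : K) : K := ttr_coef (pA rho) (pB rho) (pC rho) (pu rho) z.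

(** What [racah_wf] says about the hypergeometric parameters. *)
Lemma wf_poch_neq0 rho M : racah_wf rho -> (M <= rN rho)%N ->
  [/\ poch (pA rho) M != 0, poch (pB rho) M != 0, poch (pC rho) M != 0 &
    forall m, (0 < m < M.*2)%N -> m%:R + ssum (pA rho) (pB rho) (pC rho) (pu rho) != 0].
Proof.
move=> [h1 h2 h3] hM; split; [exact: poch_neq0_le hM h1|exact: poch_neq0_le hM h2|exact: poch_pC|].
move=> m hm; rewrite ssumE /ps.
pose i := (m./2).+1; have hi : (i <= rN rho)%N by rewrite /i; lia.
have /poch_neq0P/(_ (m - i)%N) := h3 i hi.
have -> : i%:R + rA rho + rB rho + 1 + (m - i)%:R = m%:R + (rA rho + rB rho + 1).
  rewrite natrB; last by rewrite /i; lia.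
  by ring.
by apply; rewrite /i; lia.
Qed.

Section Wf.
Variables (rho : racahParam K) (xi : K).
Hypothesis wf : racah_wf rho.

Lemma mracah_lead i : (i <= rN rho)%N -> (mracah rho xi i)`_i = 1.
Proof. by move=> h; have [h1 h2 h3 h4] := wf_poch_neq0 wf (leqnn _); apply: mpol_lead h. Qed.

Lemma size_mracah i : (i <= rN rho)%N -> size (mracah rho xi i) = i.+1.
Proof. by move=> h; have [h1 h2 h3 h4] := wf_poch_neq0 wf (leqnn _); apply: size_mpol h. Qed.

Lemma leadR_neq0 i : (i <= rN rho)%N -> leadR rho i != 0.
Proof. by move=> h; have [h1 h2 h3 h4] := wf_poch_neq0 wf (leqnn _); apply: leadP_neq0 h. Qed.

Lemma RQ_mracah i : (i <= rN rho)%N -> RQ rho xi i = leadR rho i *: mracah rho xi i.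
Proof.
by move=> h; rewrite /mracah /mpol scalerA divff ?scale1r // leadR_neq0.
Qed.

Lemma mracah_ttr i : (1 < i < rN rho)%N ->
  exists b, 'X * mracah rho xi i = mracah rho xi i.+1 + b *: mracah rho xi i + ttrR rho i%:R *: mracah rho xi i.-1.
Proof.
move=> /andP[i1 iN]; have [h1 h2 h3 h4] := wf_poch_neq0 wf (leqnn _).
apply: (ttr xi h1 h2 h3 h4); first by rewrite (ltnW i1) iN.
have := h4 (i.*2 - 2)%N; rewrite natrB; last by lia.
rewrite natr_double addrAC; apply; lia.
Qed.

Lemma mracah_coefs : exists P1 P2 : K -> K, [/\ polyfun 4 P1, polyfun 8 P2,
  forall i : nat, (0 < i <= rN rho)%N ->
     (mracah rho xi i)`_i.-1 = P1 i%:R / (2 * i%:R + ps rho - 1) &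
  forall i : nat, (1 < i <= rN rho)%N ->
     (mracah rho xi i)`_i.-2 = P2 i%:R / ((2 * i%:R + ps rho - 1) * (2 * i%:R + ps rho - 2))].
Proof.
have [h1 h2 h3 h4] := wf_poch_neq0 wf (leqnn _).
by have := top_coefs xi h1 h2 h3 h4; rewrite ssumE.
Qed.

Lemma wf_ps_neq0 i m : (i <= rN rho)%N -> (0 < m < i.*2)%N -> 2 * i%:R + ps rho - m%:R != 0.
Proof.
move=> iN mi; have [_ _ _] := wf_poch_neq0 wf (leqnn _); rewrite ssumE => h.
have := h (i.*2 - m)%N; rewrite natrB; last by lia.
rewrite natr_double addrAC; apply; lia.
Qed.

End Wf.
End MonicRacah.

Section Relation.
Variables (K : numFieldType) (rho rhot : racahParam K) (eta : int).
Hypotheses (G : generic rho) (wft : racah_wf rhot).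
Hypothesis hu : pu rhot = pu rho - 2 * eta%:~R.
Variables (xi kap : K) (h : bool) (c1 c2 : nat -> K) (M : nat).
Hypothesis M40 : (40 <= M)%N.
Hypotheses (MN : (M <= rN rho)%N) (MN' : (M <= rN rhot)%N).

Let wf := generic_wf G.
Let P i := mracah rho 0 i.
Let Q i := mracah rhot xi i.
(** The multiplier, of degree h. *)
Definition lamP : {poly K} := if h then 'X - kap%:P else 1.

Hypothesis rel : forall i, (2 <= i)%N -> (i + h <= M)%N ->
  lamP * P i = Q (i + h) + c1 i *: Q (i + h).-1 + c2 i *: Q (i + h).-2.

Lemma lamP_coef1 (p : {poly K}) i : (lamP * p)`_(i.+1 + h).-1 = p`_i - h%:R * kap * p`_i.+1.
Proof.
rewrite /lamP; case: (h) => /=; last by rewrite mul1r mul0r mul0r subr0 addn0.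
by rewrite mulrBl coefB coefXM coefCM mul1r addn1.
Qed.

Lemma lamP_coef2 (p : {poly K}) i : (lamP * p)`_(i.+2 + h).-2 = p`_i - h%:R * kap * p`_i.+1.
Proof.
rewrite /lamP; case: (h) => /=; last by rewrite mul1r mul0r mul0r subr0 addn0.
by rewrite mulrBl coefB coefXM coefCM mul1r addn1.
Qed.

(** The coefficients c1, c2 are found by comparing the two coefficients below
    the leading one; they are rational functions of i with known denominators. *)
Lemma relation_coefs : exists n1 n2 : K -> K, [/\ polyfun 5 n1, polyfun 11 n2,
  forall i, (2 <= i)%N -> (i + h <= M)%N ->
    c1 i * ((2 * i%:R + ps rho - 1) * (2 * (i%:R + h%:R) + ps rhot - 1)) = n1 i%:R &
  forall i, (2 <= i)%N -> (i + h <= M)%N ->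
    c2 i * ((2 * i%:R + ps rho - 1) * (2 * i%:R + ps rho - 2) *
     ((2 * (i%:R + h%:R) + ps rhot - 1) * (2 * (i%:R + h%:R) + ps rhot - 2)
        * (2 * (i%:R + h%:R) + ps rhot - 3))) = n2 i%:R].
Proof.
have [P1 [P2 [pP1 pP2 HP1 HP2]]] := mracah_coefs 0 wf.
have [Q1 [Q2 [pQ1 pQ2 HQ1 HQ2]]] := mracah_coefs xi wft.
have HQ1q i : _ -> (Q i)`_i.-1 = _ := HQ1 i; have HQ2q i : _ -> (Q i)`_i.-2 = _ := HQ2 i.
set s := ps rho in HP1 HP2 *; set s' := ps rhot in HQ1q HQ2q *.
pose k := h%:R * kap; pose hh : K := h%:R.
pose n1 z := P1 z * (2 * (z + hh) + s' - 1) - k * ((2 * z + s - 1) * (2 * (z + hh) + s' - 1))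
   - Q1 (z + hh) * (2 * z + s - 1).
have pl1 (a b : K) : polyfun 1 (fun z => 2 * z + a - b) by apply: polyfun_lin2.
have pl2 (a b : K) : polyfun 1 (fun z => 2 * (z + hh) + a - b).
  by apply: (@polyfun_shift K 1 hh (fun z => 2 * z + a - b)).
have pn1 : polyfun 5 n1.
  apply: polyfun_add; [apply: polyfun_add|].
  - exact: (@polyfun_mul _ 4 1).
  - apply: polyfun_opp; apply: (@polyfun_le _ 2) => //; apply: (@polyfun_mul _ 0 2); first exact: polyfun_const.
    exact: (@polyfun_mul _ 1 1).
  - by apply: polyfun_opp; apply: (@polyfun_mul _ 4 1) => //; exact: polyfun_shift.
pose n2 z := P2 z * ((2 * (z + hh) + s' - 1) * (2 * (z + hh) + s' - 2) * (2 * (z + hh) + s' - 3))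
  - k * (P1 z * (2 * z + s - 2) * ((2 * (z + hh) + s' - 1) * (2 * (z + hh) + s' - 2) * (2 * (z + hh) + s' - 3)))
  - Q2 (z + hh) * ((2 * z + s - 1) * (2 * z + s - 2) * (2 * (z + hh) + s' - 3))
  - n1 z * (Q1 (z + (hh - 1)) * ((2 * z + s - 2) * (2 * (z + hh) + s' - 2))).
have pn2 : polyfun 11 n2.
  have p3 : polyfun 3 (fun z => (2 * (z + hh) + s' - 1) * (2 * (z + hh) + s' - 2) * (2 * (z + hh) + s' - 3)).
    by apply: (@polyfun_mul _ 2 1) => //; apply: (@polyfun_mul _ 1 1).
  apply: polyfun_add; [apply: polyfun_add; [apply: polyfun_add|]|].
  - exact: (@polyfun_mul _ 8 3).
  - apply: polyfun_opp; apply: (@polyfun_le _ 8) => //; apply: (@polyfun_mul _ 0 8); first exact: polyfun_const.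
    by apply: (@polyfun_mul _ 5 3) => //; apply: (@polyfun_mul _ 4 1).
  - apply: polyfun_opp; apply: (@polyfun_mul _ 8 3); first exact: polyfun_shift.
    by apply: (@polyfun_mul _ 2 1) => //; apply: (@polyfun_mul _ 1 1).
  - apply: polyfun_opp; apply: (@polyfun_mul _ 5 6) => //; apply: (@polyfun_mul _ 4 2); first exact: polyfun_shift.
    by apply: (@polyfun_mul _ 1 1).
have C1 i : (2 <= i)%N -> (i + h <= M)%N ->
   c1 i = P1 i%:R / (2 * i%:R + s - 1) - k - Q1 (i%:R + hh) / (2 * (i%:R + hh) + s' - 1).
  case: i => // i i2 iM; have : (lamP * P i.+1)`_(i.+1 + h).-1 =
    (Q (i.+1 + h) + c1 i.+1 *: Q (i.+1 + h).-1 + c2 i.+1 *: Q (i.+1 + h).-2)`_(i.+1 + h).-1.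
    by rewrite rel.
  rewrite lamP_coef1 !coefD (coefZ (c1 _)) (coefZ (c2 _)) HQ1q; last by lia.
  rewrite (_ : (Q (i.+1 + h).-1)`_((i.+1 + h).-1) = 1); last by apply: mracah_lead => //; lia.
  rewrite (_ : (Q (i.+1 + h).-2)`_((i.+1 + h).-1) = 0); last first.
    by rewrite nth_default // size_mracah //; lia.
  rewrite (mracah_lead 0 wf) ?mulr1 ?mulr0 ?addr0; last by lia.
  have -> : (P i.+1)`_i = P1 i.+1%:R / (2 * i.+1%:R + s - 1) by rewrite -HP1 //; lia.
  by rewrite natrD -/hh -/k => ->; ring.
have C2 i : (2 <= i)%N -> (i + h <= M)%N ->
   c2 i = P2 i%:R / ((2 * i%:R + s - 1) * (2 * i%:R + s - 2)) - k * (P1 i%:R / (2 * i%:R + s - 1))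
    - Q2 (i%:R + hh) / ((2 * (i%:R + hh) + s' - 1) * (2 * (i%:R + hh) + s' - 2))
    - c1 i * (Q1 (i%:R + (hh - 1)) / (2 * (i%:R + hh) + s' - 3)).
  case: i => // -[|i] // i2 iM; have : (lamP * P i.+2)`_(i.+2 + h).-2 =
    (Q (i.+2 + h) + c1 i.+2 *: Q (i.+2 + h).-1 + c2 i.+2 *: Q (i.+2 + h).-2)`_(i.+2 + h).-2.
    by rewrite rel.
  rewrite lamP_coef2 !coefD (coefZ (c1 _)) (coefZ (c2 _)) HQ2q; last by lia.
  have -> : (Q (i.+2 + h).-1)`_((i.+2 + h).-2) = Q1 (i.+2%:R + (hh - 1)) / (2 * (i.+2%:R + hh) + s' - 3).
    have hi : (0 < (i.+2 + h).-1 <= rN rhot)%N by rewrite addSn /=; lia.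
    rewrite (HQ1q _ hi).
    have -> : (i.+2 + h).-1%:R = i.+2%:R + (hh - 1) :> K.
      by rewrite -[(i.+2 + h).-1]/(i.+1 + h)%N natrD -[i.+2%:R]natr1 -/hh; ring.
    by congr (_ / _); ring.
  rewrite (_ : (Q (i.+2 + h).-2)`_((i.+2 + h).-2) = 1); last by apply: mracah_lead => //; lia.
  have -> : (P i.+2)`_i = P2 i.+2%:R / ((2 * i.+2%:R + s - 1) * (2 * i.+2%:R + s - 2)).
    by rewrite -HP2 //; lia.
  have -> : (P i.+2)`_i.+1 = P1 i.+2%:R / (2 * i.+2%:R + s - 1) by rewrite -HP1 //; lia.
  by rewrite natrD -/hh -/k mulr1 => ->; ring.
have E1 i : (2 <= i)%N -> (i + h <= M)%N ->
    c1 i * ((2 * i%:R + s - 1) * (2 * (i%:R + hh) + s' - 1)) = n1 i%:R.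
  move=> i2 iM; rewrite C1 // /n1.
  have a1 : 2 * i%:R + s - 1 != 0 by apply: (@wf_ps_neq0 K rho wf i 1); lia.
  have b1 : 2 * (i%:R + hh) + s' - 1 != 0.
    by rewrite /hh -natrD; apply: (@wf_ps_neq0 K rhot wft (i + h) 1); lia.
  by move: (P1 _) (Q1 _) => p q; field; rewrite a1 b1.
exists n1, n2; split=> // i i2 iM.
have a1 : 2 * i%:R + s - 1 != 0 by apply: (@wf_ps_neq0 K rho wf i 1); lia.
have a2 : 2 * i%:R + s - 2 != 0 by apply: (@wf_ps_neq0 K rho wf i 2); lia.
have b1 : 2 * (i%:R + hh) + s' - 1 != 0.
  by rewrite /hh -natrD; apply: (@wf_ps_neq0 K rhot wft (i + h) 1); lia.
have b2 : 2 * (i%:R + hh) + s' - 2 != 0.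
  by rewrite /hh -natrD; apply: (@wf_ps_neq0 K rhot wft (i + h) 2); lia.
have b3 : 2 * (i%:R + hh) + s' - 3 != 0.
  by rewrite /hh -natrD; apply: (@wf_ps_neq0 K rhot wft (i + h) 3); lia.
rewrite /n2 -(E1 i) // (C2 i) //.
move: (P1 _) (P2 _) (Q1 _) (Q2 _) (c1 i) => p p2 q q2 c.
move: (2 * (i%:R + hh) + s') (2 * i%:R + s) a1 a2 b1 b2 b3 => w w0 a1 a2 b1 b2 b3.
by field; rewrite a1 a2 b1 b2 b3.
Qed.

End Relation.

Lemma notin_ttr_poles (K : numFieldType) (rho0 : racahParam K) (w0 : racah_wf rho0) i :
  (2 <= i < rN rho0)%N ->
  i%:R \notin ttr_poles (ssum (pA rho0) (pB rho0) (pC rho0) (pu rho0)).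
Proof.
move=> hi; have t0 : 2 != 0 :> K by rewrite pnatr_eq0.
have H1 (m : nat) : (m <= 2)%N -> i%:R != (m%:R - ps rho0) / 2.
  move=> m2; have : 2 * i%:R + ps rho0 - m%:R != 0.
    case: m m2 => [|m] m2; last by apply: (@wf_ps_neq0 K rho0 w0 i m.+1); lia.
    rewrite subr0 -natr_double; have [_ _ _] := wf_poch_neq0 w0 (leqnn _).
    by rewrite ssumE; apply; lia.
  by apply: contraNneq => ->; apply/eqP; field.
have H0 := H1 0%N isT; rewrite sub0r in H0.
by rewrite /ttr_poles ssumE !inE !negb_or (negPf H0) (negPf (H1 1%N isT)) (negPf (H1 2%N isT)).
Qed.

Section Relation.
Variables (K : numFieldType) (rho rhot : racahParam K) (eta : int).
Hypotheses (G : generic rho) (wft : racah_wf rhot).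
Hypothesis hu : pu rhot = pu rho - 2 * eta%:~R.
Variables (xi kap : K) (h : bool) (c1 c2 : nat -> K) (M : nat).
Hypothesis M40 : (40 <= M)%N.
Hypotheses (MN : (M <= rN rho)%N) (MN' : (M <= rN rhot)%N).

Let wf := generic_wf G.

Hypothesis rel : forall i, (2 <= i)%N -> (i + h <= M)%N ->
  lamP kap h * mracah rho 0 i = mracah rhot xi (i + h) + c1 i *: mracah rhot xi (i + h).-1
    + c2 i *: mracah rhot xi (i + h).-2.

(** Comparison of the lowest terms of X lam P_i, according to which of c2 and c1
    vanish. *)
Lemma relation_bottom i : (4 <= i)%N -> (i + h < M)%N ->
  [/\ ttrR rho i%:R * c2 i.-1 = c2 i * ttrR rhot (i%:R + h%:R - 2),
      c2 i = 0 -> ttrR rho i%:R * c1 i.-1 = c1 i * ttrR rhot (i%:R + h%:R - 1) &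
      c2 i = 0 -> c2 i.+1 = 0 -> c1 i = 0 -> ttrR rho i%:R = ttrR rhot (i%:R + h%:R)].
Proof.
move=> i4 iM; have [j ej] : exists j, i = j.+4 by exists (i - 4)%N; lia.
rewrite {i}ej /= in i4 iM *.
have [b Tb] := mracah_ttr 0 wf (i := j.+4) (ltac:(lia)).
have [b1 T1] := mracah_ttr xi wft (i := (j.+2 + h)%N) (ltac:(lia)).
have [b2 T2] := mracah_ttr xi wft (i := (j.+3 + h)%N) (ltac:(lia)).
have [b3 T3] := mracah_ttr xi wft (i := (j.+4 + h)%N) (ltac:(lia)).
have R2 := rel (i := j.+3) isT (ltac:(lia)).
have R3 := rel (i := j.+4) isT (ltac:(lia)).
have R4 := rel (i := j.+1.+4) isT (ltac:(lia)).
have sz k : (k <= M)%N -> size (mracah rhot xi k) = k.+1.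
  by move=> kM; apply: size_mracah => //; lia.
have [||||E0 E1 E2] := bottom_coefs _ _ _ _ R2 R3 R4 Tb T1 T2 T3.
- by rewrite sz //=; lia.
- by rewrite /= !sz //; lia.
- by rewrite /= !sz //; lia.
- by rewrite /= !sz //; lia.
have e1 : (j.+2 + h)%:R = j.+4%:R + h%:R - 2 :> K.
  by rewrite natrD -[j.+4%:R]natr1 -[j.+3%:R]natr1; ring.
have e2 : (j.+3 + h)%:R = j.+4%:R + h%:R - 1 :> K.
  by rewrite natrD -[j.+4%:R]natr1; ring.
rewrite -e1 -e2 -natrD; split=> //.
- by move=> c0; move: E1; rewrite c0 mulr0 mul0r addr0 add0r.
- by move=> c0 c0' c0''; move: E2; rewrite c0 c0' c0'' mulr0 mul0r !addr0 add0r.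
Qed.

(** The poles of the last nonzero coefficient c_m. *)
Definition relation_poles (m : nat) : seq K :=
  match m with
  | 0 => [::]
  | 1 => [:: (1 - ps rho) / 2; (1 - 2 * h%:R - ps rhot) / 2]
  | _ => [:: (1 - ps rho) / 2; (2 - ps rho) / 2;
    (1 - 2 * h%:R - ps rhot) / 2; (2 - 2 * h%:R - ps rhot) / 2; (3 - 2 * h%:R - ps rhot) / 2]
  end.

(** Here m is the largest index of a coefficient that does not vanish
    identically, with c_0 = 1.  For m = 2 the numerator of c_m has degree at
    most 11 and c_m has 5 poles, so 11 + 5 + 12 + 1 consecutive indices are
    needed, from 4 on; this is the origin of the bound 40. *)
Lemma classify_monic : exists m : nat, [/\ (m <= 2)%N,
  (m <= 1)%N -> forall i, (2 <= i)%N -> (i + h <= M)%N -> c2 i = 0,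
  (m <= 0)%N -> forall i, (2 <= i)%N -> (i + h <= M)%N -> c1 i = 0,
  m = 2 -> ~ (forall i, (2 <= i)%N -> (i + h <= M)%N -> c2 i = 0) &
  exists t1 t2 t3 t4 : int,
   [/\ eta = - t1, (rN rhot)%:Z = (rN rho)%:Z - t1 - t4,
      (pA rhot = pA rho + (t1 + t2)%:~R /\ pB rhot = pB rho + (t1 + t3)%:~R)
      \/ (pA rhot = pB rho + (t1 + t3)%:~R /\ pB rhot = pA rho + (t1 + t2)%:~R),
      [/\ t1 + t2 <= m%:Z - h%:Z, t1 + t3 <= m%:Z - h%:Z & t1 + t4 <= m%:Z - h%:Z] /\
      [/\ t2 + t3 <= m%:Z - h%:Z, t2 + t4 <= m%:Z - h%:Z & t3 + t4 <= m%:Z - h%:Z] &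
      t1 + t2 + t3 + t4 <= m%:Z - h%:Z /\
      4 * (m%:Z - h%:Z) - 2 * (t1 + t2 + t3 + t4) <= (size (relation_poles m))%:Z]].
Proof.
have t0 : 2 != 0 :> K by rewrite pnatr_eq0.
have [n1 [n2 [pn1 pn2 E1 E2]]] := relation_coefs G wft M40 MN MN' rel.
have h1 : (h <= 1)%N by case: (h).
pose r m : int := m%:Z - h%:Z.
have main (m d : nat) (c : nat -> K) (n : K -> K) : (m <= 2)%N -> (d <= 11)%N ->
    polyfun d n -> (exists z, n z != 0) ->
    (forall i, (2 <= i)%N -> (i + h <= M)%N -> c i * \prod_(x <- relation_poles m) (i%:R - x) = n i%:R) ->
    (forall i, (4 <= i)%N -> (i + h < M)%N ->
       ttrR rho i%:R * c i.-1 = c i * ttrR rhot (i%:R + h%:R - m%:R)) ->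
    exists t1 t2 t3 t4 : int,
   [/\ eta = - t1, (rN rhot)%:Z = (rN rho)%:Z - t1 - t4,
      (pA rhot = pA rho + (t1 + t2)%:~R /\ pB rhot = pB rho + (t1 + t3)%:~R)
      \/ (pA rhot = pB rho + (t1 + t3)%:~R /\ pB rhot = pA rho + (t1 + t2)%:~R),
      [/\ t1 + t2 <= r m, t1 + t3 <= r m & t1 + t4 <= r m] /\
      [/\ t2 + t3 <= r m, t2 + t4 <= r m & t3 + t4 <= r m] &
      t1 + t2 + t3 + t4 <= r m /\ 4 * r m - 2 * (t1 + t2 + t3 + t4) <= (size (relation_poles m))%:Z].
  move=> m2 d11 pn n0 hc H.
  have sz5 : (size (relation_poles m) <= 5)%N by case: (m) m2 => [|[|]].
  have er i : i%:R - (r m)%:~R = i%:R + h%:R - m%:R :> K by rewrite /r intrB; ring.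
  have er2 i : (4 <= i)%N -> i%:R + h%:R - m%:R = (i + h - m)%:R :> K.
    by move=> i4; rewrite natrB ?natrD //; lia.
  have [] := @ttr_match K (pA rho) (pB rho) (pC rho) (pu rho) (pA rhot) (pB rhot)
    (pC rhot) (pu rhot) (relation_poles m) (r m)%:~R n c d 4 pn n0 isT.
  - by move=> i hi; apply: notin_ttr_poles => //; lia.
  - by move=> i hi; rewrite er er2; [apply: notin_ttr_poles => //; lia | lia].
  - by move=> i hi; apply: hc; move: hi => /=; lia.
  - by move=> i hi; rewrite er; apply: H; lia.
  move=> ks; rewrite (ssumE rho) hu => -[k1 k2 k3].
  have g1 : (d < rN rho)%N by lia.
  have g2 : r m <= (rN rho)%:Z by rewrite /r; lia.
  apply: (@classify_match K rho G (pA rhot) (pB rhot) (rN rhot) eta (r m) (relation_poles m) d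
    g1 g2 _ ks k1 k2 k3).
  move=> x; rewrite -hu ssumE.
  case: (m) => [|[|m']] //=; rewrite !inE.
    case/orP => /eqP ->; [left; exists 1 => //|right; exists (1 - 2 * h%:Z)].
    by rewrite intrB intrM.
  case/or4P => [/eqP ->|/eqP ->|/eqP ->|/orP[] /eqP ->].
  - by left; exists 1.
  - by left; exists 2.
  - by right; exists (1 - 2 * h%:Z); rewrite intrB intrM.
  - by right; exists (2 - 2 * h%:Z); rewrite intrB intrM.
  - by right; exists (3 - 2 * h%:Z); rewrite intrB intrM.
have nz (n : K -> K) : (exists z, n z != 0) \/ forall z, n z = 0.
  have [H|H] := classic (exists z, n z != 0); [by left|right=> z].
  by apply/eqP/negPn/negP => h0; apply: H; exists z.
have D2 i : \prod_(x <- relation_poles 2) (i%:R - x) = 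
    ((2 * i%:R + ps rho - 1) * (2 * i%:R + ps rho - 2) *
     ((2 * (i%:R + h%:R) + ps rhot - 1) * (2 * (i%:R + h%:R) + ps rhot - 2)
        * (2 * (i%:R + h%:R) + ps rhot - 3))) / 32.
  have t32 : 32 != 0 :> K by rewrite pnatr_eq0.
  by rewrite /relation_poles !big_cons big_nil; field.
have D1 i : \prod_(x <- relation_poles 1) (i%:R - x) = 
    ((2 * i%:R + ps rho - 1) * (2 * (i%:R + h%:R) + ps rhot - 1)) / 4.
  have t4 : 4 != 0 :> K by rewrite pnatr_eq0.
  by rewrite /relation_poles !big_cons big_nil; field.
have [N2|Z2] := nz n2.
  exists 2%N; split=> //.
    move=> _ Z; have [z] := N2; rewrite (@polyfun_zero K 11 n2 2) ?eqxx // => i hi.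
    by rewrite -E2 ?Z ?mul0r //; lia.
  apply: (@main 2 11 c2 (fun z => n2 z * 32^-1)) => //.
  - by apply: (@polyfun_mul _ 11 0) => //; exact: polyfun_const.
  - have [z hz] := N2; exists z; rewrite mulf_neq0 // invr_eq0 pnatr_eq0 //.
  - by move=> i i2 iM; rewrite D2 mulrA E2.
  - by move=> i i4 iM; have [] := relation_bottom i4 iM.
have c20 i : (2 <= i)%N -> (i + h <= M)%N -> c2 i = 0.
  move=> i2 iM; move/eqP: (E2 i i2 iM); rewrite Z2 mulf_eq0 => /orP[/eqP //|].
  have a1 : 2 * i%:R + ps rho - 1 != 0 by apply: (@wf_ps_neq0 K rho wf i 1); lia.
  have a2 : 2 * i%:R + ps rho - 2 != 0 by apply: (@wf_ps_neq0 K rho wf i 2); lia.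
  have b (k : nat) : (0 < k <= 3)%N -> 2 * (i%:R + h%:R) + ps rhot - k%:R != 0.
    by move=> hk; rewrite -natrD; apply: (@wf_ps_neq0 K rhot wft (i + h) k); lia.
  have b1 := b 1%N isT; have b2 := b 2%N isT; have b3 := b 3%N isT.
  by rewrite !mulf_eq0 (negPf a1) (negPf a2) (negPf b1) (negPf b2) (negPf b3).
have [N1|Z1] := nz n1.
  exists 1%N; split=> //; apply: (@main 1 5 c1 (fun z => n1 z * 4^-1)) => //.
  - by apply: (@polyfun_mul _ 5 0) => //; exact: polyfun_const.
  - have [z hz] := N1; exists z; rewrite mulf_neq0 // invr_eq0 pnatr_eq0 //.
  - by move=> i i2 iM; rewrite D1 mulrA E1.
  - by move=> i i4 iM; have [_ + _] := relation_bottom i4 iM; apply; apply: c20; lia.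
have c10 i : (2 <= i)%N -> (i + h <= M)%N -> c1 i = 0.
  move=> i2 iM; move/eqP: (E1 i i2 iM); rewrite Z1 mulf_eq0 => /orP[/eqP //|].
  have a1 : 2 * i%:R + ps rho - 1 != 0 by apply: (@wf_ps_neq0 K rho wf i 1); lia.
  have b1 : 2 * (i%:R + h%:R) + ps rhot - 1 != 0.
    by rewrite -natrD; apply: (@wf_ps_neq0 K rhot wft (i + h) 1); lia.
  by rewrite mulf_eq0 (negPf a1) (negPf b1).
exists 0%N; split=> //; apply: (@main 0 0 (fun=> 1) (fun=> 1)) => //.
- exact: polyfun_const.
- by exists 0; rewrite oner_eq0.
- by move=> i _ _; rewrite big_nil mulr1.
- move=> i i4 iM; rewrite subr0 mulr1 mul1r; have [_ _] := relation_bottom i4 iM.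
  by apply; [apply: c20|apply: c20|apply: c10]; lia.
Qed.

End Relation.

(** * Enumeration of the shift vectors *)

(** The vector (t1, t2, t3, t4) of an elementary step; the step adds t1 + t2 to A,
    t1 + t3 to B, t1 + t4 to C, and - t1 to x.  The trivial step is [None]. *)
Definition vec (k : option racahCase) : int * int * int * int :=
  match k with
  | None => (0, 0, 0, 0)
  | Some RIII => (1, 0, 0, 0)
  | Some RIV => (0, 1, 0, 0)
  | Some RII => (0, 0, 1, 0)
  | Some RI => (0, 0, 0, 1)
  end.

Definition isvec (t1 t2 t3 t4 : int) (v : int * int * int * int) : Prop :=
  [/\ t1 = v.1.1.1, t2 = v.1.1.2, t3 = v.1.2 & t4 = v.2].

(** All the sums of two coordinates are at most r. *)
Definition pairs_le (t1 t2 t3 t4 r : int) : Prop :=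
  [/\ t1 + t2 <= r, t1 + t3 <= r & t1 + t4 <= r] /\
  [/\ t2 + t3 <= r, t2 + t4 <= r & t3 + t4 <= r].

Lemma steps_sum1 t1 t2 t3 t4 : pairs_le t1 t2 t3 t4 1 -> t1 + t2 + t3 + t4 = 1 ->
  exists k : racahCase, isvec t1 t2 t3 t4 (vec (Some k)).
Proof.
move=> [[h1 h2 h3] [h4 h5 h6]] s.
have : [\/ [/\ t1 = 1, t2 = 0, t3 = 0 & t4 = 0], [/\ t1 = 0, t2 = 1, t3 = 0 & t4 = 0],
  [/\ t1 = 0, t2 = 0, t3 = 1 & t4 = 0] | [/\ t1 = 0, t2 = 0, t3 = 0 & t4 = 1]].
  have [e1|[e1|[e1|e1]]] : (t1 = 1) \/ (t2 = 1) \/ (t3 = 1) \/ (t4 = 1) by lia.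
  - by apply: Or41; split; lia.
  - by apply: Or42; split; lia.
  - by apply: Or43; split; lia.
  - by apply: Or44; split; lia.
by case=> -[-> -> -> ->]; [exists RIII|exists RIV|exists RII|exists RI].
Qed.

Lemma steps_sum0 t1 t2 t3 t4 : pairs_le t1 t2 t3 t4 0 -> t1 + t2 + t3 + t4 = 0 ->
  isvec t1 t2 t3 t4 (vec None).
Proof. by move=> [[h1 h2 h3] [h4 h5 h6]] s; split=> /=; lia. Qed.

Definition vadd (v w : int * int * int * int) : int * int * int * int :=
  (v.1.1.1 + w.1.1.1, v.1.1.2 + w.1.1.2, v.1.2 + w.1.2, v.2 + w.2).
Definition vsub (v w : int * int * int * int) : int * int * int * int :=
  (v.1.1.1 - w.1.1.1, v.1.1.2 - w.1.1.2, v.1.2 - w.1.2, v.2 - w.2).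

Lemma steps_sum0_le1 t1 t2 t3 t4 : pairs_le t1 t2 t3 t4 1 -> t1 + t2 + t3 + t4 = 0 ->
  isvec t1 t2 t3 t4 (vec None) \/
  exists j k : racahCase, j <> k /\ isvec t1 t2 t3 t4 (vsub (vec (Some j)) (vec (Some k))).
Proof.
move=> H s; have [[h1 h2 h3] [h4 h5 h6]] := H.
have [e|[e|[e|[e|e]]]] : (t1 = -1) \/ (t2 = -1) \/ (t3 = -1) \/ (t4 = -1) \/
  (t1 = 0 /\ t2 = 0 /\ t3 = 0 /\ t4 = 0) by lia.
- right; have [k [e1 e2 e3 e4]] := @steps_sum1 (t1 + 1) t2 t3 t4 (ltac:(by split; split; lia)) (ltac:(lia)).
  by exists k, RIII; case: k e1 e2 e3 e4 => /= e1 e2 e3 e4; split=> //; try split; lia.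
- right; have [k [e1 e2 e3 e4]] := @steps_sum1 t1 (t2 + 1) t3 t4 (ltac:(by split; split; lia)) (ltac:(lia)).
  by exists k, RIV; case: k e1 e2 e3 e4 => /= e1 e2 e3 e4; split=> //; try split; lia.
- right; have [k [e1 e2 e3 e4]] := @steps_sum1 t1 t2 (t3 + 1) t4 (ltac:(by split; split; lia)) (ltac:(lia)).
  by exists k, RII; case: k e1 e2 e3 e4 => /= e1 e2 e3 e4; split=> //; try split; lia.
- right; have [k [e1 e2 e3 e4]] := @steps_sum1 t1 t2 t3 (t4 + 1) (ltac:(by split; split; lia)) (ltac:(lia)).
  by exists k, RI; case: k e1 e2 e3 e4 => /= e1 e2 e3 e4; split=> //; try split; lia.
- by left; case: e => [-> [-> [-> ->]]].
Qed.

(** Besides the sums of two unit vectors, there are the vectors with three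
    coordinates 1 and one coordinate -1. *)
Lemma steps_sum2 t1 t2 t3 t4 : pairs_le t1 t2 t3 t4 2 -> t1 + t2 + t3 + t4 = 2 ->
  (exists j k : racahCase, isvec t1 t2 t3 t4 (vadd (vec (Some j)) (vec (Some k)))) \/
  exists d : racahCase, isvec t1 t2 t3 t4 (vsub (1, 1, 1, 1) (vadd (vec (Some d)) (vec (Some d)))).
Proof.
move=> H s; have [[h1 h2 h3] [h4 h5 h6]] := H.
have [e|[e|[e|[e|e]]]] : (t1 = -1) \/ (t2 = -1) \/ (t3 = -1) \/ (t4 = -1) \/
  (0 <= t1 /\ 0 <= t2 /\ 0 <= t3 /\ 0 <= t4) by lia.
- by right; exists RIII; split=> /=; lia.
- by right; exists RIV; split=> /=; lia.
- by right; exists RII; split=> /=; lia.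
- by right; exists RI; split=> /=; lia.
left; have [e1|[e1|[e1|e1]]] : (0 < t1) \/ (0 < t2) \/ (0 < t3) \/ (0 < t4) by lia.
- exists RIII; have [a|[a|[a|a]]] : t1 = 2 \/ t2 = 1 \/ t3 = 1 \/ t4 = 1 by lia.
  + by exists RIII; split=> /=; lia.
  + by exists RIV; split=> /=; lia.
  + by exists RII; split=> /=; lia.
  + by exists RI; split=> /=; lia.
- exists RIV; have [a|[a|[a|a]]] : t1 = 1 \/ t2 = 2 \/ t3 = 1 \/ t4 = 1 by lia.
  + by exists RIII; split=> /=; lia.
  + by exists RIV; split=> /=; lia.
  + by exists RII; split=> /=; lia.
  + by exists RI; split=> /=; lia.
- exists RII; have [a|[a|[a|a]]] : t1 = 1 \/ t2 = 1 \/ t3 = 2 \/ t4 = 1 by lia.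
  + by exists RIII; split=> /=; lia.
  + by exists RIV; split=> /=; lia.
  + by exists RII; split=> /=; lia.
  + by exists RI; split=> /=; lia.
- exists RI; have [a|[a|[a|a]]] : t1 = 1 \/ t2 = 1 \/ t3 = 1 \/ t4 = 2 by lia.
  + by exists RIII; split=> /=; lia.
  + by exists RIV; split=> /=; lia.
  + by exists RII; split=> /=; lia.
  + by exists RI; split=> /=; lia.
Qed.

Lemma steps_sumN1 t1 t2 t3 t4 : pairs_le t1 t2 t3 t4 0 -> t1 + t2 + t3 + t4 = -1 ->
  exists k : racahCase, isvec t1 t2 t3 t4 (vsub (vec None) (vec (Some k))).
Proof.
move=> [[h1 h2 h3] [h4 h5 h6]] s.
have [k [e1 e2 e3 e4]] := @steps_sum1 (- t1) (- t2) (- t3) (- t4) (ltac:(by split; split; lia)) (ltac:(lia)).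
by exists k; case: k e1 e2 e3 e4 => /= e1 e2 e3 e4; split=> /=; lia.
Qed.

(** * Shifted parameters and the four elementary steps *)

Section Shift.
Variable K : numFieldType.
Implicit Types (rho : racahParam K).

(** The parameters shifted by a vector, in terms of alpha, beta, gamma.  Since
    N is a natural number, its new value N' is given separately. *)
Definition shift_param (v : int * int * int * int) rho (N' : nat) : racahParam K :=
  RacahParam (rA rho + (v.1.1.1 + v.1.1.2)%:~R) (rB rho + (v.1.2 + v.2)%:~R)
    (rC rho + (v.1.1.1 - v.2)%:~R) N'.

(** The exchange of A and B, in terms of alpha and beta. *)
Definition swapR rho : racahParam K :=
  RacahParam (rB rho + rC rho) (rA rho - rC rho) (rC rho) (rN rho).

(** Equality of the families of polynomials, whatever the base point.  It is
    stronger than [racah_same], which bounds the index and does not compare the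
    lattices. *)
Definition same rho rho' : Prop :=
  [/\ rN rho = rN rho', pu rho = pu rho' &
      forall xi i, RQ rho xi i = RQ rho' xi i].

Lemma same_refl rho : same rho rho. Proof. by []. Qed.

Lemma same_sym rho rho' : same rho rho' -> same rho' rho.
Proof. by move=> [h1 h2 h3]; split. Qed.

Lemma same_swap rho : same (swapR rho) rho.
Proof.
split=> // xi i; rewrite /RQ /RP RPn_swap12.
by congr (RPn _ _ _ _ _ _ _); rewrite /pA /pB /pC /pu /=; ring.
Qed.

Lemma same_lattice rho rho' x : same rho rho' -> lattice rho x = lattice rho' x.
Proof. by move=> [_ h _]; rewrite !latticeE h. Qed.

Lemma same_racah rho rho' i x : same rho rho' -> racah rho i x = racah rho' i x.
Proof.
by move=> h; rewrite !(racahE _ 0) (same_lattice _ h); case: h => _ _ ->.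
Qed.

Lemma same_racah_same rho rho' : same rho rho' -> racah_same rho rho'.
Proof. by move=> h; split=> [|i _ x]; [case: h | exact: same_racah]. Qed.

(** Parameters found by [classify_match] are shifted parameters, up to the
    exchange of A and B. *)
Lemma shift_same rho rhot (eta t1 t2 t3 t4 : int) v :
  pu rhot = pu rho - 2 * eta%:~R -> eta = - t1 ->
  (rN rhot)%:Z = (rN rho)%:Z - t1 - t4 ->
  (pA rhot = pA rho + (t1 + t2)%:~R /\ pB rhot = pB rho + (t1 + t3)%:~R)
      \/ (pA rhot = pB rho + (t1 + t3)%:~R /\ pB rhot = pA rho + (t1 + t2)%:~R) ->
  isvec t1 t2 t3 t4 v ->
  same rhot (shift_param v rho (rN rhot)).
Proof.
move=> hu he hN H [e1 e2 e3 e4]; rewrite {}he in hu.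
have EN : (rN rhot)%:R = (rN rho)%:R - t1%:~R - t4%:~R :> K.
  by have := congr1 (fun z : int => z%:~R : K) hN; rewrite !(intrD, intrN).
have EC : rC rhot = rC rho + (t1 - t4)%:~R.
  have -> : rC rhot = pu rhot + (rN rhot)%:R by rewrite /pu; ring.
  by rewrite hu EN /pu !(intrD, intrN); ring.
have [[hA hB]|[hA hB]] := H.
  suff -> : rhot = shift_param v rho (rN rhot) by exact: same_refl.
  rewrite /shift_param -e1 -e2 -e3 -e4 -EC.
  have hA' : rA rhot = rA rho + (t1 + t2)%:~R by apply: (addIr 1); rewrite -/(pA rhot) hA /pA; ring.
  have hB' : rB rhot = rB rho + (t3 + t4)%:~R.
    have -> : rB rhot = pB rhot - rC rhot - 1 by rewrite /pB; ring.
    by rewrite hB EC /pB !(intrD, intrN); ring.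
  by rewrite -hA' -hB'; case: (rhot).
suff -> : rhot = swapR (shift_param v rho (rN rhot)) by exact: same_swap.
rewrite /swapR /shift_param /= -e1 -e2 -e3 -e4 -EC.
have hA' : rA rhot = rB rho + (t3 + t4)%:~R + rC rhot.
  by apply: (addIr 1); rewrite -/(pA rhot) hA EC /pB !(intrD, intrN); ring.
have hB' : rB rhot = rA rho + (t1 + t2)%:~R - rC rhot.
  have -> : rB rhot = pB rhot - rC rhot - 1 by rewrite /pB; ring.
  by rewrite hB /pA; ring.
by rewrite -hA' -hB'; case: (rhot).
Qed.

Lemma shift_generic v rho N' : generic rho -> generic (shift_param v rho N').
Proof. by move=> G; apply: generic_shift G _ _ _; rewrite /shift_param /=; reflexivity. Qed.

(** Target and shift of x of an elementary or trivial step. *)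
Definition step_target (k : option racahCase) rho : racahParam K :=
  if k is Some k then case_target k rho else rho.
Definition step_shift (k : option racahCase) : int :=
  if k is Some k then case_shift k else 0.

Lemma step_targetE k rho N' :
  (rN rho)%:Z - (vec k).1.1.1 - (vec k).2 = N'%:Z ->
  step_target k rho = shift_param (vec k) rho N'.
Proof.
case: rho => a b c N; case: k => [[]|] /= h; rewrite /shift_param /= ?(addr0, add0r, sub0r, subr0);
  congr RacahParam => //; lia.
Qed.

Lemma shift_param_comp v w rho M N' :
  shift_param v (shift_param w rho M) N' = shift_param (vadd w v) rho N'.
Proof. by rewrite /shift_param /=; congr RacahParam; rewrite !(intrD, intrN); ring. Qed.

(** The shift by a difference of two steps is a step followed by the inverse of
    another one: both ends have a common target. *)
Lemma step_sub (j k : option racahCase) rho N' : (2 <= rN rho)%N ->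
  (rN rho)%:Z - (vsub (vec j) (vec k)).1.1.1 - (vsub (vec j) (vec k)).2 = N'%:Z ->
  step_target k (shift_param (vsub (vec j) (vec k)) rho N') = step_target j rho.
Proof.
move=> N2 h; have hN : (2 <= rN rho)%N := N2.
pose M : nat := absz ((rN rho)%:Z - (vec j).1.1.1 - (vec j).2)%R.
have hM : M%:Z = (rN rho)%:Z - (vec j).1.1.1 - (vec j).2.
  by rewrite /M; case: (j) => [[]|] /=; lia.
rewrite (@step_targetE j rho M) //.
rewrite (@step_targetE k _ M); last by rewrite hM /=; move: h => /=; lia.
rewrite shift_param_comp; congr shift_param; rewrite /vadd /vsub /=.
by case: (vec j) (vec k) => [[[? ?] ?] ?] [[[? ?] ?] ?] /=; rewrite !subrK.
Qed.

Lemma step_add (j k : option racahCase) rho N' : (2 <= rN rho)%N ->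
  (rN rho)%:Z - (vadd (vec j) (vec k)).1.1.1 - (vadd (vec j) (vec k)).2 = N'%:Z ->
  shift_param (vadd (vec j) (vec k)) rho N' = step_target k (step_target j rho).
Proof.
move=> N2 h.
pose M : nat := absz ((rN rho)%:Z - (vec j).1.1.1 - (vec j).2)%R.
have hM : M%:Z = (rN rho)%:Z - (vec j).1.1.1 - (vec j).2.
  by rewrite /M; case: (j) => [[]|] /=; lia.
rewrite (@step_targetE j rho M) // (@step_targetE k _ N') ?shift_param_comp //.
by rewrite hM -h /=; lia.
Qed.

End Shift.

(** * Polynomial form of the elementary steps *)

Section Steps.
Variable K : numFieldType.
Implicit Types (rho : racahParam K) (xi : K) (k : racahCase).

(** The base point that makes the lattice of the target coincide with that of
    rho. *)
Definition case_xi k rho xi : K := if k is RIII then xi - pu rho - 1 else xi.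

(** The zero of the multiplier of the associated relation, in the lattice
    variable with base point 0. *)
Definition case_root k rho : K :=
  match k with
  | RI => pC rho * (pC rho - pu rho)
  | RII => pB rho * (pB rho - pu rho)
  | RIII => 0
  | RIV => pA rho * (pA rho - pu rho)
  end.

Lemma case_up_poly k rho xi i : generic rho -> (i < rN rho)%N ->
  RQ rho xi i = case_Phip k rho 0 i *: RQ (case_target k rho) (case_xi k rho xi) i
    + case_Phip k rho (-1) i *: RQ (case_target k rho) (case_xi k rho xi) i.-1.
Proof.
move=> G iN; have N0 : (0 < rN rho)%N by lia.
have h : lowersN k -> (0 < rN rho)%N by [].
have [hk|hk] : notRIII k \/ k = RIII by case: (k); [left|left|right|left].
  have [-> ->] := case_Phip_up i h hk.
  have -> : case_xi k rho xi = xi by case: (k) hk.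
  rewrite /RQ -(@RPn_eq _ _ _ _ _ _ i.+1 i.-1); last by lia.
  rewrite /RP !target_RPn // (raised_RPn k) -(raised_ssum k).
  apply: RPn_up; first exact: raised_neq0.
    by apply: raised_poch1.
  by rewrite raised_ssum; have := gen_ps_neq0 G i 0; rewrite addr0.
rewrite {}hk in h *; have [-> ->] := case_Phip_up' rho i.
have [A0 B0 C0] := gen_ABC_neq0 G N0.
rewrite /RQ -(@RPn_eq _ _ _ _ _ _ i.+1 i.-1); last by lia.
rewrite -(@RPn_eq _ _ _ _ _ _ i.+2 i) //.
rewrite [RP (pA (case_target _ _)) _ _ _ _ _]/RP !target_RPn' // -ssumE.
rewrite RPn_up' //= ?gen_poch_pA1 ?gen_poch_pB1 ?poch_pC1 //; last first.
  by rewrite ssumE; have := gen_ps_neq0 G i 0; rewrite addr0.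
by rewrite wt_eq0 // scale0r addr0.
Qed.

Lemma case_dn_poly k rho xi i : generic rho -> (i < rN rho)%N ->
  exists a b : K, ('X - (case_root k rho - xi)%:P)
    * RQ (case_target k rho) (case_xi k rho xi) i = a *: RQ rho xi i.+1 + b *: RQ rho xi i.
Proof.
move=> G iN; have N0 : (0 < rN rho)%N by lia.
have h : lowersN k -> (0 < rN rho)%N by [].
have [hk|hk] : notRIII k \/ k = RIII by case: (k); [left|left|right|left].
  have -> : case_xi k rho xi = xi by case: (k) hk.
  have -> : case_root k rho = (raised k rho).1.1 * ((raised k rho).1.1 - pu rho) by case: (k) hk.
  have [A0 B0 C0] := raised_poch G k iN.
  have hs : 2 * i%:R + ssum (raised k rho).1.1 (raised k rho).1.2 (raised k rho).2 (pu rho) + 1 != 0.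
    by rewrite raised_ssum; exact: (gen_ps_neq0 G i 1).
  have := RPn_dn xi A0 B0 C0 hs; rewrite ltnSn orbT => /(_ isT).
  rewrite wt_eq0 // scale0r addr0 -!raised_RPn -target_RPn // !RPn_eq // => E.
  move: (_ * dn1 _ _ _ _) (_ * dn0 _ _ _ _) E => a b E; exists (- a), (- b).
  rewrite -[LHS]opprK -mulNr opprB E opprD !scaleNr //.
rewrite {}hk in h *.
have hs : 2 * i%:R + ssum (pA rho) (pB rho) (pC rho) (pu rho) + 1 != 0.
  by rewrite ssumE; exact: (gen_ps_neq0 G i 1).
have := RPn_dn' xi (gen_poch_pA G i.+1) (gen_poch_pB G i.+1) (poch_pC iN) hs.
move: (_ * dn' _ _) => c; rewrite -target_RPn' // !RPn_eq // => E.
exists c, (- c); rewrite /= sub0r -[LHS]opprK -mulNr opprB E.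
by rewrite -scalerN opprB scalerBr scaleNr.
Qed.

Lemma case_Phip1_neq0 k rho i : generic rho -> (0 < i < rN rho)%N ->
  case_Phip k rho (-1) i != 0.
Proof.
move=> G /andP[i0 iN]; have N0 : (0 < rN rho)%N by lia.
have h : lowersN k -> (0 < rN rho)%N by [].
have ni : i%:R != 0 :> K by rewrite pnatr_eq0 -lt0n.
have s0 : 2 * i%:R + ps rho != 0 by have := gen_ps_neq0 G i 0; rewrite addr0.
have f1 : i%:R + ps rho - pA rho != 0.
  by apply: (@gen_ne K rho _ i 0 1 0 G) => //; rewrite /ps /pA; ring.
have f2 : i%:R + ps rho - pB rho != 0.
  by apply: (@gen_ne K rho _ i 1 0 (-1) G) => //; rewrite /ps /pB; ring.
have f3 : i%:R + ps rho - pC rho != 0.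
  by apply: (@gen_ne K rho _ (i%:Z + 1 + rN rho) 1 1 0 G) => //; rewrite /ps /pC !intrD; ring.
have [A0 B0 C0] := gen_ABC_neq0 G N0.
have [hk|hk] : notRIII k \/ k = RIII by case: (k); [left|left|right|left].
  have [_ ->] := case_Phip_up i h hk; rewrite /up1 oppr_eq0.
  by case: (k) hk => //= _; rewrite mulf_neq0 ?mulf_neq0 ?invr_eq0 ?mulf_neq0.
rewrite hk; have [_ ->] := case_Phip_up' rho i; rewrite /up1' oppr_eq0.
by rewrite mulf_neq0 ?mulf_neq0 ?invr_eq0 ?mulf_neq0 // mulf_neq0.
Qed.

Lemma ttrR_neq0 rho i : generic rho -> (0 < i <= rN rho)%N -> ttrR rho i%:R != 0.
Proof.
move=> G /andP[i0 iN]; rewrite /ttrR /ttr_coef /ttr_num /ttr_den ssumE.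
have ni : i%:R != 0 :> K by rewrite pnatr_eq0 -lt0n.
have f1 : i%:R + ps rho - pA rho != 0.
  by apply: (@gen_ne K rho _ i 0 1 0 G) => //; rewrite /ps /pA; ring.
have f2 : i%:R + ps rho - pB rho != 0.
  by apply: (@gen_ne K rho _ i 1 0 (-1) G) => //; rewrite /ps /pB; ring.
have f3 : i%:R + ps rho - pC rho != 0.
  by apply: (@gen_ne K rho _ (i%:Z + 1 + rN rho) 1 1 0 G) => //; rewrite /ps /pC !intrD; ring.
have f4 : i%:R + ps rho - 1 != 0.
  by apply: (@gen_ne K rho _ i 1 1 0 G) => //; rewrite /ps; ring.
have f5 : pA rho + i%:R - 1 != 0.
  by apply: (@gen_ne K rho _ i 1 0 0 G) => //; rewrite /pA; ring.
have f6 : pB rho + i%:R - 1 != 0.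
  by apply: (@gen_ne K rho _ i 0 1 1 G) => //; rewrite /pB; ring.
have f7 : pC rho + i%:R - 1 != 0.
  have -> : pC rho + i%:R - 1 = - ((rN rho).+1 - i)%:R.
    by rewrite natrB ?(leqW iN) // /pC -[(rN rho).+1%:R]natr1; ring.
  by rewrite oppr_eq0 pnatr_eq0; lia.
have g (m : int) : 2 * i%:R + ps rho + m%:~R != 0.
  by apply: (@gen_ne K rho _ (2 * i%:Z + 1 + m) 1 1 0 G) => //; rewrite /ps !intrD intrM; ring.
have g2 := g (-2); have g1 := g (-1); have g0 := g 0; rewrite addr0 in g0.
by rewrite mulf_neq0 // ?invr_eq0 ?mulf_neq0 // ?mulf_neq0 // expf_neq0.
Qed.

Lemma RQ_ttr rho xi i : generic rho -> (0 < i < rN rho)%N ->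
  exists a b c, c != 0 /\
    'X * RQ rho xi i = a *: RQ rho xi i.+1 + b *: RQ rho xi i + c *: RQ rho xi i.-1.
Proof.
move=> G hi; have w := generic_wf G.
have [h1 h2 h3 h4] := wf_poch_neq0 w (leqnn _).
have hs : 2 * i%:R + ssum (pA rho) (pB rho) (pC rho) (pu rho) - 2 != 0.
  rewrite ssumE; case: (i) hi => // j _; have := gen_ps_neq0 G j 0; rewrite addr0.
  by congr (_ != 0); rewrite -(natr1 j); ring.
have [b E] := ttr xi h1 h2 h3 h4 hi hs.
exists (leadR rho i / leadR rho i.+1), b, (ttrR rho i%:R * leadR rho i / leadR rho i.-1); split.
  apply: mulf_neq0; last by rewrite invr_eq0; apply: leadR_neq0 => //; lia.
  by apply: mulf_neq0; [apply: ttrR_neq0|apply: leadR_neq0] => //; lia.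
rewrite !RQ_mracah //; try lia.
rewrite -scalerAr /mracah E !scalerDr !scalerA -/(mracah _ _ _).
rewrite divfK ?leadR_neq0 //; last by lia.
rewrite divfK ?leadR_neq0 //; last by lia.
by rewrite [b * _]mulrC [ttrR _ _ * _]mulrC.
Qed.

Lemma size_RQ rho xi i : racah_wf rho -> (i <= rN rho)%N -> size (RQ rho xi i) = i.+1.
Proof. by move=> w iN; rewrite RQ_mracah // size_scale ?size_mracah // leadR_neq0. Qed.

Lemma RQ_indep rho xi (n : nat) (a : nat -> K) : racah_wf rho -> (n <= (rN rho).+1)%N ->
  \sum_(l < n) a l *: RQ rho xi l = 0 -> forall l, (l < n)%N -> a l = 0.
Proof.
move=> w nN; apply: lin_indep => [i j /andP[ij jn]|i iN].
  by rewrite !size_RQ //; lia.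
by rewrite -size_poly_gt0 size_RQ //; lia.
Qed.

End Steps.

(** * Exclusion of the spurious shift vectors *)

Section Exclusions.
Variable K : numFieldType.
Implicit Types (rho : racahParam K) (xi : K) (k : racahCase).

Lemma target_rN_ge k rho n : (n < rN rho)%N -> (n <= rN (case_target k rho))%N.
Proof. by rewrite target_rN; case: (lowersN k); lia. Qed.

(** No relation with multiplier of degree one and only two terms between a
    family and itself: the third term of the recurrence does not vanish. *)
Lemma no_square_in_pencil rho kap (a b : K) : generic rho -> (5 <= rN rho)%N ->
  ('X - kap%:P) * RQ rho 0 4 <> a *: RQ rho 0 5 + b *: RQ rho 0 4.
Proof.
move=> G N5 H; have w := generic_wf G.
have [a' [b' [c [c0 E]]]] := RQ_ttr 0 G (i := 4) (ltac:(lia)).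
pose v (l : nat) : K := nth 0 [:: 0; 0; 0; c; b' - kap - b; a' - a] l.
have H0 : \sum_(l < 6) v l *: RQ rho 0 l = 0.
  move: H; rewrite mulrBl E mul_polyC => H.
  rewrite !big_ord_recr big_ord0 /= /v /= !scale0r !add0r !scalerBl.
  apply/eqP; move/eqP: H; rewrite -subr_eq0 => /eqP <-; apply/eqP.
  move: (_ *: RQ _ _ 3) (a *: _) (a' *: _) (b *: _) (b' *: _) (kap *: _) => r1 r2 r3 r4 r5 r6.
  by ring.
have := RQ_indep w (n := 6) (ltac:(lia)) H0 (l := 3) isT.
by rewrite /v /= => c0'; rewrite c0' eqxx in c0.
Qed.

(** No relation with multiplier of degree one and three terms from rho to the
    target of a single step: the product with R_4 has a nonzero component of
    index 2. *)
Lemma no_linear_multiplier rho k kap (a b c : K) : generic rho -> (7 <= rN rho)%N ->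
  ('X - kap%:P) * RQ rho 0 4 <> a *: RQ (case_target k rho) (case_xi k rho 0) 5
    + b *: RQ (case_target k rho) (case_xi k rho 0) 4
    + c *: RQ (case_target k rho) (case_xi k rho 0) 3.
Proof.
move=> G N7 H; have Gt : generic (case_target k rho) by exact: target_generic.
have w := generic_wf Gt.
set R := RQ (case_target k rho) (case_xi k rho 0) in H.
have Nt : (6 <= rN (case_target k rho))%N by exact: target_rN_ge.
have E : RQ rho 0 4 = case_Phip k rho 0 4%N *: R 4%N + case_Phip k rho (-1) 4%N *: R 3%N.
  by apply: case_up_poly => //; lia.
have [a4 [b4 [c4 [_ E4]]]] := RQ_ttr (case_xi k rho 0) Gt (i := 4) (ltac:(lia)).
have [a3 [b3 [c3 [c0 E3]]]] := RQ_ttr (case_xi k rho 0) Gt (i := 3) (ltac:(lia)).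
rewrite -/R /= in E4 E3.
have p0 : case_Phip k rho (-1) 4%N != 0 by apply: case_Phip1_neq0 => //; lia.
move: (case_Phip k rho 0 4%N) (case_Phip k rho (-1) 4%N) p0 E => p q p0 E.
pose v (l : nat) : K := nth 0 [:: 0; 0; q * c3; p * c4 + q * (b3 - kap) - c;
  p * (b4 - kap) + q * a3 - b; p * a4 - a] l.
have H0 : \sum_(l < 6) v l *: R l = 0.
  have EX : ('X - kap%:P) * RQ rho 0 4 =
     p *: ('X * R 4%N) + q *: ('X * R 3%N) - (kap * p) *: R 4%N - (kap * q) *: R 3%N.
    by rewrite E -!mul_polyC !polyCM; ring.
  move: H; rewrite EX E4 E3 !scalerDr !scalerA => /eqP; rewrite -subr_eq0 => /eqP H.
  rewrite -[RHS]H !big_ord_recr big_ord0 /= /v /= !scale0r !add0r.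
  rewrite -!mul_polyC !(polyCD, polyCM, polyCN, polyCB).
  by ring.
have := RQ_indep w (n := 6) (ltac:(lia)) H0 (l := 2) isT.
by rewrite /v /= => /eqP; rewrite mulf_eq0 (negPf p0) (negPf c0).
Qed.

Section Span.
Variables (R : nat -> {poly K}).

(** f is a combination of R_lo, ..., R_(hi-1). *)
Definition spanned lo hi (f : {poly K}) : Prop :=
  exists a : nat -> K, f = \sum_(lo <= l < hi) a l *: R l.

Lemma spanned_add lo hi f g : spanned lo hi f -> spanned lo hi g -> spanned lo hi (f + g).
Proof.
move=> [a ->] [b ->]; exists (fun l => a l + b l).
by rewrite -big_split /=; apply: eq_bigr => l _; rewrite scalerDl.
Qed.

Lemma spanned_scale lo hi (c : K) f : spanned lo hi f -> spanned lo hi (c *: f).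
Proof.
move=> [a ->]; exists (fun l => c * a l).
by rewrite scaler_sumr; apply: eq_bigr => l _; rewrite scalerA.
Qed.

Lemma spanned_base lo hi l : (lo <= l < hi)%N -> spanned lo hi (R l).
Proof.
move=> /andP[h1 h2]; exists (fun j => (j == l)%:R).
rewrite (bigD1_seq l) /= ?iota_uniq ?mem_index_iota ?h1 ?h2 // eqxx scale1r.
by rewrite big1 ?addr0 // => j /negPf ->; rewrite scale0r.
Qed.

Lemma spanned_sum lo hi lo' hi' (a : nat -> K) (f : nat -> {poly K}) :
  (forall l, (lo <= l < hi)%N -> spanned lo' hi' (f l)) ->
  spanned lo' hi' (\sum_(lo <= l < hi) a l *: f l).
Proof.
move=> H; rewrite big_seq_cond.
apply: big_ind => [|f1 f2|l]; last first.
- by rewrite andbT mem_index_iota => /H; exact: spanned_scale.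
- exact: spanned_add.
- by exists (fun=> 0); rewrite big1 // => l _; rewrite scale0r.
Qed.

Lemma spanned_widen lo hi lo' hi' f : (lo' <= lo)%N -> (hi <= hi')%N ->
  spanned lo hi f -> spanned lo' hi' f.
Proof.
by move=> h1 h2 [a ->]; apply: spanned_sum => l hl; apply: spanned_base; lia.
Qed.

End Span.

Lemma spanned_mulX rho xi lo hi kap f : generic rho -> (0 < lo)%N -> (hi <= rN rho)%N ->
  spanned (RQ rho xi) lo.+1 hi f -> spanned (RQ rho xi) lo hi.+1 (('X - kap%:P) * f).
Proof.
move=> G l0 hN [a ->]; rewrite mulr_sumr.
under eq_bigr => l _ do rewrite -scalerAr.
apply: spanned_sum => l hl.
have [a' [b' [c' [_ E]]]] := RQ_ttr xi G (i := l) (ltac:(lia)).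
rewrite mulrBl E mul_polyC -scaleNr.
by apply: spanned_add; [apply: spanned_add; [apply: spanned_add|]|]; apply: spanned_scale; apply: spanned_base; lia.
Qed.

Lemma spanned_dn rho xi k lo hi f : generic rho -> (hi <= rN rho)%N ->
  spanned (RQ (case_target k rho) (case_xi k rho xi)) lo hi f ->
  spanned (RQ rho xi) lo hi.+1 (('X - (case_root k rho - xi)%:P) * f).
Proof.
move=> G hN [a ->]; rewrite mulr_sumr.
under eq_bigr => l _ do rewrite -scalerAr.
apply: spanned_sum => l hl.
have [a' [b' E]] := case_dn_poly k xi G (i := l) (ltac:(lia)).
rewrite E.
by apply: spanned_add; apply: spanned_scale; apply: spanned_base; lia.
Qed.

(** A square root of the zero of the multiplier, shifted by u^2 / 4, so that it
    no longer depends on the base point and is not changed by the other steps. *)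
Definition ycoord k rho : K :=
  match k with
  | RI => pC rho - pu rho / 2
  | RII => pB rho - pu rho / 2
  | RIII => pu rho / 2
  | RIV => pA rho - pu rho / 2
  end.

Lemma case_rootE k rho : case_root k rho = ycoord k rho ^+ 2 - (pu rho / 2) ^+ 2.
Proof. by case: k; rewrite /case_root /ycoord; field. Qed.

Lemma case_xi_inv k rho xi : (0 < rN rho)%N ->
  (pu (case_target k rho) / 2) ^+ 2 + case_xi k rho xi = (pu rho / 2) ^+ 2 + xi.
Proof. by move=> N0; rewrite target_pu //; case: k => /=; field. Qed.

Lemma ycoord_target k j rho : (0 < rN rho)%N -> j <> k ->
  ycoord j (case_target k rho) = ycoord j rho.
Proof.
move=> N0 jk; have h : lowersN k -> (0 < rN rho)%N by [].
have := target_pu h; have := target_pC h.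
case: k h jk => h jk; case: j jk => // _; rewrite /ycoord => e1 e2; rewrite ?e1 ?e2;
  case: rho N0 h e1 e2 => a b c N /= _ _ _ _; rewrite /pA /pB /=; by field.
Qed.

Lemma ycoord_neq rho j k : generic rho -> (0 < rN rho)%N -> j <> k ->
  ycoord j rho ^+ 2 - ycoord k rho ^+ 2 != 0.
Proof.
move=> G N0; wlog: j k / match j, k with
    | RI, _ => true | RII, RI => false | RII, _ => true | RIV, RIII => true | _, _ => false end.
  move=> W jk; rewrite -oppr_eq0 opprB.
  have W' := W k j _ (not_eq_sym jk).
  by case: j k jk W W' => -[] jk W W'; try (by apply: W'); rewrite -oppr_eq0 opprB; apply: W.
have E (m0 m1 m2 m3 : int) (z : K) : z = m0%:~R + m1%:~R * rA rho + m2%:~R * rB rho + m3%:~R * rC rho ->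
  [|| m1 != 0, m2 != 0, m3 != 0 | m0 != 0] -> z != 0 by exact: gen_ne.
set N : int := rN rho.
have NE : (rN rho)%:R = N%:~R :> K by [].
move=> hjk jk; rewrite subr_sqr.
case: j hjk jk => hjk jk; case: k hjk jk => // _ _; apply: mulf_neq0;
  rewrite /ycoord /pA /pB /pC /pu NE.
- by apply: (E (- N - 1) 0 (-1) (-1)) => //; rewrite ?(intrD, intrN); field.
- by apply: (E 1 0 1 0) => //; rewrite ?(intrD, intrN); field.
- by apply: (E 0 0 0 (-1)) => //; rewrite ?(intrD, intrN); field.
- apply: (E (- N) 0 0 0); first by rewrite ?(intrD, intrN); field.
  by rewrite /= oppr_eq0 /N -lt0n.
- by apply: (E (- N - 1) (-1) 0 0) => //; rewrite ?(intrD, intrN); field.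
- by apply: (E 1 1 0 (-1)) => //; rewrite ?(intrD, intrN); field.
- by apply: (E (N + 1) 0 1 0) => //; rewrite ?(intrD, intrN); field.
- by apply: (E 1 0 1 1) => //; rewrite ?(intrD, intrN); field.
- by apply: (E 0 (-1) 1 1) => //; rewrite ?(intrD, intrN); field.
- by apply: (E (2 + N) 1 1 0) => //; rewrite ?(intrD, intrN); field.
- by apply: (E (1 + N) 1 0 (-1)) => //; rewrite ?(intrD, intrN); field.
- by apply: (E 1 1 0 0) => //; rewrite ?(intrD, intrN); field.
Qed.

(** The shift vector with three coordinates 1 and one coordinate -1 does not
    occur.  Let P_i be the polynomials of the target of d and suppose that P_3
    is a combination of polynomials of indices 1, 2, 3 at the target of a, b, c.
    The product of P_3 by the multipliers of a, b, c lies in the span of R_1, ...,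
    R_6.  The product by the multiplier of d lies in that of R_3 and R_4, and two
    more factors of degree one lead to the same span of R_1, ..., R_6.  As the
    zeros of the four multipliers are distinct, P_3 itself lies in it, then P_2,
    P_1 and P_0 = R_0, a contradiction. *)
Lemma no_three_up_one_down rho (d a b c : racahCase) xi (x y z : K) :
  generic rho -> (10 <= rN rho)%N ->
  d <> a -> d <> b -> d <> c -> a <> b -> a <> c -> b <> c ->
  let rho1 := case_target a rho in let xi1 := case_xi a rho xi in
  let rho2 := case_target b rho1 in let xi2 := case_xi b rho1 xi1 in
  let rho3 := case_target c rho2 in let xi3 := case_xi c rho2 xi2 in
  RQ (case_target d rho) (case_xi d rho xi) 3 <>
    x *: RQ rho3 xi3 3 + y *: RQ rho3 xi3 2 + z *: RQ rho3 xi3 1.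
Proof.
move=> G N10 da db dc ab ac bc rho1 xi1 rho2 xi2 rho3 xi3 H.
have G1 : generic rho1 by exact: target_generic.
have G2 : generic rho2 by exact: target_generic.
have G3 : generic rho3 by exact: target_generic.
have N1 : (9 <= rN rho1)%N by exact: target_rN_ge.
have N2 : (8 <= rN rho2)%N by exact: target_rN_ge.
have N3 : (7 <= rN rho3)%N by exact: target_rN_ge.
have w := generic_wf G.
pose kap j := ycoord j rho ^+ 2 - (pu rho / 2) ^+ 2 - xi.
have i1 := case_xi_inv a xi (ltac:(lia) : (0 < rN rho)%N).
have i2 := case_xi_inv b xi1 (ltac:(lia) : (0 < rN rho1)%N).
rewrite -/rho1 -/xi1 in i1; rewrite -/rho2 -/xi2 i1 in i2.
have ka : case_root a rho - xi = kap a by rewrite case_rootE.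
have kd : case_root d rho - xi = kap d by rewrite case_rootE.
have kb : case_root b rho1 - xi1 = kap b.
  rewrite case_rootE -addrA -opprD i1 ycoord_target //; try lia; last exact: not_eq_sym.
  by rewrite /kap; ring.
have kc : case_root c rho2 - xi2 = kap c.
  rewrite case_rootE -addrA -opprD i2 ycoord_target //; try lia; last exact: not_eq_sym.
  rewrite ycoord_target //; try lia; last exact: not_eq_sym.
  by rewrite /kap; ring.
pose R := RQ rho xi.
pose P i := RQ (case_target d rho) (case_xi d rho xi) i.
have SA f : spanned (RQ rho3 xi3) 1 4 f -> spanned R 1 7
    (('X - (kap a)%:P) * (('X - (kap b)%:P) * (('X - (kap c)%:P) * f))).
  move=> hf; rewrite -ka -kb -kc.
  apply: spanned_dn => //; first by lia.
  apply: (@spanned_dn rho1) => //; first by lia.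
  by apply: (@spanned_dn rho2) => //; lia.
have S1 : spanned R 1 7 (('X - (kap a)%:P) * (('X - (kap b)%:P) * (('X - (kap c)%:P) * P 3%N))).
  apply: SA; rewrite /P H.
  by apply: spanned_add; [apply: spanned_add|]; apply: spanned_scale; apply: spanned_base.
have S2 : spanned R 3 5 (('X - (kap d)%:P) * P 3%N).
  rewrite -kd; have [u [v E]] := case_dn_poly d xi G (i := 3) (ltac:(lia)).
  by rewrite /P E; apply: spanned_add; apply: spanned_scale; apply: spanned_base.
pose da' := kap d - kap a; pose db' := kap d - kap b; pose dc' := kap d - kap c.
have S3 : spanned R 1 7 ((da' * db' * dc') *: P 3%N).
  have -> : (da' * db' * dc') *: P 3%N =
     ('X - (kap a)%:P) * (('X - (kap b)%:P) * (('X - (kap c)%:P) * P 3%N))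
     + (-1) *: (('X - (kap b)%:P) * (('X - (kap c)%:P) * (('X - (kap d)%:P) * P 3%N)))
     + (- da') *: (('X - (kap c)%:P) * (('X - (kap d)%:P) * P 3%N))
     + (- (da' * db')) *: (('X - (kap d)%:P) * P 3%N).
    rewrite /da' /db' /dc' -!mul_polyC !(polyCN, polyCB, polyCM); ring.
  apply: spanned_add; [apply: spanned_add; [apply: spanned_add => //|]|]; apply: spanned_scale.
  - apply: spanned_mulX => //; first by lia.
    by apply: spanned_mulX => //; lia.
  - by apply: (@spanned_widen R 2 6) => //; apply: spanned_mulX => //; lia.
  - exact: (@spanned_widen R 3 5).
have dn i : (0 < i <= 3)%N -> spanned R 1 7 ((da' * db' * dc') *: P i) ->
    spanned R 1 7 ((da' * db' * dc') *: P i.-1).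
  move=> hi hS.
  have E := case_up_poly d xi G (i := i) (ltac:(lia)).
  have q0 := case_Phip1_neq0 d G (i := i) (ltac:(lia)).
  have -> : P i.-1 = (case_Phip d rho (-1) i)^-1 *: (R i - case_Phip d rho 0 i *: P i).
    by rewrite /R E addrAC subrr add0r scalerA mulVf // scale1r.
  move: (da' * db' * dc') hS => D hS.
  rewrite scalerA mulrC -scalerA; apply: spanned_scale; rewrite scalerBr -scaleN1r.
  apply: spanned_add; first by apply: spanned_scale; apply: spanned_base; lia.
  by apply: spanned_scale; rewrite scalerA mulrC -scalerA; apply: spanned_scale.
have [e E] := dn 1%N isT (dn 2%N isT (dn 3%N isT S3)).
have P0 : P 0%N = R 0%N by rewrite /P /R /RQ /RP !RPn1.
pose v l := if l == 0%N then - (da' * db' * dc') else e l.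
have H0 : \sum_(l < 7) v l *: RQ rho xi l = 0.
  rewrite big_ord_recl /= /v eqxx -/(R 0%N) -P0 scaleNr E big_add1 big_mkord /=.
  by rewrite addrC; apply/eqP; rewrite subr_eq0; apply/eqP; apply: eq_bigr.
have := RQ_indep w (n := 7) (ltac:(lia)) H0 (l := 0) isT.
move/eqP; rewrite /v /= oppr_eq0 !mulf_eq0 /da' /db' /dc' /kap.
have D j : d <> j -> (ycoord d rho ^+ 2 - (pu rho / 2) ^+ 2 - xi
   - (ycoord j rho ^+ 2 - (pu rho / 2) ^+ 2 - xi) == 0) = false.
  move=> dj; have := ycoord_neq G (ltac:(lia)) dj; move=> h; apply/negbTE.
  by apply: contraNneq h => h; apply/eqP; rewrite -h; ring.
by rewrite !D.
Qed.

End Exclusions.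

(** * Algebra of contiguity relations *)

Section Contiguity.
Variable K : numFieldType.
Implicit Types (rho : racahParam K) (xi : K) (eta : int) (E : seq int).
Implicit Types (lam : K -> K) (Phi : int -> nat -> K).

(** Compatibility of the lattices amounts to u' = u - 2 eta. *)
Lemma compat_pu rho eta rhot : compatible_lattices rho eta rhot ->
  pu rhot = pu rho - 2 * eta%:~R.
Proof.
move=> [zeta [xi H]].
have H0 := H 0; have H1 := H 1; have Hm := H (-1); rewrite !latticeE in H0 H1 Hm.
move: (pu rho) (pu rhot) (eta%:~R : K) H0 H1 Hm => u u' e H0 H1 Hm.
have t0 : 2 != 0 :> K by rewrite pnatr_eq0.
have z1 : zeta = 1.
  apply: (mulIf t0); apply/eqP; rewrite -subr_eq0; apply/eqP.
  transitivity ((zeta * ((1 + e) * (1 + e + u')) - xi - 1 * (1 + u))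
    + (zeta * ((-1 + e) * (-1 + e + u')) - xi - -1 * (-1 + u))
    - 2 * (zeta * ((0 + e) * (0 + e + u')) - xi - 0 * (0 + u))); first by ring.
  by rewrite -H0 -H1 -Hm !(subrr, mulr0, subr0, addr0).
rewrite {}z1 !mul1r in H0 H1 Hm.
apply: (mulIf t0); apply/eqP; rewrite -subr_eq0; apply/eqP.
transitivity (((1 + e) * (1 + e + u') - xi - (1 + u))
   - ((-1 + e) * (-1 + e + u') - xi - -1 * (-1 + u))); first by ring.
by rewrite -H1 -Hm !(subrr, subr0).
Qed.

Lemma compat_of_pu rho eta rhot : pu rhot = pu rho - 2 * eta%:~R ->
  compatible_lattices rho eta rhot.
Proof.
move=> h; exists 1; exists (eta%:~R * (pu rho - eta%:~R)) => x.
by rewrite mul1r (lattice_shift h erefl).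
Qed.

Lemma contig_ext E lam lam' Phi Phi' rho eta rhot :
  (forall x, lam x = lam' x) ->
  (forall e i, e \in E -> (i <= rN rho)%N -> Phi e i = Phi' e i) ->
  contiguity E lam Phi rho eta rhot -> contiguity E lam' Phi' rho eta rhot.
Proof.
move=> hl hP H i iN; have [H1 H2] := H i iN; split.
  by move=> e eE he; rewrite -hP // H1.
move=> x hx; rewrite -hl H2 //; rewrite big_seq_cond [RHS]big_seq_cond.
by apply: eq_bigr => e /andP[eE _]; rewrite hP.
Qed.

Lemma contig_lin E lam lam' Phi Phi' rho eta rhot (a b : K) :
  contiguity E lam Phi rho eta rhot -> contiguity E lam' Phi' rho eta rhot ->
  contiguity E (fun x => a * lam x + b * lam' x) (fun e i => a * Phi e i + b * Phi' e i)
    rho eta rhot.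
Proof.
move=> H H' i iN; have [H1 H2] := H i iN; have [H1' H2'] := H' i iN; split.
  by move=> e eE he; rewrite H1 // H1' // !mulr0 addr0.
move=> x hx; rewrite mulrDl -!mulrA H2 // H2' // !mulr_sumr -big_split /=.
by apply: eq_bigr => e _; rewrite mulrDl !mulrA.
Qed.

Lemma contig_same_r E lam Phi rho eta rhot rhot' : same rhot rhot' ->
  contiguity E lam Phi rho eta rhot -> contiguity E lam Phi rho eta rhot'.
Proof.
move=> S H i iN; have [e _ _] := S; have [H1 H2] := H i iN; rewrite -e; split=> // x hx.
by rewrite H2 //; apply: eq_bigr => j _; rewrite (same_racah _ _ S).
Qed.

Lemma contig_same_l E lam Phi rho eta rhot rho' : same rho rho' ->
  contiguity E lam Phi rho eta rhot -> contiguity E lam Phi rho' eta rhot.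
Proof.
move=> S H i; have [e _ _] := S; rewrite -e => iN; have [H1 H2] := H i iN; split=> // x hx.
by rewrite -(same_racah _ _ S) H2.
Qed.

Section Grid.
Variables (rho rhot : racahParam K) (eta : int).
Hypotheses (G : generic rho) (hu : pu rhot = pu rho - 2 * eta%:~R).
Let xi : K := eta%:~R * (pu rho - eta%:~R).

Lemma lattice_inj (m n : nat) : lattice rhot m%:R = lattice rhot n%:R -> m = n.
Proof.
move=> /eqP; rewrite !latticeE hu -subr_eq0.
have -> : m%:R * (m%:R + (pu rho - 2 * eta%:~R)) - n%:R * (n%:R + (pu rho - 2 * eta%:~R))
   = (m%:R - n%:R) * (m%:R + n%:R + pu rho - 2 * eta%:~R) by ring.
rewrite mulf_eq0 subr_eq0 eqr_nat => /orP[/eqP //|] /eqP h.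
have : m%:R + n%:R + pu rho - 2 * eta%:~R != 0.
  have F := @gen_ne K rho (m%:R + n%:R + pu rho - 2 * eta%:~R) (m%:Z + n%:Z - (rN rho)%:Z - 2 * eta) 0 0 1 G.
  apply: F => //.
  by rewrite /pu !(intrD, intrN, intrM); ring.
by rewrite h eqxx.
Qed.

(** The grid points are distinct, because u is not an integer. *)
Lemma grid_zero (p : {poly K}) n : (size p <= n.+1)%N ->
  (forall m, (m <= n)%N -> p.[lattice rhot m%:R - xi] = 0) -> p = 0.
Proof.
move=> sp H; apply/eqP; apply/negPn/negP => p0.
pose rs : seq K := [seq lattice rhot m%:R - xi | m <- iota 0 n.+1].
have := max_poly_roots (rs := rs) p0; rewrite size_map size_iota.
move=> H1; have : (n.+1 < size p)%N.
  apply: H1; first by apply/allP => x /mapP[m]; rewrite mem_iota => hm ->; rewrite /root H //; lia.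
  rewrite map_inj_uniq ?iota_uniq // => m m' h; apply: lattice_inj.
  by apply: (addIr (- xi)).
by rewrite ltnNge sp.
Qed.

Lemma all_zero (p : {poly K}) : (forall x, p.[lattice rho x] = 0) -> p = 0.
Proof.
move=> H; apply: (@grid_zero p (size p)) => // m _.
by rewrite -(H (m%:R - eta%:~R)) -(lattice_shift hu erefl) subrK.
Qed.

Section Uniq.
Hypothesis wft : racah_wf rhot.

(** A relation with zero multiplier is, on the grid, a vanishing combination of
    the polynomials of index at most N'. *)
Lemma contig_zero E D : uniq E -> contiguity E (fun=> 0) D rho eta rhot ->
  forall e i, e \in E -> (i <= rN rho)%N -> D e i = 0.
Proof.
move=> uE H e0 i e0E iN; have [H1 H2] := H i iN.
have [r0|/H1 -> //] := boolP (0 <= i%:Z + e0 <= (rN rhot)%:Z).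
pose a l := \sum_(e <- E | i%:Z + e == l%:Z) D e i.
have Z : \sum_(l < (rN rhot).+1) a l *: RQ rhot xi l = 0.
  apply: (@grid_zero _ (rN rhot)).
    apply: (big_ind (fun p : {poly K} => (size p <= (rN rhot).+1)%N)).
    - by rewrite size_poly0.
    - by move=> p q hp hq; apply: leq_trans (size_polyD _ _) _; rewrite geq_max hp hq.
    - move=> l _; apply: leq_trans (size_scale_leq _ _) _; rewrite size_RQ //.
      by rewrite -ltnS.
  move=> m mN.
  have hx : (forall e : int, e \in E -> i%:Z + e <= (rN rhot)%:Z) \/
     (exists2 m' : nat, (m' <= rN rhot)%N & m%:R - eta%:~R + eta%:~R = m'%:R :> K).
    by right; exists m => //; rewrite subrK.
  have := H2 _ hx; rewrite mul0r => E0; rewrite [RHS]E0 {E0}.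
  rewrite horner_sum; under eq_bigr => l _.
    rewrite hornerZ -racahE /a mulr_suml; over.
  rewrite (exchange_big_dep xpredT) //= [RHS]big_mkcond /=.
  apply: eq_bigr => e _; rewrite subrK; case: ifP => [he|he].
    have hl : (absz (i%:Z + e)%R < (rN rhot).+1)%N by lia.
    rewrite (big_pred1 (Ordinal hl)) // => l; rewrite /= -val_eqE /=.
    by apply/eqP/eqP; lia.
  rewrite big_pred0 // => l; apply/eqP => hl; move: he; rewrite hl.
  by have := ltn_ord l; lia.
have hl : (absz (i%:Z + e0)%R < (rN rhot).+1)%N by lia.
have := RQ_indep wft (leqnn _) Z hl; rewrite /a.
rewrite big_mkcond (bigD1_seq e0) //=.
have -> : (i%:Z + e0 == (absz (i%:Z + e0)%R)%:Z) by apply/eqP; lia.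
rewrite big1 ?addr0 // => e /eqP he; case: eqP => // h.
by case: he; lia.
Qed.

Lemma contig_unique E lam Phi Phi' : uniq E ->
  contiguity E lam Phi rho eta rhot -> contiguity E lam Phi' rho eta rhot ->
  forall e i, e \in E -> (i <= rN rho)%N -> Phi e i = Phi' e i.
Proof.
move=> uE H H' e i eE iN.
have H0 : contiguity E (fun=> 0) (fun e i => 1 * Phi e i + -1 * Phi' e i) rho eta rhot.
  by apply: contig_ext (contig_lin 1 (-1) H H') => // x; rewrite mul1r mulN1r subrr.
have := contig_zero uE H0 eE iN; rewrite mul1r mulN1r => /eqP.
by rewrite subr_eq0 => /eqP.
Qed.

(** Where no term is omitted, a relation is an identity of polynomials. *)
Lemma contig_poly E lam (lp : {poly K}) Phi i :
  contiguity E lam Phi rho eta rhot -> (forall x, lam x = lp.[lattice rho x]) ->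
  (i <= rN rho)%N -> (forall e, e \in E -> 0 <= i%:Z + e <= (rN rhot)%:Z) ->
  lp * RQ rho 0 i = \sum_(e <- E) Phi e i *: RQ rhot xi (absz (i%:Z + e)).
Proof.
move=> H hl iN hE; have [_ H2] := H i iN.
apply/eqP; rewrite -subr_eq0; apply/eqP/all_zero => x.
have := H2 x; rewrite hl (racahE rho 0) subr0 big_seq_cond => h.
rewrite hornerD hornerN hornerM h; last by left=> e /hE /andP[].
rewrite horner_sum [X in _ - X]big_seq_cond; apply/eqP; rewrite subr_eq0; apply/eqP.
apply: congr_big => // e /=; last by rewrite hornerZ (racah_shiftE _ _ hu erefl).
by case eE: (e \in E) => //=; rewrite hE.
Qed.

End Uniq.
End Grid.
End Contiguity.

(** * Classification of polynomial relations *)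

Section Classification.
Variables (K : numFieldType) (rho rhot : racahParam K) (eta : int).
Hypotheses (G : generic rho) (wft : racah_wf rhot).
Hypothesis hu : pu rhot = pu rho - 2 * eta%:~R.
Let xi : K := eta%:~R * (pu rho - eta%:~R).
Variable M : nat.
Hypotheses (M40 : (40 <= M)%N) (MN : (M <= rN rho)%N) (MN' : (M <= rN rhot)%N).
Let wf := generic_wf G.

(** The relation of index i, with a multiplier l (X - kap) or l. *)
Definition rel_at (l kap : K) (h : bool) (f0 f1 f2 : nat -> K) i :=
  (l *: lamP kap h) * RQ rho 0 i = f0 i *: RQ rhot xi (i + h)
    + f1 i *: RQ rhot xi (i + h).-1 + f2 i *: RQ rhot xi (i + h).-2.

Lemma monic_rel (l kap : K) (h : bool) (f0 f1 f2 : nat -> K) i : l != 0 ->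
  (2 <= i)%N -> (i + h <= M)%N -> rel_at l kap h f0 f1 f2 i ->
  lamP kap h * mracah rho 0 i = mracah rhot xi (i + h)
    + (f1 i * leadR rhot (i + h).-1 / (l * leadR rho i)) *: mracah rhot xi (i + h).-1
    + (f2 i * leadR rhot (i + h).-2 / (l * leadR rho i)) *: mracah rhot xi (i + h).-2.
Proof.
move=> l0 i2 iM; rewrite /rel_at !RQ_mracah //; try (by lia).
have h1 : (h <= 1)%N by case: (h).
have c0 : leadR rho i != 0 by apply: leadR_neq0 => //; lia.
move=> E; have E0 : l * leadR rho i = f0 i * leadR rhot (i + h).
  have := congr1 (fun p : {poly K} => p`_(i.+1 + h).-1) E.
  rewrite -scalerAr -scalerAl (coefZ (leadR rho i)) (coefZ l) lamP_coef1 mracah_lead //; last by lia.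
  rewrite [(mracah rho 0 i)`_i.+1]nth_default; last first.
    by rewrite size_mracah //; lia.
  rewrite !coefD !(coefZ (f0 _)) !(coefZ (f1 _)) !(coefZ (f2 _)) !(coefZ (leadR _ _)) addSn /=.
  rewrite mracah_lead //; last by lia.
  rewrite [(mracah _ _ (i + h).-1)`_ _]nth_default; last by rewrite size_mracah //; lia.
  rewrite [(mracah _ _ (i + h).-2)`_ _]nth_default; last by rewrite size_mracah //; lia.
  by rewrite !(mulr0, addr0, subr0, mulr1) mulrC.
have d0 : l * leadR rho i != 0 by rewrite mulf_neq0.
have EL : (l * leadR rho i) *: (lamP kap h * mracah rho 0 i)
    = (l *: lamP kap h) * (leadR rho i *: mracah rho 0 i).
  by rewrite -(scalerAr (leadR rho i)) -(scalerAl l) scalerA [leadR _ _ * l]mulrC.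
apply: (scalerI d0); rewrite {}EL {}E !scalerDr !scalerA.
by rewrite ![l * leadR rho i * (_ / _)]mulrC !divfK // E0.
Qed.

(** The classification with the total t1 + t2 + t3 + t4 bounded from both
    sides, the number of poles being known. *)
Lemma classify_shift (l kap : K) (h : bool) (f0 f1 f2 : nat -> K) : l != 0 ->
  (forall i, (2 <= i)%N -> (i + h <= M)%N -> rel_at l kap h f0 f1 f2 i) ->
  exists m : nat, [/\ (m <= 2)%N,
  (m <= 1)%N -> forall i, (2 <= i)%N -> (i + h <= M)%N -> f2 i = 0,
  (m <= 0)%N -> forall i, (2 <= i)%N -> (i + h <= M)%N -> f1 i = 0,
  m = 2 -> ~ (forall i, (2 <= i)%N -> (i + h <= M)%N -> f2 i = 0) &
  exists t1 t2 t3 t4 : int,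
   [/\ eta = - t1, (rN rhot)%:Z = (rN rho)%:Z - t1 - t4,
      forall v, isvec t1 t2 t3 t4 v -> same rhot (shift_param v rho (rN rhot)),
      pairs_le t1 t2 t3 t4 (m%:Z - h%:Z) &
      t1 + t2 + t3 + t4 <= m%:Z - h%:Z /\
      2 * (m%:Z - h%:Z) - m%:Z <= t1 + t2 + t3 + t4]].
Proof.
move=> l0 H; have h1 : (h <= 1)%N by case: (h).
have R i : (2 <= i)%N -> (i + h <= M)%N -> _ := fun a b => monic_rel l0 a b (H i a b).
have nz i : (2 <= i)%N -> (i + h <= M)%N -> l * leadR rho i != 0.
  by move=> i2 iM; rewrite mulf_neq0 // leadR_neq0 //; lia.
have nz1 i : (2 <= i)%N -> (i + h <= M)%N -> leadR rhot (i + h).-1 != 0.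
  by move=> i2 iM; rewrite leadR_neq0 //; lia.
have nz2 i : (2 <= i)%N -> (i + h <= M)%N -> leadR rhot (i + h).-2 != 0.
  by move=> i2 iM; rewrite leadR_neq0 //; lia.
have [m [m2 c2 c1 c2' [t1 [t2 [t3 [t4 [e1 e2 e3 e4 [e5 e6]]]]]]]] := classify_monic G wft hu M40 MN MN' R.
exists m; split=> //.
- move=> m1 i i2 iM; move/eqP: (c2 m1 i i2 iM).
  by rewrite 2!mulf_eq0 invr_eq0 (negPf (nz _ i2 iM)) (negPf (nz2 _ i2 iM)) !orbF => /eqP.
- move=> m1 i i2 iM; move/eqP: (c1 m1 i i2 iM).
  by rewrite 2!mulf_eq0 invr_eq0 (negPf (nz _ i2 iM)) (negPf (nz1 _ i2 iM)) !orbF => /eqP.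
- by move=> /c2' F Z; apply: F => i i2 iM; rewrite Z // !mul0r.
exists t1, t2, t3, t4; split=> //.
  by move=> v; apply: shift_same hu e1 e2 e3.
split=> //; move: e6; case: (m) m2 => [|[|[|]]] //= _; lia.
Qed.

Lemma xi_case k : eta = case_shift k -> xi = case_xi k rho 0.
Proof. by move=> e; rewrite /xi e; case: k {e} => /=; ring. Qed.

(** Relations with a constant multiplier: at most two steps, and at most one
    step if there are two terms. *)
Lemma classify_const (l : K) (f0 f1 f2 : nat -> K) : l != 0 ->
  (forall i, (2 <= i)%N -> (i <= M)%N -> rel_at l 0 false f0 f1 f2 i) ->
  exists j k : option racahCase,
   [/\ eta = - (vadd (vec j) (vec k)).1.1.1,
      (rN rhot)%:Z = (rN rho)%:Z - (vadd (vec j) (vec k)).1.1.1 - (vadd (vec j) (vec k)).2,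
      same rhot (shift_param (vadd (vec j) (vec k)) rho (rN rhot)) &
      (forall i, (2 <= i)%N -> (i <= M)%N -> f2 i = 0) -> k = None].
Proof.
move=> l0 H.
have H' i : (2 <= i)%N -> (i + false <= M)%N -> rel_at l 0 false f0 f1 f2 i.
  by rewrite addn0; exact: H.
have [m [m2 F2 F1 Z2 [t1 [t2 [t3 [t4 [e1 e2 S P [s1 s2]]]]]]]] := classify_shift l0 H'.
have fin j k : isvec t1 t2 t3 t4 (vadd (vec j) (vec k)) ->
   ((m = 2)%N \/ k = None) -> exists j k : option racahCase,
   [/\ eta = - (vadd (vec j) (vec k)).1.1.1,
      (rN rhot)%:Z = (rN rho)%:Z - (vadd (vec j) (vec k)).1.1.1 - (vadd (vec j) (vec k)).2,
      same rhot (shift_param (vadd (vec j) (vec k)) rho (rN rhot)) &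
      (forall i, (2 <= i)%N -> (i <= M)%N -> f2 i = 0) -> k = None].
  move=> V hm; exists j, k; have [v1 v2 v3 v4] := V; split.
  - by rewrite e1 v1.
  - by rewrite e2 v1 v4.
  - exact: S V.
  - by case: hm => // m22 Z; case: (Z2 m22) => i i2; rewrite addn0; exact: Z.
have add0 v : vadd v (vec None) = v by case: v => [[[a b] c] d]; rewrite /vadd /= !addr0.
case: m m2 F2 F1 Z2 P s1 s2 fin => [|[|[|//]]] _ F2 F1 Z2 P s1 s2 fin.
- have V : isvec t1 t2 t3 t4 (vec None) by apply: steps_sum0 => //; lia.
  by apply: (fin None None); [rewrite add0 | right].
- have [|j V] := steps_sum1 P; first by lia.
  by apply: (fin (Some j) None); [rewrite add0 | right].
have [|[j [k V]]|[d V]] := steps_sum2 P; first by lia.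
  by apply: (fin (Some j) (Some k)); [exact: V | left].
(* Three coordinates are 1 and one, that of d, is -1: rho is the target of d
   from rho', and rhot is reached from rho' by the three other steps. *)
exfalso.
have S' := S _ V; have [v1 v2 v3 v4] := V.
have M4 : (3 <= M)%N by lia.
pose rho' := shift_param (vsub (vec None) (vec (Some d))) rho (rN rho + (lowersN d))%N.
have G' : generic rho' by exact: shift_generic.
have Erho : case_target d rho' = rho.
  rewrite -[LHS]/(step_target (Some d) rho') (@step_targetE _ _ _ (rN rho)).
    rewrite shift_param_comp /shift_param; case: (rho) => a b c N /=.
    by case: (d) => /=; congr RacahParam; rewrite ?addr0.
  by rewrite /rho'; case: (d) => /=; lia.
pose xi' := if d is RIII then pu rho' + 1 else 0.
have Exi : case_xi d rho' xi' = 0 by rewrite /xi'; case: (d) => //=; ring.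
have N' : (10 <= rN rho')%N by rewrite /=; lia.
have X3 a b c : d <> a -> d <> b -> d <> c -> a <> b -> a <> c -> b <> c ->
   shift_param (vsub (1, 1, 1, 1) (vadd (vec (Some d)) (vec (Some d)))) rho (rN rhot)
     = case_target c (case_target b (case_target a rho')) ->
   xi = case_xi c (case_target b (case_target a rho'))
     (case_xi b (case_target a rho') (case_xi a rho' xi')) -> False.
  move=> da db dc ab ac bc Es Ex.
  have := no_three_up_one_down (xi := xi') (x := f0 3%N / l) (y := f1 3%N / l) (z := f2 3%N / l)
    G' N' da db dc ab ac bc; apply; rewrite -Ex -Es Exi Erho.
  have := H 3%N isT M4; rewrite /rel_at /lamP addn0; case: S' => _ _ SS; rewrite !SS => E.
  apply: (scalerI l0); rewrite -[l *: RQ _ _ _]mulr1 -scalerAl mulrC scalerAl E.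
  by rewrite !scalerDr !scalerA ![l * _]mulrC !divfK.
have vd : (rN rhot)%:Z = (rN rho)%:Z -
    (vsub (1, 1, 1, 1) (vadd (vec (Some d)) (vec (Some d)))).1.1.1 -
    (vsub (1, 1, 1, 1) (vadd (vec (Some d)) (vec (Some d)))).2 by rewrite e2 v1 v4.
have eE : eta = - (vsub (1, 1, 1, 1) (vadd (vec (Some d)) (vec (Some d)))).1.1.1.
  by rewrite e1 v1.
have vr : forall z : K, z + 1 - 1 = z by move=> z; rewrite addrK.
unfold xi' in X3; unfold rho' in X3; move: X3 vd eE => {V S' v1 v2 v3 v4 G' N' Exi xi' Erho rho'}.
case: d => X3 vd eE.
- apply: (X3 RIII RII RIV) => //.
    rewrite /shift_param /= in vd *; congr RacahParam; rewrite ?(intrD, intrN); try ring; lia.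
  rewrite /xi eE /= /pu /=; rewrite natrD !(intrD, intrN) /=; ring.
- apply: (X3 RIII RI RIV) => //.
    rewrite /shift_param /= in vd *; congr RacahParam; rewrite ?(intrD, intrN); try ring; lia.
  rewrite /xi eE /= /pu /=; rewrite natrD !(intrD, intrN) /=; ring.
- apply: (X3 RI RII RIV) => //.
    rewrite /shift_param /= in vd *; congr RacahParam; rewrite ?(intrD, intrN); try ring; lia.
  rewrite /xi eE /= /pu /=; rewrite ?/pu /= natrD !(intrD, intrN) /=; ring.
- apply: (X3 RIII RI RII) => //.
    rewrite /shift_param /= in vd *; congr RacahParam; rewrite ?(intrD, intrN); try ring; lia.
  rewrite /xi eE /= /pu /=; rewrite natrD !(intrD, intrN) /=; ring.
Qed.

(** Relations with a multiplier of degree one: a step, possibly trivial,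
    followed by the inverse of a nontrivial one. *)
Lemma classify_linear (l kap : K) (f0 f1 f2 : nat -> K) : l != 0 ->
  (forall i, (2 <= i)%N -> (i < M)%N -> rel_at l kap true f0 f1 f2 i) ->
  exists (j : option racahCase) (k : racahCase),
   [/\ eta = - (vsub (vec j) (vec (Some k))).1.1.1,
      (rN rhot)%:Z = (rN rho)%:Z - (vsub (vec j) (vec (Some k))).1.1.1 - (vsub (vec j) (vec (Some k))).2 &
      same rhot (shift_param (vsub (vec j) (vec (Some k))) rho (rN rhot))].
Proof.
move=> l0 H.
have H' i : (2 <= i)%N -> (i + true <= M)%N -> rel_at l kap true f0 f1 f2 i.
  by rewrite addn1; exact: H.
have [m [m2 F2 F1 Z2 [t1 [t2 [t3 [t4 [e1 e2 S P [s1 s2]]]]]]]] := classify_shift l0 H'.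
have fin j k : isvec t1 t2 t3 t4 (vsub (vec j) (vec (Some k))) ->
   exists (j : option racahCase) (k : racahCase),
   [/\ eta = - (vsub (vec j) (vec (Some k))).1.1.1,
      (rN rhot)%:Z = (rN rho)%:Z - (vsub (vec j) (vec (Some k))).1.1.1 - (vsub (vec j) (vec (Some k))).2 &
      same rhot (shift_param (vsub (vec j) (vec (Some k))) rho (rN rhot))].
  move=> V; exists j, k; have [v1 v2 v3 v4] := V; split.
  - by rewrite e1 v1.
  - by rewrite e2 v1 v4.
  - exact: S V.
have M5 : (5 <= M)%N by lia.
case: m m2 F2 F1 Z2 P s1 s2 => [|[|[|//]]] _ F2 F1 Z2 P s1 s2.
- by exfalso; case: P => -[h1 h2 h3] [h4 h5 h6]; lia.
- have [s|s] : t1 + t2 + t3 + t4 = 0 \/ t1 + t2 + t3 + t4 = -1 by lia.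
    have V := steps_sum0 P s; have [v1 v2 v3 v4] := V.
    have EN : rN rhot = rN rho by move: e2; rewrite v1 v4 /=; lia.
    have [_ _ SS] := S _ V; exfalso.
    apply: (@no_square_in_pencil K rho kap (f0 4%N / l) (f1 4%N / l)) => //; first lia.
    have := H 4%N isT M5; rewrite /rel_at F2 // scale0r addr0 !SS /= => E.
    apply: (scalerI l0); rewrite scalerAl E scalerDr !scalerA ![l * _]mulrC !divfK //.
    have -> : xi = 0 by rewrite /xi e1 v1 /= oppr0 mul0r.
    by congr (_ *: RQ _ _ _ + _ *: RQ _ _ _); case: (rho) EN => a b c N /= ->;
      rewrite /shift_param /= !addr0.
  by have [k V] := steps_sumN1 P s; apply: fin V.
- have [s|s] : t1 + t2 + t3 + t4 = 0 \/ t1 + t2 + t3 + t4 = 1 by lia.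
    have [V|[j [k [_ V]]]] := steps_sum0_le1 P s; last exact: fin V.
    by apply: (fin (Some RI) RI); case: V => -> -> -> ->; split.
  have [k V] := steps_sum1 P s; have [v1 v2 v3 v4] := V; exfalso.
  have [_ _ SS] := S _ V.
  have Et : shift_param (vec (Some k)) rho (rN rhot) = case_target k rho.
    by rewrite -[RHS]/(step_target (Some k) rho) (@step_targetE _ _ _ (rN rhot)) // e2 v1 v4.
  have Ek : eta = case_shift k by rewrite e1 v1; case: (k).
  apply: (@no_linear_multiplier K rho k kap (f0 4%N / l) (f1 4%N / l) (f2 4%N / l)) => //; first lia.
  have := H 4%N isT M5; rewrite /rel_at !SS Et (xi_case Ek) /= => E.
  by apply: (scalerI l0); rewrite scalerAl E !scalerDr !scalerA ![l * _]mulrC !divfK.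
Qed.

End Classification.

(** * Classification of contiguity relations *)

Section FromContiguity.
Variable K : numFieldType.
Implicit Types (rho : racahParam K) (xi : K) (eta : int) (E : seq int).
Implicit Types (lam : K -> K) (Phi : int -> nat -> K).

Lemma racah0 rho x : racah rho 0 x = 1.
Proof. by rewrite (racahE rho 0) /RQ /RP RPn1 hornerC. Qed.

Lemma contig_lam_const E lam Phi rho eta rhot :
  E = [:: 0; -1] \/ E = [:: 0; -1; -2] ->
  contiguity E lam Phi rho eta rhot -> forall x, lam x = Phi 0 0%N.
Proof.
move=> hE H x; have [_ H2] := H 0%N isT.
have := H2 x; rewrite racah0 mulr1 => ->.
  by case: hE => ->; rewrite ?big2E ?big3E /= racah0 mulr1 !addr0.
by left=> e; case: hE => ->; rewrite !inE => h; lia.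
Qed.

Lemma contig_lam_affine lam Phi rho eta rhot :
  racah_wf rhot -> (0 < rN rhot)%N -> pu rhot = pu rho - 2 * eta%:~R ->
  contiguity [:: 1; 0; -1] lam Phi rho eta rhot ->
  exists c l0, forall x, lam x = ((Phi 1 0%N * c) *: 'X + l0%:P).[lattice rho x].
Proof.
move=> w N0 hu H.
pose xi : K := eta%:~R * (pu rho - eta%:~R).
pose p := RQ rhot xi 1.
exists p`_1, (Phi 1 0%N * p`_0 + Phi 0 0%N) => x; have [_ H2] := H 0%N isT.
have := H2 x; rewrite racah0 mulr1 => ->; last first.
  by left=> e; rewrite !inE => h; lia.
rewrite big3E [X in X + _ + _]ifT; last by lia.
rewrite addr0 /= racah0 mulr1.
rewrite (racah_shiftE _ _ hu erefl) -/xi -/p.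
have -> : p = p`_1 *: 'X + (p`_0)%:P.
  apply/polyP => i; rewrite coefD coefZ coefX coefC; case: i => [|[|i]] /=;
    rewrite ?mulr0 ?mulr1 ?add0r ?addr0 //.
  by rewrite nth_default // /p size_RQ.
by rewrite !(hornerE, coefD, coefZ, coefX, coefC) /=; ring.
Qed.

(** N' >= N - 2 for a relation with index shifts 0 and -1.  Otherwise the
    polynomials of index N' + 2 and N' + 3 have a common zero, at the origin of
    the grid of the right-hand side; by the recurrence it is a zero of R_0 = 1. *)
Lemma contig_no_drop lam Phi rho eta rhot : generic rho ->
  contiguity [:: 0; -1] lam Phi rho eta rhot -> Phi 0 0%N != 0 ->
  (rN rho <= (rN rhot).+2)%N.
Proof.
move=> G H l0; rewrite leqNgt; apply/negP => hN.
pose y0 := lattice rho (- eta%:~R).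
have V i : (rN rhot + 2 <= i <= rN rho)%N -> (RQ rho 0 i).[y0] = 0.
  move=> hi; have [_ H2] := H i (ltac:(lia)).
  have := H2 (- eta%:~R); rewrite (contig_lam_const (or_introl erefl) H) big2E.
  rewrite !ifF; try lia; rewrite addr0 (racahE rho 0) subr0 => E.
  apply/eqP; have/eqP := E (ltac:(by right; exists 0%N; rewrite ?addNr)).
  by rewrite mulf_eq0 (negPf l0).
have W d : (d <= rN rhot + 2)%N ->
   (RQ rho 0 (rN rhot + 2 - d)).[y0] = 0 /\ (RQ rho 0 (rN rhot + 2 - d).+1).[y0] = 0.
  elim: d => [_|d IH hd]; first by rewrite subn0; split; apply: V; lia.
  have [v1 v2] := IH (ltnW hd).
  have -> : (rN rhot + 2 - d.+1).+1 = (rN rhot + 2 - d)%N by lia.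
  split=> //; have [a [b [c [c0 E]]]] := RQ_ttr 0 G (i := (rN rhot + 2 - d)%N) (ltac:(lia)).
  have := congr1 (fun p : {poly K} => p.[y0]) E.
  rewrite hornerM !hornerD !(hornerZ _ (RQ _ _ _)) v1 v2 !mulr0 !add0r => /esym/eqP.
  rewrite mulf_eq0 (negPf c0) => /eqP.
  by have -> : (rN rhot + 2 - d).-1 = (rN rhot + 2 - d.+1)%N by lia.
have [] := W _ (leqnn _); rewrite subnn /RQ /RP RPn1 hornerC => /eqP.
by rewrite oner_eq0.
Qed.

Lemma step_shiftE k : step_shift k = - (vec k).1.1.1.
Proof. by case: k => [[]|]. Qed.

Lemma vadd_None v : vadd v (vec None) = v.
Proof. by case: v => [[[a b] c] d]; rewrite /vadd /= !addr0. Qed.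

Lemma two_term_class (M : nat) (l : K) (f0 f1 : nat -> K) rho eta rhot :
  generic rho -> racah_wf rhot -> pu rhot = pu rho - 2 * eta%:~R ->
  (40 <= M)%N -> (M <= rN rho)%N -> (M <= rN rhot)%N -> l != 0 ->
  (forall i, (2 <= i <= M)%N -> l%:P * RQ rho 0 i =
      f0 i *: RQ rhot (eta%:~R * (pu rho - eta%:~R)) i
      + f1 i *: RQ rhot (eta%:~R * (pu rho - eta%:~R)) i.-1) ->
  exists j, eta = step_shift j /\ same rhot (step_target j rho).
Proof.
move=> G w hu M40 MN MN' l0 H.
have [|j [k [e1 e2 e3 e4]]] := classify_const (f0 := f0) (f1 := f1) (f2 := fun=> 0)
   G w hu M40 MN MN' l0.
  move=> i i2 iM; rewrite /rel_at /lamP alg_polyC H ?i2 // addn0.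
  by rewrite scale0r addr0.
rewrite (e4 (fun _ _ _ => erefl)) vadd_None in e1 e2 e3.
exists j; rewrite step_shiftE; split=> //.
by rewrite (@step_targetE _ j rho (rN rhot)).
Qed.

(** A relation with index shifts 0 and -1 leads to the target of a single step. *)
Lemma A2_class lam Phi rho eta rhot : generic rho -> (50 <= rN rho)%N ->
  racah_wf rhot -> pu rhot = pu rho - 2 * eta%:~R ->
  contiguity [:: 0; -1] lam Phi rho eta rhot -> Phi 0 0%N != 0 ->
  exists j, eta = step_shift j /\ same rhot (step_target j rho).
Proof.
move=> G N50 w hu H l0; have dr := contig_no_drop G H l0.
apply: (@two_term_class (minn (rN rho) (rN rhot)) (Phi 0 0%N) (Phi 0) (Phi (-1)) _ _ _ G w hu);
  rewrite ?geq_minl ?geq_minr //; first by lia.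
move=> i hi; rewrite (contig_poly G hu H (lp := (Phi 0 0%N)%:P)) //.
- rewrite !big_cons big_nil [X in _ + X]addr0.
  by congr (_ *: RQ _ _ _ + _ *: RQ _ _ _); lia.
- by move=> x; rewrite hornerC (contig_lam_const (or_introl erefl) H).
- by lia.
- by move=> e; rewrite !inE => he; lia.
Qed.

(** When the multiplier is constant, comparison of degrees shows that the
    coefficient of index shift 1 vanishes. *)
Lemma B2_class_const lam Phi rho eta rhot l0 : generic rho -> (50 <= rN rho)%N ->
  (rN rho <= (rN rhot).+2)%N -> racah_wf rhot -> pu rhot = pu rho - 2 * eta%:~R ->
  contiguity [:: 1; 0; -1] lam Phi rho eta rhot ->
  (forall x, lam x = l0) -> l0 != 0 ->
  exists j, eta = step_shift j /\ same rhot (step_target j rho).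
Proof.
move=> G N50 dr w hu H hl l00; set M := (minn (rN rho) (rN rhot)).-1.
have M1 : (M <= rN rho)%N by lia.
have M2 : (M < rN rhot)%N by lia.
apply: (@two_term_class M l0 (Phi 0) (Phi (-1)) _ _ _ G w hu) => //; try lia.
move=> i hi; have := @contig_poly _ _ _ _ G hu _ _ l0%:P _ i H.
rewrite !big_cons big_nil [X in _ + (_ + X)]addr0.
have -> : absz (i%:Z + 1)%R = i.+1 by lia.
have -> : absz (i%:Z + 0)%R = i by lia.
have -> : absz (i%:Z + -1)%R = i.-1 by lia.
move=> E; have {}E := E (fun x => (etrans (hl x) (esym (hornerC _ _)))) (ltac:(lia)).
have {}E := E (ltac:(by move=> e; rewrite !inE => he; lia)).
have F : Phi 1 i = 0.
  have := congr1 (fun p : {poly K} => p`_i.+1) E.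
  rewrite coefCM !coefD !(coefZ (Phi _ _)).
  rewrite [X in _ * X = _]nth_default; last by rewrite size_RQ //; [exact: generic_wf | lia].
  rewrite [X in _ = _ + (Phi 0 _ * X + _)]nth_default; last by rewrite size_RQ //; lia.
  rewrite [X in _ = _ + (_ + Phi (-1) _ * X)]nth_default; last by rewrite size_RQ //; lia.
  rewrite !mulr0 !addr0 => /esym/eqP; rewrite mulf_eq0 => /orP[/eqP //|].
  have : lead_coef (RQ rhot (eta%:~R * (pu rho - eta%:~R)) i.+1) != 0.
    by rewrite lead_coef_eq0 -size_poly_gt0 size_RQ //; lia.
  by rewrite lead_coefE size_RQ // => [/negPf ->|]; last by lia.
by rewrite E F scale0r add0r.
Qed.

Lemma B2_class_linear lam Phi rho eta rhot l1 l0 : generic rho -> (50 <= rN rho)%N ->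
  (rN rho <= (rN rhot).+2)%N -> racah_wf rhot -> pu rhot = pu rho - 2 * eta%:~R ->
  contiguity [:: 1; 0; -1] lam Phi rho eta rhot ->
  (forall x, lam x = (l1 *: 'X + l0%:P).[lattice rho x]) -> l1 != 0 ->
  exists (j : option racahCase) (k : racahCase) (rhot' : racahParam K),
   [/\ eta = step_shift j - case_shift k, generic rhot', same rhot rhot' &
      step_target j rho = case_target k rhot'].
Proof.
move=> G N50 dr w hu H hl l10; set M := (minn (rN rho) (rN rhot)).
have M1 : (M <= rN rho)%N by lia.
have M2 : (M <= rN rhot)%N by lia.
have [||j [k [e1 e2 e3]]] := @classify_linear _ _ _ _ G w hu M _ M1 M2 l1 (- l0 / l1) (Phi 1) (Phi 0) (Phi (-1)) l10.
- by lia.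
- move=> i i2 iM; rewrite /rel_at /lamP addn1.
  have -> : l1 *: ('X - (- l0 / l1)%:P) = l1 *: 'X + l0%:P.
    by rewrite scalerBr -[l1 *: _%:P]mul_polyC -polyCM mulrC divfK // polyCN opprK.
  rewrite (@contig_poly _ _ _ _ G hu _ _ _ _ i H hl); try lia; last first.
    by move=> e; rewrite !inE => he; lia.
  rewrite !big_cons big_nil [X in _ + (_ + X)]addr0 addrA.
  by congr (_ *: RQ _ _ _ + _ *: RQ _ _ _ + _ *: RQ _ _ _); lia.
exists j, k, (shift_param (vsub (vec j) (vec (Some k))) rho (rN rhot)); split=> //.
- by rewrite e1 step_shiftE -[case_shift k]/(step_shift (Some k)) step_shiftE /=; lia.
- exact: shift_generic.
- by rewrite -[RHS]/(step_target (Some k) _) step_sub // ?e2 //; lia.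
Qed.

Lemma B2'_class lam Phi rho eta rhot : generic rho -> (50 <= rN rho)%N ->
  (rN rho <= (rN rhot).+2)%N -> racah_wf rhot -> pu rhot = pu rho - 2 * eta%:~R ->
  contiguity [:: 0; -1; -2] lam Phi rho eta rhot -> Phi 0 0%N != 0 ->
  exists j k, eta = step_shift j + step_shift k /\
      same rhot (step_target k (step_target j rho)).
Proof.
move=> G N50 dr w hu H l0; set M := (minn (rN rho) (rN rhot)).
have M1 : (M <= rN rho)%N by lia.
have M2 : (M <= rN rhot)%N by lia.
have [||j [k [e1 e2 e3 _]]] := @classify_const _ _ _ _ G w hu M _ M1 M2 (Phi 0 0%N) (Phi 0) (Phi (-1)) (Phi (-2)) l0.
- by lia.
- move=> i i2 iM; rewrite /rel_at /lamP alg_polyC addn0.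
  rewrite (@contig_poly _ _ _ _ G hu _ _ (Phi 0 0%N)%:P _ i H); try lia; last first.
  + by move=> e; rewrite !inE => he; lia.
  + by move=> x; rewrite hornerC (contig_lam_const (or_intror erefl) H).
  rewrite !big_cons big_nil [X in _ + (_ + X)]addr0 addrA.
  by congr (_ *: RQ _ _ _ + _ *: RQ _ _ _ + _ *: RQ _ _ _); lia.
exists j, k; split; first by rewrite e1 !step_shiftE /=; lia.
by rewrite -(@step_add _ j k rho (rN rhot)) //; lia.
Qed.

End FromContiguity.

(** * Composition of elementary steps *)

Section Steps.
Variable K : numFieldType.
Implicit Types (rho : racahParam K) (xi : K) (eta : int) (E : seq int).
Implicit Types (lam : K -> K) (Phi : int -> nat -> K) (k : option racahCase).

(** Composition of two relations.  On the grid of the right-hand side, the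
    intermediate point must be on the intermediate grid, unless the second
    multiplier vanishes there. *)
Lemma contiguity_comp (a : int) lam1 lam2 P Q Phi rho rhob rhot eta1 eta2 eta :
  eta = eta1 + eta2 ->
  contiguity [:: 0; -1] lam1 P rho eta1 rhob ->
  contiguity [:: a; a - 1] lam2 Q rhob eta2 rhot ->
  (rN rhot)%:Z <= (rN rhob)%:Z + a ->
  (forall m : nat, (m <= rN rhot)%N -> lam2 (m%:R - eta2%:~R) = 0 \/
     exists2 m' : nat, (m' <= rN rhob)%N & m%:R - eta2%:~R = m'%:R :> K) ->
  (forall i, (i <= rN rho)%N ->
    [/\ Phi a i = P 0 i * Q a i,
        Phi (a - 1) i = P 0 i * Q (a - 1) i + P (-1) i * Q a i.-1 &
        Phi (a - 2) i = P (-1) i * Q (a - 1) i.-1]) ->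
  contiguity [:: a; a - 1; a - 2] (fun x => lam1 x * lam2 (x + eta1%:~R)) Phi rho eta rhot.
Proof.
move=> -> H1 H2 hN hg hP i iN; have [p1 p2 p3] := hP i iN.
have [Z1 V1] := H1 i iN.
have P0z : (rN rhob < i)%N -> P 0 i = 0.
  by move=> h; apply: Z1; rewrite ?inE //; lia.
have P1z : ((rN rhob).+1 < i)%N \/ i = 0%N -> P (-1) i = 0.
  by move=> h; apply: Z1; rewrite ?inE //; lia.
have Qz e j : e \in [:: a; a - 1] -> (j <= rN rhob)%N -> ~~ (0 <= j%:Z + e <= (rN rhot)%:Z) ->
   Q e j = 0.
  by move=> he hj h; have [Z2 _] := H2 j hj; apply: Z2.
have ha : a \in [:: a; a - 1] by rewrite !inE eqxx.
have ha1 : a - 1 \in [:: a; a - 1] by rewrite !inE eqxx orbT.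
have PQ0 e : e \in [:: a; a - 1] -> ~~ (0 <= i%:Z + e <= (rN rhot)%:Z) -> P 0 i * Q e i = 0.
  move=> he h; have [hi|hi] := leqP i (rN rhob); last by rewrite P0z ?mul0r.
  by rewrite (Qz e) ?mulr0.
have PQ1 e : e \in [:: a; a - 1] -> ~~ (0 <= i%:Z - 1 + e <= (rN rhot)%:Z) ->
    P (-1) i * Q e i.-1 = 0.
  move=> he h; have [hi|hi] := boolP ((0 < i) && (i.-1 <= rN rhob))%N; last first.
    by rewrite P1z ?mul0r //; lia.
  by rewrite (Qz e) ?mulr0 //; lia.
split.
  move=> e; rewrite !inE => /or3P[] /eqP -> h.
  - by rewrite p1 PQ0.
  - by rewrite p2 PQ0 ?PQ1 ?addr0 //; lia.
  - by rewrite p3 PQ1 //; lia.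
move=> x hx; set y := x + eta1%:~R.
have ey : x + (eta1 + eta2)%:~R = y + eta2%:~R by rewrite intrD addrA.
rewrite ey.
have {}hx : i%:Z + a <= (rN rhot)%:Z \/ exists2 m : nat, (m <= rN rhot)%N & y + eta2%:~R = m%:R.
  by case: hx => [h|h]; [left; apply: h; rewrite !inE eqxx | right; rewrite -ey].
pose r (j : int) : K := if 0 <= j <= (rN rhot)%:Z then racah rhot (absz j) (y + eta2%:~R) else 0.
pose rb (j : int) : K := if 0 <= j <= (rN rhob)%:Z then racah rhob (absz j) y else 0.
have rE (F : int -> K) (e j : int) :
   (if 0 <= j <= (rN rhot)%:Z then F e * racah rhot (absz j) (y + eta2%:~R) else 0) = F e * r j.
  by rewrite /r; case: ifP; rewrite ?mulr0.
rewrite big3E !(rE (fun e => Phi e i)) p1 p2 p3.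
have X j : (j <= rN rhob)%N -> j%:Z <= i%:Z ->
    lam2 y * racah rhob j y = Q a j * r (j%:Z + a) + Q (a - 1) j * r (j%:Z + (a - 1)).
  move=> hj ji; have [_ V2] := H2 j hj; rewrite V2.
    by rewrite big2E !(rE (fun e => Q e j)).
  case: hx => [hx|hx]; [left=> e'|by right].
  by rewrite !inE => /orP[] /eqP ->; lia.
have S0 : P 0 i * (lam2 y * rb i%:Z) = P 0 i * (Q a i * r (i%:Z + a) + Q (a - 1) i * r (i%:Z + (a - 1))).
  rewrite /rb; case: ifP => h; first by rewrite X //; lia.
  by rewrite P0z ?mul0r //; lia.
have S1 : P (-1) i * (lam2 y * rb (i%:Z - 1)) = P (-1) i * (Q a i.-1 * r (i%:Z + (a - 1))
     + Q (a - 1) i.-1 * r (i%:Z + (a - 2))).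
  rewrite /rb; case: ifP => h; last by rewrite P1z ?mul0r //; lia.
  have -> : absz (i%:Z - 1) = i.-1 by lia.
  rewrite X //; try lia.
  by congr (_ * (_ * r _ + _ * r _)); lia.
transitivity (P 0 i * (lam2 y * rb i%:Z) + P (-1) i * (lam2 y * rb (i%:Z - 1))); last first.
  by rewrite S0 S1; ring.
have D : lam2 y = 0 \/ ((forall e : int, e \in [:: 0; -1] -> i%:Z + e <= (rN rhob)%:Z) \/
     exists2 m : nat, (m <= rN rhob)%N & y = m%:R).
  case: hx => [hx|[m hm em]].
    by right; left => e; rewrite !inE => /orP[] /eqP ->; lia.
  have ey' : y = m%:R - eta2%:~R by rewrite -em addrK.
  by rewrite ey'; case: (hg m hm) => h; [left | right; right].
case: D => [->|D]; first by rewrite !(mulr0, mul0r, addr0).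
have := V1 x D; rewrite big2E => E.
transitivity (lam2 y * (lam1 x * racah rho i x)); first by ring.
rewrite E addr0 /rb; do 2! case: ifP => _; ring.
Qed.

(** Coefficients and multiplier of the relation of a step ([step_P]) and of its
    associated relation ([step_lamm], [step_Q]). *)
Definition step_P k rho (e : int) (i : nat) : K :=
  if k is Some k then case_Phip k rho e i else (e == 0)%:R.
Definition step_lamm k rho (x : K) : K :=
  if k is Some k then case_lamm k rho x else 1.
Definition step_Q k rho (e : int) (i : nat) : K :=
  if k is Some k then case_Phim k rho e i else (e == 0)%:R.

Lemma contig_id (a b : int) rho : a = 0 /\ b = -1 \/ a = 1 /\ b = 0 ->
  contiguity [:: a; b] (fun=> 1) (fun e _ => (e == 0)%:R) rho 0 rho.
Proof.
move=> hab i iN; split.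
  move=> e; case: eqP => // -> _; rewrite addr0 => h; lia.
move=> x _; rewrite addr0 big2E.
case: hab => -[-> ->] /=; rewrite ?(eqxx, mul0r, mul1r, if_same, add0r, addr0) ifT ?addn0 //; lia.
Qed.

Lemma step_relations k rho : generic rho -> (0 < rN rho)%N ->
  A2_relation (fun=> 1) (step_P k rho) rho (step_shift k) (step_target k rho) /\
  A2_associated (step_lamm k rho) (step_Q k rho) rho (step_shift k) (step_target k rho).
Proof.
move=> G N0; case: k => [k|] /=; first exact: four_relations.
have w := generic_wf G; split; last by apply: contig_id; right.
split=> //; first by apply: compat_of_pu; rewrite mulr0 subr0.
  by apply: contig_id; left.
by rewrite /step_P eqxx oner_eq0.
Qed.

Lemma contig_scale E lam Phi rho eta rhot (kappa : K) :
  contiguity E lam Phi rho eta rhot ->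
  contiguity E (fun x => kappa * lam x) (fun e i => kappa * Phi e i) rho eta rhot.
Proof.
move=> H; apply: contig_ext (contig_lin kappa 0 H H) => [x|e i _ _];
  by rewrite mul0r addr0.
Qed.

Lemma A2_same lam P rho rho' eta rhob rhob' kappa :
  same rho rho' -> same rhob rhob' -> racah_wf rho' -> racah_wf rhob' -> kappa != 0 ->
  A2_relation lam P rho eta rhob ->
  A2_relation (fun x => kappa * lam x) (fun e i => kappa * P e i) rho' eta rhob'.
Proof.
move=> S Sb w wb k0 [_ _ c H p0]; split=> //.
- apply: compat_of_pu; have := compat_pu c.
  by case: S Sb => _ -> _ [_ -> _].
- by apply: contig_scale; apply: contig_same_l S _; apply: contig_same_r Sb _.
- by rewrite mulf_neq0.
Qed.

Lemma A2_assoc_same lam P rho rho' eta rhob rhob' kappa :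
  same rho rho' -> same rhob rhob' ->
  A2_associated lam P rho eta rhob ->
  A2_associated (fun x => kappa * lam x) (fun e i => kappa * P e i) rho' eta rhob'.
Proof.
move=> S Sb H; rewrite /A2_associated.
apply: (@contig_scale _ (fun y => lam (y - eta%:~R))).
by apply: contig_same_l Sb _; apply: contig_same_r S _.
Qed.

Lemma step_rN k rho : rN (step_target k rho) = (rN rho - (if k is Some k then lowersN k else false))%N.
Proof. by case: k => [k|] /=; rewrite ?target_rN ?subn0. Qed.

Lemma step_target_generic k rho : generic rho -> generic (step_target k rho).
Proof. by case: k => [k|] //=; exact: target_generic. Qed.

Lemma step_target_pu k rho : (0 < rN rho)%N ->
  pu (step_target k rho) = pu rho - 2 * (step_shift k)%:~R.
Proof. by move=> N0; case: k => [k|] /=; [apply: target_pu | rewrite mulr0 subr0]. Qed.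

(** The multiplier vanishes at the points of the grid of rho that the step
    does not send to the grid of its target: x = N for RI, x = 0 for RIII. *)
Lemma step_lamm_grid k rho m : (0 < rN rho)%N -> (m <= rN rho)%N ->
  step_lamm k rho m%:R = 0 \/
  exists2 m' : nat, (m' <= rN (step_target k rho))%N &
    m%:R + (step_shift k)%:~R = m'%:R :> K.
Proof.
move=> N0 mN; have triv : (m <= rN (step_target k rho))%N -> step_shift k = 0 ->
  exists2 m' : nat, (m' <= rN (step_target k rho))%N &
    m%:R + (step_shift k)%:~R = m'%:R :> K by move=> h ->; exists m; rewrite ?addr0.
case: k triv => [[]|] triv; rewrite step_rN /= in triv *; try (by right; apply: triv; lia).
- have [->|hm] := eqVneq m (rN rho).
    by left; case: (rho) => a b c N /=; rewrite subrr mulr0 mul0r.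
  by right; apply: triv => //; lia.
- have [->|hm] := posnP m.
    by left; case: (rho) => a b c N /=; rewrite !mul0r.
  right; exists m.-1; first lia.
  by rewrite -[in LHS](prednK hm) -natr1 addrK.
Qed.

(** The coefficients of step j followed by the inverse of step k. *)
Definition B2_coef j k rho rhot (e : int) (i : nat) : K :=
  if e == 1 then step_P j rho 0 i * step_Q k rhot 1 i else
  if e == 0 then step_P j rho 0 i * step_Q k rhot 0 i + step_P j rho (-1) i * step_Q k rhot 1 i.-1
  else step_P j rho (-1) i * step_Q k rhot 0 i.-1.

Lemma B2_steps j k rho rhot eta : generic rho -> generic rhot ->
  (0 < rN rho)%N -> (0 < rN rhot)%N -> step_target j rho = step_target k rhot ->
  eta = step_shift j - step_shift k ->
  contiguity [:: 1; 0; -1] (fun x => step_lamm k rhot (x + eta%:~R))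
    (B2_coef j k rho rhot) rho eta rhot.
Proof.
move=> G Gt N0 Nt ET ->.
have [[_ _ _ H1 _] _] := step_relations j G N0.
have [_ H2] := step_relations k Gt Nt; rewrite /A2_associated -ET in H2.
have -> : [:: 1; 0; -1] = [:: 1; 1 - 1; 1 - 2] :> seq int by [].
apply: (@contig_ext _ _ (fun x => 1 *
   step_lamm k rhot (x + (step_shift j)%:~R - (step_shift k)%:~R)) _ (B2_coef j k rho rhot)) => //.
  by move=> x; rewrite mul1r intrB addrA.
apply: contiguity_comp (erefl _) H1 H2 _ _ _ => //.
- by rewrite ET step_rN; case: (k) => [[]|] /=; lia.
- move=> m hm; rewrite intrN opprK addrK ET.
  exact: step_lamm_grid.
Qed.

Lemma B2_from_steps j k rho rhot rhot' eta lam Phi kappa :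
  generic rho -> generic rhot' -> (0 < rN rho)%N -> (0 < rN rhot')%N ->
  same rhot rhot' -> racah_wf rhot -> step_target j rho = step_target k rhot' ->
  eta = step_shift j - step_shift k ->
  (forall x, lam x = kappa * step_lamm k rhot' (x + eta%:~R)) ->
  (forall e i, e \in [:: 1; 0; -1] -> (i <= rN rho)%N ->
     Phi e i = kappa * B2_coef j k rho rhot' e i) ->
  B2_from_A2 lam Phi rho eta rhot.
Proof.
move=> G Gt N0 Nt S w ET he hl hP.
have [H1 _] := step_relations j G N0.
have [H2 H3] := step_relations k Gt Nt; rewrite -ET in H2 H3.
have S' := same_sym S; have wb := generic_wf (step_target_generic (k := j) G).
exists (step_target j rho), (step_shift j), (step_shift k), (fun=> 1), (fun x => 1 * 1),
  (fun x => kappa * step_lamm k rhot' x), (step_P j rho), (fun e i => 1 * step_P k rhot' e i),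
  (fun e i => kappa * step_Q k rhot' e i); split=> //.
- by split; [case: (j) => [[]|] | case: (k) => [[]|] | rewrite he subrK].
- split; last exact: A2_assoc_same H3.
  by apply: A2_same H2 => //; exact: oner_neq0.
- by move=> x; rewrite hl mul1r.
- move=> i iN; rewrite !hP ?inE //= /B2_coef /=; split; ring.
Qed.

(** The coefficients of step j followed by step k. *)
Definition B2'_coef j k rho (e : int) (i : nat) : K :=
  let rhob := step_target j rho in
  if e == 0 then step_P j rho 0 i * step_P k rhob 0 i else
  if e == -1 then step_P j rho 0 i * step_P k rhob (-1) i + step_P j rho (-1) i * step_P k rhob 0 i.-1
  else step_P j rho (-1) i * step_P k rhob (-1) i.-1.

Lemma B2'_steps j k rho eta : generic rho -> (1 < rN rho)%N ->
  eta = step_shift j + step_shift k ->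
  contiguity [:: 0; -1; -2] (fun=> 1) (B2'_coef j k rho) rho eta
    (step_target k (step_target j rho)).
Proof.
move=> G N0 he; have Nb : (0 < rN (step_target j rho))%N.
  by rewrite step_rN; case: (j) => [[]|] /=; lia.
have [[_ _ _ H1 _] _] := step_relations j G (ltnW N0).
have [[_ _ _ H2 _] _] := step_relations k (step_target_generic (k := j) G) Nb.
have -> : [:: 0; -1; -2] = [:: 0; 0 - 1; 0 - 2] :> seq int by [].
apply: (@contig_ext _ _ (fun x => 1 * 1) _ (B2'_coef j k rho)) => //.
  by move=> x; rewrite mul1r.
apply: contiguity_comp he H1 H2 _ _ _ => //.
  by rewrite step_rN; case: (k) => [[]|] /=; lia.
move=> m; rewrite step_rN => hm; right.
have [e|e] : step_shift k = 0 \/ k = Some RIII by case: (k) => [[]|]; [left|left|right|left|left].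
  by exists m; [lia | rewrite e subr0].
rewrite e /= in hm *; exists m.+1; first lia.
by rewrite -natr1 opprK.
Qed.

Lemma B2'_from_steps j k rho rhot eta lam Phi kappa :
  generic rho -> (1 < rN rho)%N -> kappa != 0 ->
  same rhot (step_target k (step_target j rho)) -> racah_wf rhot ->
  eta = step_shift j + step_shift k ->
  (forall x, lam x = kappa) ->
  (forall e i, e \in [:: 0; -1; -2] -> (i <= rN rho)%N ->
     Phi e i = kappa * B2'_coef j k rho e i) ->
  B2'_from_A2 lam Phi rho eta rhot.
Proof.
move=> G N0 k0 S w he hl hP.
have Nb : (0 < rN (step_target j rho))%N.
  by rewrite step_rN; case: (j) => [[]|] /=; lia.
have [H1 _] := step_relations j G (ltnW N0).
have [H2 _] := step_relations k (step_target_generic (k := j) G) Nb.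
have wb := generic_wf (step_target_generic (k := j) G).
exists (step_target j rho), (step_shift j), (step_shift k), (fun=> 1), (fun x => kappa * 1),
  (step_P j rho), (fun e i => kappa * step_P k (step_target j rho) e i); split=> //.
- by split; [case: (j) => [[]|] | case: (k) => [[]|] | ].
- by apply: A2_same H2 => //; exact: same_sym.
- by move=> x; rewrite hl mul1r mulr1.
- move=> i iN; rewrite !hP ?inE //= /B2'_coef /=; split; ring.
Qed.

End Steps.

(** * Uniqueness of the coefficients *)

Section Conclusions.
Variable K : numFieldType.
Implicit Types (rho : racahParam K) (xi : K) (eta : int) (E : seq int).
Implicit Types (lam : K -> K) (Phi : int -> nat -> K).

(** The identity between the two families is itself a relation with index
    shifts 0 and -1; by the classification it is the trivial step, since the
    coefficient of index shift -1 of a nontrivial step does not vanish. *)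
Lemma racah_same_same rho rhot : generic rho -> (50 <= rN rho)%N -> racah_wf rhot ->
  pu rhot = pu rho -> racah_same rhot rho -> same rhot rho.
Proof.
move=> G N50 w hu [eN hR].
have hu0 : pu rhot = pu rho - 2 * (0 : int)%:~R by rewrite mulr0 subr0.
have H : contiguity [:: 0; -1] (fun=> 1) (fun e _ => (e == 0)%:R) rho 0 rhot.
  move=> i iN; have [H1 H2] := contig_id (or_introl (conj erefl erefl)) iN.
  rewrite eN; split=> // x hx; rewrite H2 //; apply: eq_bigr => e he.
  by rewrite hR //; lia.
have [|[k|] [e S]] := A2_class G N50 w hu0 H; [exact: oner_neq0| |by []].
have [[_ _ _ H' _] _] := step_relations (Some k) G (ltac:(lia)).
have H'' := contig_same_r (same_sym S) H'; rewrite -e in H''.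
have U : uniq [:: 0; -1 : int] by [].
have := contig_unique G hu0 w U H H'' (e := -1) (i := 1%N) isT (ltac:(lia)).
rewrite /step_P /= => /esym/eqP.
by rewrite (negPf (case_Phip1_neq0 _ _ _)) //; lia.
Qed.

Lemma contig_extend E e0 lam Phi rho eta rhot : e0 \notin E ->
  contiguity E lam Phi rho eta rhot ->
  contiguity (rcons E e0) lam (fun e i => if e == e0 then 0 else Phi e i) rho eta rhot.
Proof.
move=> e0E H i iN; have [H1 H2] := H i iN; split=> [e|x hx].
  by rewrite mem_rcons inE; case: eqP => //= _; exact: H1.
have hx' : (forall e : int, e \in E -> i%:Z + e <= (rN rhot)%:Z) \/
   (exists2 m : nat, (m <= rN rhot)%N & x + eta%:~R = m%:R).
  by case: hx => [hx|]; [left=> e he; apply: hx; rewrite mem_rcons inE he orbT | right].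
rewrite (H2 x hx') -cats1 big_cat /= [X in _ = _ + X]big_cons big_nil.
rewrite eqxx mul0r !addr0 if_same addr0.
rewrite big_seq_cond [RHS]big_seq_cond; apply: eq_bigr => e /andP[eE _].
by case: eqP eE e0E => // -> ->.
Qed.

(** Parameters from which a step leads to rho, or to the target of a step from
    rho, are not themselves the target of a step from rho.  Otherwise R_i would
    be expanded in two ways at the common target, with and without a term of
    index i - 2. *)
Lemma no_const_and_linear rho rhot j k j' : generic rho -> generic rhot ->
  (10 <= rN rho)%N -> (10 <= rN rhot)%N ->
  step_target j rho = case_target k rhot -> step_shift j - case_shift k = case_shift j' ->
  same rhot (case_target j' rho) -> False.
Proof.
move=> G Gt N N' ET es S.
have Gb : generic (case_target k rhot) by exact: target_generic.
have [[_ _ _ H1 _] _] := step_relations (j) G (ltac:(lia)).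
have [[_ _ _ H2 _] _] := step_relations (Some j') G (ltac:(lia)).
have [[_ _ _ H3 _] _] := step_relations (Some k) Gt (ltac:(lia)).
have H2' := contig_same_r (same_sym S) H2.
have E : step_shift j = case_shift j' + case_shift k by rewrite -es subrK.
pose Q (e : int) i : K := if e == 0 then step_P (Some j') rho 0 i * step_P (Some k) rhot 0 i else
  if e == -1 then step_P (Some j') rho 0 i * step_P (Some k) rhot (-1) i
     + step_P (Some j') rho (-1) i * step_P (Some k) rhot 0 i.-1
  else step_P (Some j') rho (-1) i * step_P (Some k) rhot (-1) i.-1.
have HC : contiguity [:: 0; -1; -2] (fun x => 1 * 1) Q rho (step_shift j) (case_target k rhot).
  apply: (contiguity_comp (a := 0) E H2' H3) => //.
    by rewrite target_rN; case: (k) => /=; lia.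
  move=> m; rewrite /= target_rN => hm; right; case: (k) hm => /= hm;
    try (by exists m; [lia | rewrite subr0]).
  by exists m.+1; [lia | rewrite -natr1 opprK].
have H1' := contig_extend (isT : (-2 : int) \notin [:: 0; -1]) H1; rewrite ET in H1'.
have hu : pu (case_target k rhot) = pu rho - 2 * (step_shift j)%:~R.
  by rewrite -ET step_target_pu //; lia.
have HC' := contig_ext (lam' := fun=> 1) (Phi' := Q) (fun x => mul1r 1) (fun _ _ _ _ => erefl) HC.
have U : uniq [:: 0; -1; -2 : int] by [].
have := contig_unique G hu (generic_wf Gb) U HC' H1' (e := -2) (i := 3%N) isT (ltac:(lia)).
rewrite eqxx /Q /= => /eqP; rewrite mulf_eq0.
by rewrite !(negPf (case_Phip1_neq0 _ _ _)) //; lia.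
Qed.

Lemma case_Phim10_neq0 k rho : generic rho -> (0 < rN rho)%N -> case_Phim k rho 1 0 != 0.
Proof.
move=> G N0; have n0 : (rN rho)%:R != 0 :> K by rewrite pnatr_eq0 -lt0n.
have h1 : rA rho + 1 != 0 by apply: (@gen_ne K rho _ 1 1 0 0 G) => //; ring.
have h2 : rB rho + rC rho + 1 != 0 by apply: (@gen_ne K rho _ 1 0 1 1 G) => //; ring.
have h3 : 2 + rA rho + rB rho != 0 by apply: (@gen_ne K rho _ 2 1 1 0 G) => //; ring.
case: rho {G N0} n0 h1 h2 h3 => a b c n /= n0 h1 h2 h3.
have h1' : 1 + a != 0 by rewrite addrC.
have h2' : 1 + b + c != 0 by rewrite -addrA addrC.
by case: k => /=; rewrite ?oppr_eq0 !(mulr0, add0r, subr0) ?mulf_neq0 ?invr_eq0 ?oner_neq0.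
Qed.

(** The multiple of the composite relation with the same coefficient of
    index shift 1 at i = 0 is subtracted; what remains has a constant
    multiplier, which vanishes by [no_const_and_linear] or because the families
    differ. *)
Lemma linear_unique lam Phi rho rhot eta j k : generic rho -> generic rhot ->
  (60 <= rN rho)%N -> (rN rho <= (rN rhot).+2)%N ->
  step_target j rho = case_target k rhot -> eta = step_shift j - case_shift k ->
  ~ (eta = 0 /\ same rhot rho) ->
  contiguity [:: 1; 0; -1] lam Phi rho eta rhot ->
  exists kappa, (forall x, lam x = kappa * case_lamm k rhot (x + eta%:~R)) /\
    forall e i, e \in [:: 1; 0; -1] -> (i <= rN rho)%N ->
      Phi e i = kappa * B2_coef j (Some k) rho rhot e i.
Proof.
move=> G Gt N60 dr ET he nt H; have wt := generic_wf Gt.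
have HC := B2_steps (k := Some k) G Gt (ltac:(lia)) (ltac:(lia)) ET he.
have hu : pu rhot = pu rho - 2 * eta%:~R.
  have := step_target_pu j (rho := rho) (ltac:(lia)).
  rewrite ET target_pu; last by lia.
  by move=> h; apply: (addIr (- (2 * (case_shift k)%:~R))); rewrite h he intrB; ring.
have c0 : B2_coef j (Some k) rho rhot 1 0 != 0.
  rewrite /B2_coef eqxx mulf_neq0 //; last by apply: case_Phim10_neq0 => //; lia.
  have [[_ _ _ H1 _] _] := step_relations (j) G (ltac:(lia)).
  by rewrite -(contig_lam_const (or_introl erefl) H1 0) oner_neq0.
set kap := Phi 1 0%N / B2_coef j (Some k) rho rhot 1 0.
have HD := contig_lin 1 (- kap) H HC.
have [|c [l0 hD]] := contig_lam_affine wt _ hu HD; first by lia.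
have l00 : l0 = 0.
  apply/eqP/negPn/negP => l0n.
  have hD' x : 1 * lam x + - kap * step_lamm (Some k) rhot (x + eta%:~R) = l0.
    by rewrite hD mul1r /kap mulNr divfK // subrr mul0r scale0r add0r hornerC.
  have [|[j'|] [e S]] := B2_class_const G _ dr wt hu HD hD' l0n; first by lia.
    by apply: (no_const_and_linear G Gt _ _ ET _ S); rewrite -?he //; lia.
  exact: nt.
exists kap.
have L x : lam x = kap * step_lamm (Some k) rhot (x + eta%:~R).
  apply/eqP; rewrite -subr_eq0; apply/eqP; rewrite -[lam x]mul1r -mulNr hD.
  by rewrite mul1r /kap mulNr divfK // subrr mul0r scale0r add0r l00 hornerC.
have U : uniq [:: 1; 0; -1 : int] by [].
split=> //; apply: (contig_unique G hu wt U H).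
by apply: contig_ext (contig_scale kap HC) => // x; rewrite L.
Qed.

End Conclusions.

(** * The classification theorem *)

Section Final.
Variable K : numFieldType.
Implicit Types (rho : racahParam K) (eta : int).
Implicit Types (lam : K -> K) (Phi : int -> nat -> K).

(** The associated relation is a relation from the target to rho with a
    multiplier of degree one: the trivial step followed by the inverse of k. *)
Lemma A2_complete rho eta rhob lamp Phip : generic rho -> (100 <= rN rho)%N ->
  A2_relation lamp Phip rho eta rhob -> ~ (eta = 0 /\ racah_same rhob rho) ->
  exists k : racahCase,
   [/\ eta = case_shift k, racah_same rhob (case_target k rho),
       exists kappa : K, [/\ kappa != 0, forall x, lamp x = kappa &
         forall i : nat, (i <= rN rho)%N ->
           Phip 0 i = kappa * case_Phip k rho 0 i /\
           Phip (-1) i = kappa * case_Phip k rho (-1) i] &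
       forall (lamm : K -> K) (Phim : int -> nat -> K),
         A2_associated lamm Phim rho eta rhob ->
         exists kappa : K,
           (forall x, lamm x = kappa * case_lamm k rho x) /\
           (forall i : nat, (i <= rN rhob)%N ->
              Phim 0 i = kappa * case_Phim k rho 0 i /\
              Phim 1 i = kappa * case_Phim k rho 1 i)].
Proof.
move=> G N100 [_ wb cb H p0] nt; have hu := compat_pu cb.
have hl := contig_lam_const (or_introl erefl) H.
have [|[k|] [e S]] := A2_class G _ wb hu H p0; first by lia.
  2: by case: nt; split=> //; exact: same_racah_same.
rewrite [step_shift _]/= in e; rewrite [step_target _ _]/= in S.
exists k; split=> //; first exact: same_racah_same.
  exists (Phip 0 0%N); split=> // i iN.
  have [[_ _ _ H' _] _] := four_relations (k := k) G (ltac:(lia)).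
  have := contig_scale (Phip 0 0%N) (contig_same_r (same_sym S) H'); rewrite -e => H''.
  have H3 : contiguity [:: 0; -1] lamp (fun e i => Phip 0 0%N * case_Phip k rho e i) rho eta rhob.
    by apply: contig_ext H'' => // x; rewrite mulr1 hl.
  have U : uniq [:: 0; -1 : int] by [].
  by split; apply: (contig_unique G hu wb U H H3).
move=> lamm Phim HA; set rb := case_target k rho in S.
have Gb : generic rb by exact: target_generic.
have HA' := contig_same_l S HA.
have HB := contig_extend (isT : (-1 : int) \notin [:: 1; 0]) HA'.
have [eN _ _] := S.
have Nb : (rN rho - 1 <= rN rb)%N by rewrite /rb target_rN; case: (k) => /=; lia.
have nt' : ~ (- eta = 0 /\ same rho rb).
  move=> [e0 S']; apply: nt; split; first by lia.
  case: S S' => a1 a2 a3 [b1 b2 b3].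
  by apply: same_racah_same; split; rewrite ?a1 ?a2 // => xi i; rewrite a3.
have e' : - eta = step_shift None - case_shift k by rewrite /= sub0r e.
have [||kap [L P]] := @linear_unique _ _ _ rb rho (- eta) None k Gb G _ _ erefl e' nt' HB.
- by lia.
- by rewrite /rb target_rN; lia.
exists kap; split.
  move=> x; have := L (x + eta%:~R); rewrite addrK => ->.
  by rewrite intrN addrK.
move=> i; rewrite eN => iN; split.
  have := P 0 i isT iN; rewrite /= => ->.
  by rewrite /B2_coef /step_P /= mul0r addr0 mul1r.
have := P 1 i isT iN; rewrite /= => ->.
by rewrite /B2_coef /= /step_P /= mul1r.
Qed.

Lemma drop_le2 (m n : nat) : (m%:Z - n%:Z) \in [:: 0; 1; -1; -2; 2 : int] -> (n <= m.+2)%N.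
Proof. by rewrite !inE; lia. Qed.

Lemma B2_nontrivial rho eta rhot lam Phi : generic rho -> (100 <= rN rho)%N ->
  (rN rho <= (rN rhot).+2)%N -> B2_relation lam Phi rho eta rhot ->
  ~ (eta = 0 /\ racah_same rhot rho) -> B2_from_A2 lam Phi rho eta rhot.
Proof.
move=> G N100 dr [_ w cb H [x0 hx0]] nt; have hu := compat_pu cb.
have U : uniq [:: 1; 0; -1 : int] by [].
have [|c [l0 hl]] := contig_lam_affine w _ hu H; first by lia.
have [l1|l1] := eqVneq (Phi 1 0%N * c) 0.
  have hl' x : lam x = l0 by rewrite hl l1 scale0r add0r hornerC.
  have l00 : l0 != 0 by rewrite -(hl' x0).
  have [|j [e S]] := B2_class_const G _ dr w hu H hl' l00; first by lia.
  case: j e S => [j|] e S; last by case: nt; split=> //; exact: same_racah_same.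
  have Gt : generic (step_target (Some j) rho) by exact: step_target_generic.
  have Nt : (0 < rN (step_target (Some j) rho))%N by have [<- _ _] := S; lia.
  apply: (B2_from_steps (j := Some j) (k := None) (kappa := l0) G Gt _ Nt S w) => //.
  + by lia.
  + by rewrite e /= subr0.
  + by move=> x; rewrite mulr1.
  have HC := B2_steps (j := Some j) (k := None) (eta := eta) G Gt (ltac:(lia)) Nt erefl (ltac:(by rewrite e /= subr0)).
  have HC' := contig_scale l0 (contig_same_r (same_sym S) HC).
  apply: (contig_unique G hu w U H).
  by apply: contig_ext HC' => // x; rewrite mulr1 hl'.
have [|j [k [rhot' [e Gt S ET]]]] := B2_class_linear G _ dr w hu H hl l1; first by lia.
have [eN _ _] := S.
have [|||kap [L P]] := linear_unique (j := j) (k := k) G Gt _ _ ET e _ (contig_same_r S H); try lia.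
  move=> [e0 S']; apply: nt; split=> //; apply: same_racah_same.
  by case: S S' => a1 a2 a3 [b1 b2 b3]; split; rewrite ?a1 ?a2 // => xi i; rewrite a3.
by apply: (B2_from_steps (j := j) (k := Some k) (kappa := kap) G Gt _ _ S w) => //; lia.
Qed.

(** The multiplier of the composite through RIII is a multiple of the lattice;
    that of the composite through RIV has a nonzero constant term. *)
Lemma B2_trivial rho rhot lam Phi : generic rho -> (100 <= rN rho)%N ->
  B2_relation lam Phi rho 0 rhot -> racah_same rhot rho ->
  exists (lam1 lam2 : K -> K) (Phi1 Phi2 : int -> nat -> K),
    [/\ B2_from_A2 lam1 Phi1 rho 0 rhot, B2_from_A2 lam2 Phi2 rho 0 rhot,
        forall x, lam x = lam1 x + lam2 x &
        forall (e : int) (i : nat), e \in [:: 1; 0; -1] -> (i <= rN rho)%N ->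
          Phi e i = Phi1 e i + Phi2 e i].
Proof.
move=> G N100 [_ w cb H _] R; have hu := compat_pu cb.
have hu' : pu rhot = pu rho by rewrite hu mulr0 subr0.
have S : same rhot rho by apply: racah_same_same => //; lia.
have U : uniq [:: 1; 0; -1 : int] by [].
have [eN _ _] := S.
have [|c [l0]] := contig_lam_affine w _ hu H; first by lia.
move: (Phi 1 0%N * c) => l1 hl.
have N0 : (0 < rN rho)%N by lia.
have HC k := contig_same_r (same_sym S)
  (B2_steps (j := Some k) (k := Some k) (eta := 0) G G N0 N0 erefl (esym (subrr _))).
have n0 : (rN rho)%:R != 0 :> K by rewrite pnatr_eq0 -lt0n.
have h1 : 1 + rA rho != 0 by apply: (@gen_ne K rho _ 1 1 0 0 G) => //; ring.
have h2 : 1 + rB rho + rC rho != 0 by apply: (@gen_ne K rho _ 1 0 1 1 G) => //; ring.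
have h3 : (rN rho)%:R + rA rho - rC rho + 1 != 0.
  by apply: (@gen_ne K rho _ ((rN rho)%:Z + 1) 1 0 (-1) G) => //; rewrite intrD; ring.
(* [k2] adjusts the constant term, then [k1] the coefficient of the lattice. *)
pose k2 := l0 / ((rN rho)%:R + rA rho - rC rho + 1).
pose k1 := (l1 + k2 / (1 + rA rho)) * ((1 + rA rho) * (1 + rB rho + rC rho) * (rN rho)%:R).
pose lamC k x := case_lamm k rho (x + 0%:~R).
pose C k := B2_coef (Some k) (Some k) rho rho.
have EL x : lam x = k1 * lamC RIII x + k2 * lamC RIV x.
  rewrite hl hornerD hornerZ hornerX hornerC /lamC addr0 /k1 /k2 /lattice.
  case: (rho) n0 h1 h2 h3 => a b c' n /= n0 h1 h2 h3.
  by field; rewrite n0 h1 h2 h3.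
exists (fun x => k1 * lamC RIII x), (fun x => k2 * lamC RIV x),
  (fun e i => k1 * C RIII e i), (fun e i => k2 * C RIV e i); split=> //.
- apply: (B2_from_steps (j := Some RIII) (k := Some RIII) (kappa := k1) G G N0 N0 S w) => //.
- apply: (B2_from_steps (j := Some RIV) (k := Some RIV) (kappa := k2) G G N0 N0 S w) => //.
apply: (contig_unique G hu w U H).
by apply: contig_ext (contig_lin k1 k2 (HC RIII) (HC RIV)) => // x; rewrite EL.
Qed.

Lemma B2'_complete rho eta rhot lam Phi : generic rho -> (100 <= rN rho)%N ->
  (rN rho <= (rN rhot).+2)%N -> B2'_relation lam Phi rho eta rhot ->
  B2'_from_A2 lam Phi rho eta rhot.
Proof.
move=> G N100 dr [_ w cb H [x0 hx0]]; have hu := compat_pu cb.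
have U : uniq [:: 0; -1; -2 : int] by [].
have hl := contig_lam_const (or_intror erefl) H.
have p0 : Phi 0 0%N != 0 by rewrite -(hl x0).
have [|j [k [e S]]] := B2'_class G _ dr w hu H p0; first by lia.
have N1 : (1 < rN rho)%N by lia.
apply: (B2'_from_steps G N1 p0 S w e hl).
have HC := contig_scale (Phi 0 0%N) (contig_same_r (same_sym S) (B2'_steps G N1 e)).
apply: (contig_unique G hu w U H).
by apply: contig_ext HC => // x; rewrite mulr1 hl.
Qed.

End Final.
Theorem mainTheorem15 (K : numFieldType) :
  (* the four relations and their associated relations *)
  (forall (rho : racahParam K) (k : racahCase),
     generic rho -> (lowersN k -> (0 < rN rho)%N) ->
     A2_relation (fun _ => 1) (case_Phip k rho)
       rho (case_shift k) (case_target k rho) /\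
     A2_associated (case_lamm k rho) (case_Phim k rho)
       rho (case_shift k) (case_target k rho)) /\
  (exists N0 : nat, forall rho : racahParam K,
     generic rho -> (N0 <= rN rho)%N ->
     [/\ (* the list is complete and the coefficients are unique *)
         forall (eta : int) (rhob : racahParam K)
                (lamp : K -> K) (Phip : int -> nat -> K),
           eta \in A2_shifts ->
           A2_relation lamp Phip rho eta rhob ->
           ~ (eta = 0 /\ racah_same rhob rho) ->
           exists k : racahCase,
             [/\ eta = case_shift k,
                 racah_same rhob (case_target k rho),
                 exists kappa : K,
                   [/\ kappa != 0,
                       forall x, lamp x = kappa &
                       forall i : nat, (i <= rN rho)%N ->
                         Phip 0 i = kappa * case_Phip k rho 0 i /\
                         Phip (-1) i = kappa * case_Phip k rho (-1) i] &
                 forall (lamm : K -> K) (Phim : int -> nat -> K),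
                   A2_associated lamm Phim rho eta rhob ->
                   exists kappa : K,
                     (forall x, lamm x = kappa * case_lamm k rho x) /\
                     (forall i : nat, (i <= rN rhob)%N ->
                        Phim 0 i = kappa * case_Phim k rho 0 i /\
                        Phim 1 i = kappa * case_Phim k rho 1 i)],
         (* relations of type B2 *)
         forall (eta : int) (rhot : racahParam K)
                (lam : K -> K) (Phi : int -> nat -> K),
           ((rN rhot)%:Z - (rN rho)%:Z) \in [:: 0; 1; -1; -2; 2] ->
           B2_relation lam Phi rho eta rhot ->
           (~ (eta = 0 /\ racah_same rhot rho) ->
              B2_from_A2 lam Phi rho eta rhot) /\
           (* three-term recurrence relations: lam is only determined up to
              an additive constant, a multiple of the trivial relation *)
           (eta = 0 /\ racah_same rhot rho ->
              exists (lam1 lam2 : K -> K) (Phi1 Phi2 : int -> nat -> K),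
                [/\ B2_from_A2 lam1 Phi1 rho eta rhot,
                    B2_from_A2 lam2 Phi2 rho eta rhot,
                    forall x, lam x = lam1 x + lam2 x &
                    forall (e : int) (i : nat),
                      e \in [:: 1; 0; -1] -> (i <= rN rho)%N ->
                      Phi e i = Phi1 e i + Phi2 e i])
       & (* relations of type B2' *)
         forall (eta : int) (rhot : racahParam K)
                (lam : K -> K) (Phi : int -> nat -> K),
           ((rN rhot)%:Z - (rN rho)%:Z) \in [:: 0; 1; -1; -2; 2] ->
           B2'_relation lam Phi rho eta rhot ->
           B2'_from_A2 lam Phi rho eta rhot]).
Proof.
split=> [rho k G h|]; first exact: four_relations.
(* A convenient bound: forty indices common to rho and to the other parameters
   would do for the matching of zeros. *)
exists 100%N => rho G N100; split.
- move=> eta rhob lamp Phip _ H nt; exact: A2_complete H nt.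
- move=> eta rhot lam Phi /drop_le2 dr H; split; first exact: B2_nontrivial.
  by move=> [e R]; rewrite e in H *; apply: B2_trivial.
- by move=> eta rhot lam Phi /drop_le2 dr H; apply: B2'_complete.
Qed.
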